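(* Let $A$ be a locally unital graded algebra that is locally finite-dimensional and bounded below, equipped with a graded triangular basis. Let $V$ be a graded left $A$-module that is locally finite-dimensional and bounded above. (1) The following are equivalent: (a) $V$ has a $\nabla$-flag; (b) $|\operatorname{supp}_\nabla(V)|<\infty$ and $\operatorname{Ext}^1_A(\bar\Delta(b),V)=0$ for all $b\in\mathbf B$; (c) $|\operatorname{supp}_\nabla(V)|<\infty$ and $\operatorname{Ext}^n_A(\bar\Delta(b),V)=0$ for all $b\in\mathbf B$ and $n\geq1$. (2) The following are equivalent: (a) $V$ has a $\bar\nabla$-flag; (b) $|\operatorname{supp}_{\bar\nabla}(V)|<\infty$ and $\operatorname{Ext}^1_A(\Delta(b),V)=0$ for all $b\in\mathbf B$; (c) $|\operatorname{supp}_{\bar\nabla}(V)|<\infty$ and $\operatorname{Ext}^n_A(\Delta(b),V)=0$ for all $b\in\mathbf B$ and $n\geq1$.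
   Context: Conventions. $\Bbbk$ is an algebraically closed field; all algebras, categories and functors are $\Bbbk$-linear; graded means $\mathbb Z$-graded. For a graded vector space $V$, $qV$ is the shift $(qV)_d=V_{d-1}$. A locally unital graded algebra is a graded associative algebra $A=\bigoplus_{i,j\in\mathbf I}1_iA1_j$ with a given family of mutually orthogonal homogeneous idempotents $1_i$ $(i\in\mathbf I)$. Graded left modules are locally unital: $V=\bigoplus_{i}1_iV$. $A$-gmod is the abelian category of graded left $A$-modules with degree-preserving homomorphisms. $\operatorname{Hom}_A(V,W)=\bigoplus_{d\in\mathbb Z}\operatorname{Hom}_A(V,W)_d$, where $\operatorname{Hom}_A(V,W)_d$ is the space of $A$-module homomorphisms $f$ with $f(V_n)\subseteq W_{n+d}$ for all $n$, and $\operatorname{Ext}^n_A(V,W)=\bigoplus_{d}\operatorname{Ext}^n_{A\text{-gmod}}(q^dV,W)$. $V$ is locally finite-dimensional if $\dim 1_iV_d<\infty$ for all $i,d$; it is bounded above if for each $i$ there is $N_i$ with $1_iV_d=0$ for $d>N_i$. $A$ is locally finite-dimensional and bounded below if all $(1_iA1_j)_d$ are finite-dimensional and, for all $i,j$, $(1_iA1_j)_d=0$ for $d\ll 0$. Graded triangular basis. For such $A$ this is the following data: a subset $\mathbf S\subseteq\mathbf I$; a poset $(\Lambda,\leq)$ that is lower finite (each $\{\mu\in\Lambda:\mu\leq\lambda\}$ is finite); a function $\mathbf S\to\Lambda$, $s\mapsto\dot s$, with finite (possibly empty) fibers $\mathbf S_\lambda$; homogeneous sets $\mathrm X(i,s)\subset1_iA1_s$,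 $\mathrm H(s,t)\subset1_sA1_t$, $\mathrm Y(t,j)\subset1_tA1_j$ for $i,j\in\mathbf I$, $s,t\in\mathbf S$. With $\mathrm X(s)=\bigcup_i\mathrm X(i,s)$, $\mathrm Y(t)=\bigcup_j\mathrm Y(t,j)$, the axioms are: (A1) the products $xhy$ for $(x,h,y)\in\bigcup_{s,t\in\mathbf S}\mathrm X(s)\times\mathrm H(s,t)\times\mathrm Y(t)$ form a basis of $A$; (A2) $\mathrm X(s,s)=\mathrm Y(s,s)=\{1_s\}$ for $s\in\mathbf S$; (A3) for $s\neq t$ in $\mathbf S$: $\mathrm X(s,t)\neq\varnothing\Rightarrow\dot s>\dot t$, $\mathrm H(s,t)\neq\varnothing\Rightarrow\dot s=\dot t$, $\mathrm Y(s,t)\neq\varnothing\Rightarrow\dot s<\dot t$; (A4) for each $i\in\mathbf I-\mathbf S$, the sets $\{s\in\mathbf S:\mathrm X(i,s)\neq\varnothing\}$ and $\{s\in\mathbf S:\mathrm Y(s,i)\neq\varnothing\}$ are finite. Functors. For $\lambda\in\Lambda$ let $e_\lambda=\sum_{s\in\mathbf S_\lambda}1_s$; let $A_{\geq\lambda}$ be the quotient of $A$ by the two-sided ideal generated by all $e_\mu$ with $\mu\not\geq\lambda$ (with idempotents the images $\bar1_i$), let $\bar e_\lambda$ be the image of $e_\lambda$ in it, and let $A_\lambda=\bar e_\lambda A_{\geq\lambda}\bar e_\lambda$, a unital graded algebra. Let $j^\lambda:A_{\geq\lambda}\text{-gmod}\to A_\lambda\text{-gmod}$, $V\mapsto\bar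 e_\lambda V$, with left adjoint $j^\lambda_!=A_{\geq\lambda}\bar e_\lambda\otimes_{A_\lambda}-$ and right adjoint $j^\lambda_*=\bigoplus_{i\in\mathbf I}\operatorname{Hom}_{A_\lambda}(\bar e_\lambda A_{\geq\lambda}\bar1_i,-)$. $A_{\geq\lambda}$-modules are viewed as $A$-modules by inflation. Modules. Fix a set $\mathbf B=\coprod_{\lambda\in\Lambda}\mathbf B_\lambda$ such that $L_\lambda(b)$ $(b\in\mathbf B_\lambda)$ is a full set of irreducible graded left $A_\lambda$-modules up to isomorphism and degree shift; write $\dot b=\lambda$ if $b\in\mathbf B_\lambda$. Let $P_\lambda(b)$ be a projective cover of $L_\lambda(b)$ in $A_\lambda$-gmod. For $b\in\mathbf B_\lambda$, $\Delta(b)=j^\lambda_!P_\lambda(b)$ and $\bar\Delta(b)=j^\lambda_!L_\lambda(b)$, viewed as graded $A$-modules. Flags. A $\nabla$-layer (resp. $\bar\nabla$-layer) of type $\lambda$ is a graded $A$-module isomorphic to $j^\lambda_*\bar V$ for an injective (resp. arbitrary) graded left $A_\lambda$-module $\bar V$ that is locally finite-dimensional and bounded above. $V$ has a $\nabla$-flag (resp. $\bar\nabla$-flag) if for some $n\geq0$ there is a graded filtration $V=V_0\supset V_1\supset\dots\supset V_n=0$ and distinct weights $\lambda_1,\dots,\lambda_n\in\Lambda$ such that $V_{r-1}/V_r$ is a $\nabla$-layer (resp. $\bar\nabla$-layer) of type $\lambda_r$ for each $r$. Supports. $\operatorname{supp}_\nabla(V)=\{\dot b: b\in\mathbf B,\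 \operatorname{Hom}_A(\bar\Delta(b),V)\neq0\}$ and $\operatorname{supp}_{\bar\nabla}(V)=\{\dot b: b\in\mathbf B,\ \operatorname{Hom}_A(\Delta(b),V)\neq0\}$. *)

(* Defs.v *)
From HB Require Import structures.
From mathcomp Require Import all_boot all_order all_algebra.
From mathcomp Require Import all_classical.
From mathcomp Require Import freeg.

Set Implicit Arguments.
Unset Strict Implicit.
Unset Printing Implicit Defensive.

Import Order.TTheory GRing.Theory Num.Theory.

Local Open Scope classical_set_scope.
Local Open Scope ring_scope.

Record subspace (k : fieldType) (V : lmodType k) := Subspace {
  ss_set :> V -> Prop;
  ss0 : ss_set 0;
  ssL : forall (c : k) u v, ss_set u -> ss_set v -> ss_set (c *: u + v) }.

Section SubQuo.
Context (k : fieldType) (V : lmodType k).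
Implicit Types S : subspace V.

Lemma ssD S u v : S u -> S v -> S (u + v).
Proof. by move=> hu hv; rewrite -[u]scale1r; exact: ssL. Qed.

Lemma ssZ S c u : S u -> S (c *: u).
Proof. by move=> hu; rewrite -[_ *: _]addr0; apply: ssL => //; exact: ss0. Qed.

Lemma ssN S u : S u -> S (- u).
Proof. by move=> hu; rewrite -scaleN1r; exact: ssZ. Qed.

Lemma ssB S u v : S u -> S v -> S (u - v).
Proof. by move=> hu hv; apply: ssD => //; exact: ssN. Qed.

Lemma ss_sum S (T : Type) (s : seq T) (P : pred T) (f : T -> V) :
  (forall t, P t -> S (f t)) -> S (\sum_(t <- s | P t) f t).
Proof. by move=> h; elim/big_ind: _ => // [|u v]; [exact: ss0 | exact: ssD]. Qed.

Lemma ss_sum_seq S (T : eqType) (s : seq T) (f : T -> V) :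
  (forall t, t \in s -> S (f t)) -> S (\sum_(t <- s) f t).
Proof. by move=> h; rewrite big_seq; apply: ss_sum. Qed.

Variable S : subspace V.

Definition ss_pred : {pred V} := fun v => `[< S v >].

Lemma ss_predP v : reflect (S v) (v \in ss_pred).
Proof. exact: asboolP. Qed.

Lemma ss_pred_closed : submod_closed ss_pred.
Proof.
split; first by apply/ss_predP; exact: ss0.
by move=> c u v /ss_predP hu /ss_predP hv; apply/ss_predP; exact: ssL.
Qed.

HB.instance Definition _ := GRing.isSubmodClosed.Build k V ss_pred ss_pred_closed.

Record sub_type := SubType { sub_val : V; _ : sub_val \in ss_pred }.
HB.instance Definition _ := [isSub for sub_val].
HB.instance Definition _ := [Choice of sub_type by <:].
HB.instance Definition _ := [SubChoice_isSubLmodule of sub_type by <:].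
Definition sub_lmod : lmodType k := sub_type.

Definition ssub (v : V) (hv : S v) : sub_lmod := SubType (introT (ss_predP v) hv).

Lemma sub_valP (x : sub_lmod) : S (sub_val x).
Proof. by case: x => v /= /ss_predP. Qed.

Lemma sub_valL c (x y : sub_lmod) :
  sub_val (c *: x + y) = c *: sub_val x + sub_val y.
Proof. by []. Qed.

Lemma sub_val_inj (x y : sub_lmod) : sub_val x = sub_val y -> x = y.
Proof. exact: val_inj. Qed.

Definition quo_type := Quotient.quot ss_pred.
HB.instance Definition _ := GRing.Zmodule.on quo_type.
Definition qpi (v : V) : quo_type := (\pi_(Quotient.quot ss_pred) v)%qT.
Definition qrepr (x : quo_type) : V := repr (x : Quotient.quot ss_pred).

Lemma qreprK x : qpi (qrepr x) = x. Proof. exact: reprK. Qed.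

Lemma qpi_eq u v : qpi u = qpi v <-> S (u - v).
Proof.
by split=> [h|/ss_predP h]; [apply/ss_predP|];
  [rewrite Quotient.idealrBE; apply/eqP | apply/eqP; rewrite -Quotient.idealrBE].
Qed.

Lemma qpiD u v : qpi (u + v) = qpi u + qpi v.
Proof. by rewrite /qpi !piE. Qed.

Definition quo_scale (c : k) (x : quo_type) : quo_type := qpi (c *: qrepr x).

Lemma quo_scaleE c v : quo_scale c (qpi v) = qpi (c *: v).
Proof. by apply/qpi_eq; rewrite -scalerBr; apply/ssZ/qpi_eq; rewrite qreprK. Qed.

Fact quo_scaleA a b x : quo_scale a (quo_scale b x) = quo_scale (a * b) x.
Proof. by rewrite -[x]qreprK !quo_scaleE scalerA. Qed.
Fact quo_scale1 x : quo_scale 1 x = x.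
Proof. by rewrite -[x]qreprK !quo_scaleE scale1r. Qed.
Fact quo_scaleDr a x y : quo_scale a (x + y) = quo_scale a x + quo_scale a y.
Proof. by rewrite -[x]qreprK -[y]qreprK -qpiD !quo_scaleE -qpiD scalerDr. Qed.
Fact quo_scaleDl x a b : quo_scale (a + b) x = quo_scale a x + quo_scale b x.
Proof. by rewrite -[x]qreprK !quo_scaleE -qpiD scalerDl. Qed.

HB.instance Definition _ := GRing.Zmodule_isLmodule.Build k quo_type
  quo_scaleA quo_scale1 quo_scaleDr quo_scaleDl.
Definition quo_lmod : lmodType k := quo_type.

Lemma qpiL c u v : qpi (c *: u + v) = c *: (qpi u : quo_lmod) + qpi v.
Proof. by rewrite qpiD; congr (_ + _); rewrite -quo_scaleE. Qed.

Lemma qpi0 : qpi 0 = 0 :> quo_lmod.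
Proof. by rewrite /qpi !piE. Qed.

Lemma qpi_eq0 u : (qpi u = 0 :> quo_lmod) <-> S u.
Proof. by rewrite -qpi0 qpi_eq subr0. Qed.

End SubQuo.

Arguments ss_pred {k V} S.
Arguments qpi {k V} S v.
Arguments qpi_eq {k V} S u v.
Arguments qpi_eq0 {k V} S u.

Section Linear.
Context (k : fieldType).

Lemma lin0 (U V : lmodType k) (f : U -> V) : linear f -> f 0 = 0.
Proof.
move=> h; have := h 0 0 0; rewrite !scale0r !add0r => e.
by apply: (@addrI _ (f 0)); rewrite addr0 -{1}[f 0]scale1r -h scale1r addr0.
Qed.

Lemma linD (U V : lmodType k) (f : U -> V) u v : linear f -> f (u + v) = f u + f v.
Proof. by move=> h; have := h 1 u v; rewrite !scale1r. Qed.

Lemma linZ (U V : lmodType k) (f : U -> V) c u : linear f -> f (c *: u) = c *: f u.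
Proof. by move=> h; have := h c u 0; rewrite (lin0 h) !addr0. Qed.

Lemma linB (U V : lmodType k) (f : U -> V) u v : linear f -> f (u - v) = f u - f v.
Proof. by move=> h; rewrite linD // -scaleN1r linZ // scaleN1r. Qed.

Lemma lin_sum (U V : lmodType k) (f : U -> V) (T : Type) (s : seq T) (P : pred T)
  (g : T -> U) : linear f -> f (\sum_(t <- s | P t) g t) = \sum_(t <- s | P t) f (g t).
Proof. by move=> h; apply: big_morph => [u v|]; [exact: linD | exact: lin0]. Qed.

Variable V : lmodType k.

Lemma span_closed0 (P : set V) : exists l : seq (k * V),
  (forall p, p \in l -> P p.2) /\ 0 = \sum_(p <- l) p.1 *: p.2.
Proof. by exists [::]; rewrite big_nil. Qed.

Lemma span_closedL (P : set V) (c : k) u v :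
  (exists l : seq (k * V),
    (forall p, p \in l -> P p.2) /\ u = \sum_(p <- l) p.1 *: p.2) ->
  (exists l : seq (k * V),
    (forall p, p \in l -> P p.2) /\ v = \sum_(p <- l) p.1 *: p.2) ->
  exists l : seq (k * V),
    (forall p, p \in l -> P p.2) /\ c *: u + v = \sum_(p <- l) p.1 *: p.2.
Proof.
move=> [l [hl ->]] [l' [hl' ->]]; exists ([seq (c * p.1, p.2) | p <- l] ++ l'); split.
  by move=> p; rewrite mem_cat => /orP[/mapP[q /hl hq ->] //|/hl'].
rewrite big_cat big_map /= scaler_sumr; congr (_ + _).
by apply: eq_bigr => p _; rewrite scalerA.
Qed.

Definition span (P : set V) : subspace V :=
  Subspace (span_closed0 P) (@span_closedL P).

Lemma span_sub (P : set V) v : P v -> span P v.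
Proof.
move=> h; exists [:: (1, v)]; rewrite big_seq1 scale1r; split=> // p.
by rewrite inE => /eqP ->.
Qed.

Lemma span_min (P : set V) (S : subspace V) : P `<=` S -> span P `<=` S.
Proof. by move=> h v [l [hl ->]]; apply: ss_sum_seq => p /hl/h; exact: ssZ. Qed.

Lemma span_mono (P Q : set V) : P `<=` Q -> span P `<=` span Q.
Proof. by move=> h; apply: span_min => v /h; exact: span_sub. Qed.

Definition full_ss : subspace V := @Subspace k V setT I (fun _ _ _ _ _ => I).

Lemma zero_ssL (c : k) (u v : V) : u = 0 -> v = 0 -> c *: u + v = 0.
Proof. by move=> -> ->; rewrite scaler0 addr0. Qed.
Definition zero_ss : subspace V := @Subspace k V [set 0] (erefl _) zero_ssL.

End Linear.

Arguments span {k V} P.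

Section ImPreim.
Context (k : fieldType) (U V : lmodType k) (f : U -> V) (hf : linear f).

Lemma im_ss0 (S : subspace U) : (f @` S) 0.
Proof. by exists 0; [exact: ss0 | exact: lin0]. Qed.
Lemma im_ssL (S : subspace U) c u v :
  (f @` S) u -> (f @` S) v -> (f @` S) (c *: u + v).
Proof. by move=> [x hx <-] [y hy <-]; exists (c *: x + y); [exact: ssL | exact: hf]. Qed.
Definition im_ss (S : subspace U) : subspace V := Subspace (im_ss0 S) (@im_ssL S).

Lemma pre_ss0 (S : subspace V) : (f @^-1` S) 0.
Proof. by rewrite /preimage /mkset lin0 //; exact: ss0. Qed.
Lemma pre_ssL (S : subspace V) c u v :
  (f @^-1` S) u -> (f @^-1` S) v -> (f @^-1` S) (c *: u + v).
Proof. by rewrite /preimage /mkset hf; exact: ssL. Qed.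
Definition pre_ss (S : subspace V) : subspace U := Subspace (pre_ss0 S) (@pre_ssL S).

End ImPreim.

(* S / (S ∩ N) *)
Definition subquo_lmod (k : fieldType) (V : lmodType k) (S N : subspace V) : lmodType k :=
  quo_lmod (pre_ss (@sub_valL k V S) N).

Definition fin_dim (k : fieldType) (V : lmodType k) (S : set V) :=
  exists l : seq V, S `<=` span [set` l].

Definition basis_family (k : fieldType) (V : lmodType k) (T : choiceType)
    (D : set T) (f : T -> V) :=
  (forall v, span (f @` D) v) /\
  (forall (s : seq T) (c : T -> k), uniq s -> (forall t, t \in s -> D t) ->
     \sum_(t <- s) c t *: f t = 0 -> forall t, t \in s -> c t = 0).

Definition is_grading (k : fieldType) (V : lmodType k) (F : int -> subspace V) :=
  (forall v, exists (s : seq int) (c : int -> V),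
     [/\ uniq s, forall d, F d (c d) & v = \sum_(d <- s) c d]) /\
  (forall (s : seq int) (c : int -> V), uniq s -> (forall d, F d (c d)) ->
     \sum_(d <- s) c d = 0 -> forall d, d \in s -> c d = 0).

Definition homogeneous (k : fieldType) (V : lmodType k) (F : int -> subspace V) : set V :=
  [set v | exists d, F d v].

Lemma big_ext (V : nmodType) (T : eqType) (s t : seq T) (f : T -> V) :
  uniq s -> uniq t -> {subset s <= t} ->
  \sum_(x <- t) (if x \in s then f x else 0) = \sum_(x <- s) f x.
Proof.
move=> us ut st; rewrite -big_mkcond -big_filter; apply: perm_big.
apply: uniq_perm => //; first exact: filter_uniq.
by move=> x; rewrite mem_filter; case: (boolP (x \in s)) => // /st ->.
Qed.

Section Grading.
Context (k : fieldType) (V : lmodType k) (F : int -> subspace V).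
Hypothesis hF : is_grading F.

Let ext (s : seq int) (c : int -> V) d := if d \in s then c d else 0.

Lemma gr_uniq s s' c c' : uniq s -> uniq s' -> (forall d, F d (c d)) ->
  (forall d, F d (c' d)) -> \sum_(d <- s) c d = \sum_(d <- s') c' d ->
  ext s c =1 ext s' c'.
Proof.
move=> us us' hc hc' e d.
pose t := undup (s ++ s').
have ut : uniq t by exact: undup_uniq.
have st : {subset s <= t} by move=> x; rewrite mem_undup mem_cat => ->.
have st' : {subset s' <= t} by move=> x; rewrite mem_undup mem_cat orbC => ->.
have /(hF.2 _ _ ut) h : forall d, F d (ext s c d - ext s' c' d).
  by move=> x; apply: ssB; rewrite /ext; case: ifP => // _; exact: ss0.
case: (boolP (d \in t)) => [dt|]; last first.
  by rewrite mem_undup mem_cat negb_or /ext => /andP[/negbTE -> /negbTE ->].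
apply/eqP; rewrite -subr_eq0; apply/eqP; apply: h => //.
by rewrite big_split sumrN /ext /= !big_ext // e subrr.
Qed.

Let dec v := cid (hF.1 v).
Let supp v := projT1 (dec v).
Let cmp v := projT1 (cid (projT2 (dec v))).

(* the projections onto the summands of the grading *)
Definition gr_pr d v := ext (supp v) (cmp v) d.

Lemma gr_cmpP v : [/\ uniq (supp v), forall d, F d (cmp v d) &
  v = \sum_(d <- supp v) cmp v d].
Proof. exact: (projT2 (cid (projT2 (dec v)))). Qed.

Lemma gr_pr_eq v s c : uniq s -> (forall d, F d (c d)) -> v = \sum_(d <- s) c d ->
  forall d, gr_pr d v = if d \in s then c d else 0.
Proof.
move=> us hc e; have [u h ev] := gr_cmpP v.
by apply: gr_uniq => //; rewrite -ev.
Qed.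

Lemma gr_prP d v : F d (gr_pr d v).
Proof.
by have [_ h _] := gr_cmpP v; rewrite /gr_pr /ext; case: ifP => // _; exact: ss0.
Qed.

Lemma gr_pr_sum v : exists s : seq int, forall t, uniq t -> {subset s <= t} ->
  v = \sum_(d <- t) gr_pr d v.
Proof.
have [u h ev] := gr_cmpP v; exists (supp v) => t ut st.
by rewrite {1}ev /gr_pr /ext big_ext.
Qed.

Lemma gr_pr_id d v : F d v -> gr_pr d v = v.
Proof.
move=> h; rewrite (@gr_pr_eq v [:: d] (fun e => if e == d then v else 0)) //.
- by rewrite inE eqxx.
- by move=> e; case: eqP => [->|_] //; exact: ss0.
- by rewrite big_seq1 eqxx.
Qed.

Lemma gr_pr_ne d e v : d != e -> F d v -> gr_pr e v = 0.
Proof.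
move=> ne h; rewrite (@gr_pr_eq v [:: d] (fun e => if e == d then v else 0)) //.
- by rewrite inE eq_sym (negbTE ne).
- by move=> e'; case: eqP => [->|_] //; exact: ss0.
- by rewrite big_seq1 eqxx.
Qed.

Lemma gr_pr_lin d : linear (gr_pr d).
Proof.
move=> c u v.
have [su hu] := gr_pr_sum u; have [sv hv] := gr_pr_sum v.
pose t := undup (d :: su ++ sv).
have ut : uniq t by exact: undup_uniq.
have hu' := hu t ut; have hv' := hv t ut.
rewrite (@gr_pr_eq _ t (fun d => c *: gr_pr d u + gr_pr d v)) //.
- by rewrite mem_undup inE eqxx.
- by move=> e; apply: ssL; exact: gr_prP.
- rewrite big_split /= -scaler_sumr -hu' -?hv' // => x hx;
  by rewrite mem_undup inE mem_cat hx ?orbT.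
Qed.

(* a subspace spanned by homogeneous elements is stable under the projections *)
Lemma gr_pr_stable (N : subspace V) :
  N `<=` span (N `&` homogeneous F) -> forall d v, N v -> N (gr_pr d v).
Proof.
move=> h d v /h; apply: (@span_min _ _ _ (pre_ss (@gr_pr_lin d) N)).
move=> x [nx [e he]]; rewrite /= /preimage /=.
by case: (eqVneq e d) => [<-|ne]; [rewrite gr_pr_id | rewrite (gr_pr_ne ne) //; exact: ss0].
Qed.

Lemma gr_stable_hom (N : subspace V) :
  (forall d v, N v -> N (gr_pr d v)) -> N `<=` span (N `&` homogeneous F).
Proof.
move=> h v nv; have [s /(_ _ (undup_uniq s)) ->] := gr_pr_sum v.
  by apply: ss_sum_seq => d _; apply: span_sub; split; [exact: h | exists d; exact: gr_prP].
by move=> x; rewrite mem_undup.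
Qed.

Lemma gr_span v : span (homogeneous F) v.
Proof. by apply: span_mono (gr_stable_hom (N := full_ss V) _ I) => // x []. Qed.

Definition sub_gr (N : subspace V) d : subspace (sub_lmod N) :=
  pre_ss (@sub_valL k V N) (F d).

Lemma sub_is_grading (N : subspace V) :
  N `<=` span (N `&` homogeneous F) -> is_grading (sub_gr N).
Proof.
move=> /gr_pr_stable h; split.
  move=> x; have [s /(_ _ (undup_uniq s)) e] := gr_pr_sum (sub_val x).
  exists (undup s), (fun d => ssub (h d _ (sub_valP x))); split=> [|d|].
  - exact: undup_uniq.
  - exact: gr_prP.
  - apply: sub_val_inj; rewrite (lin_sum _ _ _ (@sub_valL k V N)) /=.
    by apply: e => y; rewrite mem_undup.
move=> s c us hc e d ds; apply: sub_val_inj.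
apply: (hF.2 s (fun d => sub_val (c d)) us _ _ _ ds); first exact: hc.
by rewrite -(lin_sum _ _ _ (@sub_valL k V N)) e.
Qed.

Definition quo_gr (N : subspace V) d : subspace (quo_lmod N) :=
  im_ss (@qpiL k V N) (F d).

Lemma quo_is_grading (N : subspace V) :
  N `<=` span (N `&` homogeneous F) -> is_grading (quo_gr N).
Proof.
move=> /gr_pr_stable h; split.
  move=> x; have [s /(_ _ (undup_uniq s)) e] := gr_pr_sum (qrepr x).
  exists (undup s), (fun d => qpi N (gr_pr d (qrepr x))); split=> [|d|].
  - exact: undup_uniq.
  - by exists (gr_pr d (qrepr x)) => //; exact: gr_prP.
  - rewrite -(lin_sum _ _ _ (@qpiL k V N)) -e ?qreprK // => y.
    by rewrite mem_undup.
move=> s c us hc e d ds.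
pose c' d := projT1 (cid2 (hc d)).
have hc1 d' : F d' (c' d') by rewrite /c'; case: (cid2 _).
have hc2 d' : qpi N (c' d') = c d' by rewrite /c'; case: (cid2 _).
rewrite -hc2; apply/qpi_eq0.
have : N (\sum_(d <- s) c' d).
  by apply/qpi_eq0; rewrite (lin_sum _ _ _ (@qpiL k V N)) -[RHS]e; apply: eq_bigr.
by move/(h d); rewrite (@gr_pr_eq _ s c') // ds.
Qed.

End Grading.

Arguments homogeneous {k V} F.

(* existence of local units, for a family E of orthogonal idempotent operators *)
Section LocalUnits.
Context (k : fieldType) (V : lmodType k) (I : eqType) (E : I -> V -> V).
Hypothesis E_lin : forall i, linear (E i).
Hypothesis E_orth : forall i j v, E i (E j v) = if i == j then E j v else 0.

Definition locally_unital v := exists s : seq I, uniq s /\ v = \sum_(i <- s) E i v.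

Lemma lu_ext (s t : seq I) v : uniq s -> uniq t -> {subset s <= t} ->
  v = \sum_(i <- s) E i v -> v = \sum_(i <- t) E i v.
Proof.
move=> us ut st e; rewrite {1}e -(big_ext _ us ut st); apply: eq_bigr => i _.
case: ifPn => // his; rewrite e lin_sum // big_seq big1 // => j hj.
by rewrite E_orth; case: eqP hj his => // <- ->.
Qed.

Lemma lu_closed0 : locally_unital 0.
Proof. by exists [::]; rewrite big_nil. Qed.

Lemma lu_closedL c u v : locally_unital u -> locally_unital v ->
  locally_unital (c *: u + v).
Proof.
move=> [s [us hs]] [t [ut ht]]; exists (undup (s ++ t)); split; first exact: undup_uniq.
have hu := @lu_ext s (undup (s ++ t)) u us (undup_uniq _) _ hs.
have hv := @lu_ext t (undup (s ++ t)) v ut (undup_uniq _) _ ht.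
under eq_bigr do rewrite E_lin.
by rewrite big_split /= -scaler_sumr -hu -?hv // => x hx;
  rewrite mem_undup mem_cat hx ?orbT.
Qed.

Definition lu_ss : subspace V := Subspace lu_closed0 lu_closedL.

Lemma lu_fixed i v : E i v = v -> locally_unital v.
Proof. by move=> h; exists [:: i]; rewrite big_seq1. Qed.

End LocalUnits.

Arguments locally_unital {k V I} E v.

Reserved Notation "a ** b" (at level 40, left associativity).
Reserved Notation "a |> v" (at level 41, right associativity).

Record lualg (k : fieldType) := LUAlg {
  la_car :> lmodType k;
  la_idx : choiceType;
  la_mul : la_car -> la_car -> la_car;
  la_one : la_idx -> la_car;
  la_deg : int -> subspace la_car;
  la_mulLl : forall b, linear (la_mul^~ b);
  la_mulLr : forall a, linear (la_mul a);
  la_mulA : forall a b c, la_mul a (la_mul b c) = la_mul (la_mul a b) c;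
  la_orth : forall i j, la_mul (la_one i) (la_one j) = if i == j then la_one i else 0;
  la_unital : forall a, exists s : seq la_idx, uniq s /\
    a = \sum_(i <- s) \sum_(j <- s) la_mul (la_mul (la_one i) a) (la_one j);
  la_graded : is_grading la_deg;
  la_degM : forall m n a b, la_deg m a -> la_deg n b -> la_deg (m + n) (la_mul a b);
  la_deg1 : forall i, la_deg 0 (la_one i) }.

Arguments la_one {k} l i.
Arguments la_deg {k} l d.
Notation "a ** b" := (la_mul a b) : ring_scope.

Record gmod (k : fieldType) (A : lualg k) := GMod {
  gm_car :> lmodType k;
  gm_act : A -> gm_car -> gm_car;
  gm_deg : int -> subspace gm_car;
  gm_actLl : forall v, linear (gm_act^~ v);
  gm_actLr : forall a, linear (gm_act a);
  gm_actA : forall a b v, gm_act a (gm_act b v) = gm_act (a ** b) v;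
  gm_unital : forall v, locally_unital (fun i => gm_act (la_one A i)) v;
  gm_graded : is_grading gm_deg;
  gm_degM : forall m n a v, la_deg A m a -> gm_deg n v -> gm_deg (m + n) (gm_act a v) }.

Arguments gm_deg {k A} g d.
Notation "a |> v" := (gm_act a v) : ring_scope.

Section AlgLemmas.
Context (k : fieldType) (A : lualg k).
Implicit Types a b c : A.

Lemma mulA0 a : a ** 0 = 0. Proof. exact: lin0 (la_mulLr a). Qed.
Lemma mul0A a : 0 ** a = 0. Proof. exact: lin0 (la_mulLl a). Qed.
Lemma mulA_suml (T : Type) (s : seq T) (P : pred T) (f : T -> A) b :
  (\sum_(t <- s | P t) f t) ** b = \sum_(t <- s | P t) f t ** b.
Proof. exact: lin_sum (la_mulLl b). Qed.
Lemma mulA_sumr (T : Type) (s : seq T) (P : pred T) (f : T -> A) b :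
  b ** (\sum_(t <- s | P t) f t) = \sum_(t <- s | P t) b ** f t.
Proof. exact: lin_sum (la_mulLr b). Qed.

Lemma act_one_lin (V : gmod A) i : linear (fun v : V => la_one A i |> v).
Proof. exact: gm_actLr. Qed.

Lemma act_orth (V : gmod A) i j (v : V) :
  la_one A i |> la_one A j |> v = if i == j then la_one A j |> v else 0.
Proof.
rewrite gm_actA la_orth; case: eqP => [->|_] //.
exact: lin0 (gm_actLl v).
Qed.

Lemma la_one_orth i j a :
  la_one A i ** (la_one A j ** a) = if i == j then la_one A j ** a else 0.
Proof. by rewrite la_mulA la_orth; case: eqP => [->|_] //; exact: mul0A. Qed.

Lemma la_unitl a : locally_unital (fun i => la_mul (la_one A i)) a.
Proof.
have [s [us e]] := la_unital a; rewrite e.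
apply: (ss_sum (S := lu_ss (fun i => la_mulLr (la_one A i)) la_one_orth)) => i _.
apply: ss_sum => j _; apply: (@lu_fixed _ _ _ _ i).
by rewrite -la_mulA la_one_orth eqxx.
Qed.

End AlgLemmas.

(* A two-sided ideal, resp. a submodule, is graded when it is spanned by the
   homogeneous elements it contains. *)
Record gideal (k : fieldType) (A : lualg k) := GIdeal {
  gi_ss :> subspace A;
  gi_mull : forall a x, gi_ss x -> gi_ss (a ** x);
  gi_mulr : forall a x, gi_ss x -> gi_ss (x ** a);
  gi_hom : gi_ss `<=` span (gi_ss `&` homogeneous (la_deg A)) }.

Record gsubmod (k : fieldType) (A : lualg k) (V : gmod A) := GSubmod {
  gs_ss :> subspace V;
  gs_act : forall a x, gs_ss x -> gs_ss (a |> x);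
  gs_hom : gs_ss `<=` span (gs_ss `&` homogeneous (gm_deg V)) }.

Section GenIdeal.
Context (k : fieldType) (A : lualg k) (G : set A).
Hypothesis G_hom : G `<=` homogeneous (la_deg A).

Definition gen_set : set A := [set a | forall S : subspace A,
  (forall b x, S x -> S (b ** x)) -> (forall b x, S x -> S (x ** b)) ->
  G `<=` S -> S a].

Lemma gen_set0 : gen_set 0.
Proof. by move=> S _ _ _; exact: ss0. Qed.
Lemma gen_setL c a b : gen_set a -> gen_set b -> gen_set (c *: a + b).
Proof. by move=> ha hb S h1 h2 h3; apply: ssL; [exact: ha | exact: hb]. Qed.
Definition gen_ss : subspace A := Subspace gen_set0 gen_setL.

Lemma gen_mull a x : gen_ss x -> gen_ss (a ** x).
Proof. by move=> hx S h1 h2 h3; apply: (h1); exact: hx. Qed.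
Lemma gen_mulr a x : gen_ss x -> gen_ss (x ** a).
Proof. by move=> hx S h1 h2 h3; apply: (h2); exact: hx. Qed.
Lemma gen_sub : G `<=` gen_ss.
Proof. by move=> x gx S _ _; exact. Qed.

Lemma gen_hom : gen_ss `<=` span (gen_ss `&` homogeneous (la_deg A)).
Proof.
set T := span _ => a ha; apply: ha => [b x|b x|x gx].
- have hb := gr_span (la_graded A) b.
  move=> tx; apply: (@span_min _ _ _ (pre_ss (la_mulLl x) T) _ b hb) => y [m hy].
  apply: (@span_min _ _ _ (pre_ss (la_mulLr y) T) _ x tx) => z [gz [n hz]].
  apply: span_sub; split; first exact: gen_mull.
  by exists (m + n); exact: la_degM.
- have hb := gr_span (la_graded A) b.
  move=> tx; apply: (@span_min _ _ _ (pre_ss (la_mulLr x) T) _ b hb) => y [m hy].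
  apply: (@span_min _ _ _ (pre_ss (la_mulLl y) T) _ x tx) => z [gz [n hz]].
  apply: span_sub; split; first exact: gen_mulr.
  by exists (n + m); exact: la_degM.
- by apply: span_sub; split; [exact: gen_sub | exact: G_hom].
Qed.

Definition gen_ideal : gideal A := GIdeal gen_mull gen_mulr gen_hom.

End GenIdeal.

Section QuoAlg.
Context (k : fieldType) (A : lualg k) (J : gideal A).
Local Notation Q := (quo_lmod J).
Local Notation pi := (qpi J : A -> Q).

Definition quo_mul (x y : Q) : Q := pi (qrepr x ** qrepr y).

Lemma quo_mulE a b : quo_mul (pi a) (pi b) = pi (a ** b).
Proof.
apply/qpi_eq.
have ha : J (qrepr (pi a) - a) by apply/qpi_eq; rewrite qreprK.
have hb : J (qrepr (pi b) - b) by apply/qpi_eq; rewrite qreprK.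
set a' := qrepr _ in ha *; set b' := qrepr _ in hb *.
rewrite -(subrK (a ** b') (a' ** b')) -addrA; apply: ssD.
  by rewrite -(linB _ _ (la_mulLl b')); exact: gi_mulr.
by rewrite -(linB _ _ (la_mulLr a)); exact: gi_mull.
Qed.

Lemma quo_mulLl y : linear (quo_mul^~ y).
Proof.
move=> c x x'; rewrite /= -[x]qreprK -[x']qreprK -[y]qreprK.
by rewrite -qpiL !quo_mulE la_mulLl qpiL.
Qed.
Lemma quo_mulLr x : linear (quo_mul x).
Proof.
move=> c y y'; rewrite /= -[x]qreprK -[y]qreprK -[y']qreprK.
by rewrite -qpiL !quo_mulE la_mulLr qpiL.
Qed.
Lemma quo_mulA x y z : quo_mul x (quo_mul y z) = quo_mul (quo_mul x y) z.
Proof. by rewrite -[x]qreprK -[y]qreprK -[z]qreprK !quo_mulE la_mulA. Qed.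

Definition quo_one i : Q := pi (la_one A i).

Lemma quo_orth i j : quo_mul (quo_one i) (quo_one j) = if i == j then quo_one i else 0.
Proof. by rewrite quo_mulE la_orth; case: eqP => // _; exact: qpi0. Qed.

Lemma quo_unital (x : Q) : exists s : seq (la_idx A), uniq s /\ x = \sum_(i <- s) \sum_(j <- s) quo_mul (quo_mul (quo_one i) x) (quo_one j).
Proof.
have [s [us e]] := la_unital (qrepr x); exists s; split=> //.
rewrite -[LHS]qreprK {1}e (lin_sum _ _ _ (@qpiL k A J)); apply: eq_bigr => i _.
rewrite (lin_sum _ _ _ (@qpiL k A J)); apply: eq_bigr => j _.
by rewrite /quo_one -[x in RHS]qreprK !quo_mulE.
Qed.

Lemma quo_degM m n x y : quo_gr (la_deg A) J m x -> quo_gr (la_deg A) J n y ->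
  quo_gr (la_deg A) J (m + n) (quo_mul x y).
Proof.
move=> [a ha <-] [b hb <-]; rewrite quo_mulE.
by exists (a ** b) => //; exact: la_degM.
Qed.

Lemma quo_deg1 i : quo_gr (la_deg A) J 0 (quo_one i).
Proof. by exists (la_one A i) => //; exact: la_deg1. Qed.

Definition quo_alg : lualg k := LUAlg quo_mulLl quo_mulLr quo_mulA quo_orth
  quo_unital (quo_is_grading (la_graded A) (@gi_hom _ _ J)) quo_degM quo_deg1.

Definition quo_proj : A -> quo_alg := pi.

Lemma quo_projM a b : quo_proj (a ** b) = quo_proj a ** quo_proj b.
Proof. by rewrite /quo_proj -quo_mulE. Qed.

Section Inflation.
Context (V : gmod quo_alg).
Let act (a : A) (v : V) := quo_proj a |> v.

Lemma infl_actLl v : linear (act^~ v).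
Proof. by move=> c a b; rewrite /act /= /quo_proj qpiL gm_actLl. Qed.
Lemma infl_actLr a : linear (act a).
Proof. exact: gm_actLr. Qed.
Lemma infl_actA a b v : act a (act b v) = act (a ** b) v.
Proof. by rewrite /act gm_actA quo_projM. Qed.
Lemma infl_degM m n a v : la_deg A m a -> gm_deg V n v -> gm_deg V (m + n) (act a v).
Proof. by move=> ha; apply: (@gm_degM _ quo_alg); exists a. Qed.

Definition inflate : gmod A := GMod infl_actLl infl_actLr infl_actA
  (@gm_unital _ _ V) (gm_graded V) infl_degM.
End Inflation.

End QuoAlg.

Arguments quo_proj {k A} J a.

Section SubQuoMod.
Context (k : fieldType) (A : lualg k) (V : gmod A) (N : gsubmod V).

Section Sub.
Let act (a : A) (x : sub_lmod N) : sub_lmod N := ssub (gs_act a (sub_valP x)).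

Lemma sub_actLl v : linear (act^~ v).
Proof. by move=> c a b; apply: sub_val_inj; exact: gm_actLl. Qed.
Lemma sub_actLr a : linear (act a).
Proof. by move=> c x y; apply: sub_val_inj; exact: gm_actLr. Qed.
Lemma sub_actA a b v : act a (act b v) = act (a ** b) v.
Proof. by apply: sub_val_inj; rewrite /= gm_actA. Qed.
Lemma sub_unital v : locally_unital (fun i => act (la_one A i)) v.
Proof.
have [s [us e]] := gm_unital (sub_val v); exists s; split=> //.
by apply: sub_val_inj; rewrite (lin_sum _ _ _ (@sub_valL _ _ _)).
Qed.
Lemma sub_degM m n a v : la_deg A m a -> sub_gr (gm_deg V) N n v ->
  sub_gr (gm_deg V) N (m + n) (act a v).
Proof. exact: gm_degM. Qed.

Definition sub_gmod : gmod A := GMod sub_actLl sub_actLr sub_actA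
  sub_unital (sub_is_grading (gm_graded V) (@gs_hom _ _ _ N)) sub_degM.
End Sub.

Section Quo.
Let act (a : A) (x : quo_lmod N) : quo_lmod N := qpi N (a |> qrepr x).

Lemma quo_actE a v : act a (qpi N v) = qpi N (a |> v).
Proof.
apply/qpi_eq; rewrite -(linB _ _ (gm_actLr a)); apply: gs_act.
by apply/qpi_eq; rewrite qreprK.
Qed.
Lemma quo_actLl v : linear (act^~ v).
Proof. by move=> c a b; rewrite /= -[v]qreprK !quo_actE gm_actLl qpiL. Qed.
Lemma quo_actLr a : linear (act a).
Proof.
by move=> c x y; rewrite /= -[x]qreprK -[y]qreprK -qpiL !quo_actE gm_actLr qpiL.
Qed.
Lemma quo_actA a b v : act a (act b v) = act (a ** b) v.
Proof. by rewrite -[v]qreprK !quo_actE gm_actA. Qed.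
Lemma quo_unitalM v : locally_unital (fun i => act (la_one A i)) v.
Proof.
have [s [us e]] := gm_unital (qrepr v); exists s; split=> //.
rewrite -[LHS]qreprK {1}e (lin_sum _ _ _ (@qpiL _ _ N)); apply: eq_bigr => i _.
by rewrite -quo_actE qreprK.
Qed.
Lemma quo_degMM m n a v : la_deg A m a -> quo_gr (gm_deg V) N n v ->
  quo_gr (gm_deg V) N (m + n) (act a v).
Proof.
move=> ha [x hx <-]; rewrite quo_actE; exists (a |> x) => //; exact: gm_degM.
Qed.

Definition quo_gmod : gmod A := GMod quo_actLl quo_actLr quo_actA
  quo_unitalM (quo_is_grading (gm_graded V) (@gs_hom _ _ _ N)) quo_degMM.
End Quo.

End SubQuoMod.

Section SubquoMod.
Context (k : fieldType) (A : lualg k) (V : gmod A) (M N : gsubmod V).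

Let NM : subspace (sub_gmod M) := pre_ss (@sub_valL k V M) N.

Lemma subquo_act a x : NM x -> NM (a |> x).
Proof. exact: gs_act. Qed.

Lemma subquo_hom : NM `<=` span (NM `&` homogeneous (gm_deg (sub_gmod M))).
Proof.
apply: (@gr_stable_hom _ _ _ (gm_graded (sub_gmod M)) NM) => d x nx.
rewrite /NM /= /preimage /=.
suff -> : sub_val (gr_pr (gm_graded (sub_gmod M)) d x) =
          gr_pr (gm_graded V) d (sub_val x).
  by apply: gr_pr_stable => //; exact: gs_hom.
have [s /(_ _ (undup_uniq s)) e] := gr_pr_sum (gm_graded (sub_gmod M)) x.
rewrite [in RHS]e ?(lin_sum _ _ _ (@sub_valL k V M)); last first.
  by move=> y; rewrite mem_undup.
rewrite (lin_sum _ _ _ (gr_pr_lin (gm_graded V) d)).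
have h d' : gm_deg V d' (sub_val (gr_pr (gm_graded (sub_gmod M)) d' x)).
  exact: (gr_prP (gm_graded (sub_gmod M))).
case: (boolP (d \in undup s)) => hd; last first.
  rewrite big_seq big1 => [|i hi].
    rewrite (gr_pr_eq (gm_graded (sub_gmod M)) (undup_uniq s) _ (e _)).
    - by rewrite (negbTE hd).
    - by move=> d'; exact: gr_prP.
    - by move=> y; rewrite mem_undup.
  by apply: (gr_pr_ne _ (d := i)) => //; apply: contraNneq hd => <-.
rewrite (bigD1_seq d) ?undup_uniq //= (gr_pr_id (gm_graded V) (h d)) big1 ?addr0 // => i ne.
exact: (gr_pr_ne _ (d := i)).
Qed.

Definition subquo_sub : gsubmod (sub_gmod M) := GSubmod subquo_act subquo_hom.

(* M / (M ∩ N) *)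
Definition subquo_gmod : gmod A := quo_gmod subquo_sub.

End SubquoMod.

Section Shift.
Context (k : fieldType) (A : lualg k) (d : int) (V : gmod A).
Let deg n : subspace V := gm_deg V (n - d).

Lemma shift_graded : is_grading deg.
Proof.
have [h1 h2] := gm_graded V.
have injp : injective (fun n : int => n + d) by move=> x y; exact: addIr.
have injm : injective (fun n : int => n - d) by move=> x y; exact: addIr.
split=> [v|s c us hc e x xs].
  have [s [c [us hc e]]] := h1 v.
  exists [seq n + d | n <- s], (fun n => c (n - d)); split=> //.
  - by rewrite map_inj_uniq.
  - by move=> n; exact: hc.
  - by rewrite e big_map; apply: eq_bigr => n _; rewrite addrK.
have := h2 [seq n - d | n <- s] (fun n => c (n + d)).
rewrite map_inj_uniq // big_map => /(_ us) h.
rewrite -[x](subrK d); apply: h.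
- by move=> n; have := hc (n + d); rewrite /deg addrK.
- by rewrite -[RHS]e; apply: eq_bigr => n _; rewrite subrK.
- exact: map_f.
Qed.

Lemma shift_degM m n a v : la_deg A m a -> deg n v -> deg (m + n) (a |> v).
Proof. by rewrite /deg -addrA; exact: gm_degM. Qed.

(* q^d V *)
Definition shift : gmod A := GMod (@gm_actLl _ _ V) (@gm_actLr _ _ V)
  (@gm_actA _ _ V) (@gm_unital _ _ V) shift_graded shift_degM.
End Shift.

Section GradingLemmas.
Context (k : fieldType).

Lemma gr_pr_map (V W : lmodType k) (F : int -> subspace V) (G : int -> subspace W)
    (hF : is_grading F) (hG : is_grading G) (f : V -> W) (n : int) :
  linear f -> (forall d v, F d v -> G (d + n) (f v)) ->
  forall d v, f (gr_pr hF d v) = gr_pr hG (d + n) (f v).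
Proof.
move=> lf hf d v; have [s hs] := gr_pr_sum hF v.
pose t := undup (d :: s); have ut : uniq t by exact: undup_uniq.
have e : v = \sum_(x <- t) gr_pr hF x v.
  by apply: hs => // x xs; rewrite mem_undup inE xs orbT.
rewrite (@gr_pr_eq _ _ _ hG _ [seq x + n | x <- t] (fun y => f (gr_pr hF (y - n) v))).
- rewrite addrK ifT //; apply: (map_f (fun x : int => x + n)).
  by rewrite mem_undup inE eqxx.
- by rewrite map_inj_uniq // => x y; exact: addIr.
- by move=> y; rewrite -{1}[y](subrK n); apply: hf; exact: gr_prP.
- rewrite big_map {1}e (lin_sum _ _ _ lf); apply: eq_bigr => x _.
  by rewrite addrK.
Qed.

Lemma gr_pr_finsupp (V : lmodType k) (F : int -> subspace V) (hF : is_grading F) v :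
  exists s : seq int, forall d, d \notin s -> gr_pr hF d v = 0.
Proof.
have [s [c [us hc e]]] := hF.1 v; exists s => d ds.
by rewrite (gr_pr_eq hF us hc e) (negbTE ds).
Qed.

Lemma gr_exists (V : lmodType k) (F : int -> subspace V) v :
  span (homogeneous F) v -> exists (s : seq int) (c : int -> V),
  [/\ uniq s, forall d, F d (c d) & v = \sum_(d <- s) c d].
Proof.
pose P v := exists (s : seq int) (c : int -> V),
  [/\ uniq s, forall d, F d (c d) & v = \sum_(d <- s) c d].
have P0 : P 0.
  by exists [::], (fun => 0); split=> // [d|]; [exact: ss0 | rewrite big_nil].
have PL (a : k) u w : P u -> P w -> P (a *: u + w).
  move=> [s [c [us hc eu]]] [t [b [ut hb ew]]].
  exists (undup (s ++ t)),
    (fun d => a *: (if d \in s then c d else 0) + (if d \in t then b d else 0)).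
  split; first exact: undup_uniq.
    by move=> d; apply: ssL; case: ifP => // _; exact: ss0.
  rewrite big_split /= -scaler_sumr !big_ext -?eu -?ew ?undup_uniq // => x hx;
  by rewrite mem_undup mem_cat hx ?orbT.
apply: (@span_min _ _ _ (Subspace P0 PL)) => {}v [d hv] /=.
exists [:: d], (fun x => if x == d then v else 0); split=> //.
  by move=> x; case: eqP => [->|_] //; exact: ss0.
by rewrite big_seq1 eqxx.
Qed.

Lemma gr_intro (V : lmodType k) (F : int -> subspace V) (pr : int -> V -> V) :
  (forall d, linear (pr d)) -> (forall d v, F d v -> pr d v = v) ->
  (forall d e v, d != e -> F d v -> pr e v = 0) ->
  (forall v, span (homogeneous F) v) -> is_grading F.
Proof.
move=> lpr h1 h2 h3; split=> [v|s c us hc e d ds]; first exact: gr_exists.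
have := lin0 (lpr d); rewrite -{1}e (lin_sum _ _ _ (lpr d)) (bigD1_seq d) //=.
by rewrite h1 // big1 ?addr0 // => x ne; exact: h2 (hc x).
Qed.

Lemma lin_eq_ss (U W : lmodType k) (f g : U -> W) : linear f -> linear g ->
  linear (fun x => f x - g x).
Proof.
by move=> lf lg c x y; rewrite lf lg scalerBr opprD addrACA.
Qed.

Lemma lin_comb (U W : lmodType k) (c : k) (f g : U -> W) : linear f -> linear g ->
  linear (fun x => c *: f x + g x).
Proof.
move=> lf lg d x y; rewrite lf lg !scalerDr !scalerA [c * d]mulrC -!scalerA.
by rewrite addrACA -scalerDr.
Qed.

Lemma lin_zero (U W : lmodType k) : linear (0 : U -> W).
Proof. by move=> c x y; rewrite /= scaler0 addr0. Qed.

End GradingLemmas.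

Lemma la_unitr (k : fieldType) (A : lualg k) (a : A) :
  exists s : seq (la_idx A), a = \sum_(i <- s) a ** la_one A i.
Proof.
have lr i : linear (fun a : A => a ** la_one A i) by exact: la_mulLl.
have orth i j (b : A) : (b ** la_one A j) ** la_one A i =
    if i == j then b ** la_one A j else 0.
  rewrite -la_mulA la_orth; case: (eqVneq j i) => [->|_] //; exact: mulA0.
have [s [us e]] := la_unital a.
suff [t [_ ht]] : locally_unital (fun i (a : A) => a ** la_one A i) a by exists t.
rewrite e; apply: (ss_sum (S := lu_ss lr orth)) => i _.
apply: ss_sum => j _; apply: (@lu_fixed _ _ _ _ j).
by rewrite orth eqxx.
Qed.

Record idem (k : fieldType) (C : lualg k) := Idem {
  id_elt :> C;
  idemK : id_elt ** id_elt = id_elt;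
  idem_deg : la_deg C 0 id_elt }.

Section Truncation.
Context (k : fieldType) (C : lualg k) (e : idem C).
Local Notation e' := (id_elt e).

Lemma eC_0 : e' ** 0 = 0. Proof. exact: mulA0. Qed.
Lemma eC_L (c : k) u v : e' ** u = u -> e' ** v = v -> e' ** (c *: u + v) = c *: u + v.
Proof. by move=> hu hv; rewrite la_mulLr hu hv. Qed.
(* eC *)
Definition eC : subspace C := @Subspace k C [set x | e' ** x = x] eC_0 eC_L.

Lemma Ce_0 : 0 ** e' = 0. Proof. exact: mul0A. Qed.
Lemma Ce_L (c : k) u v : u ** e' = u -> v ** e' = v -> (c *: u + v) ** e' = c *: u + v.
Proof. by move=> hu hv; rewrite la_mulLl hu hv. Qed.
(* Ce *)
Definition Ce : subspace C := @Subspace k C [set x | x ** e' = x] Ce_0 Ce_L.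

Lemma eCe_0 : eC 0 /\ Ce 0. Proof. by split; exact: ss0. Qed.
Lemma eCe_L (c : k) u v : eC u /\ Ce u -> eC v /\ Ce v ->
  eC (c *: u + v) /\ Ce (c *: u + v).
Proof. by move=> [? ?] [? ?]; split; exact: ssL. Qed.
(* eCe *)
Definition eCe : subspace C := @Subspace k C [set x | eC x /\ Ce x] eCe_0 eCe_L.

Lemma eC_hom : eC `<=` span (eC `&` homogeneous (la_deg C)).
Proof.
apply: (@gr_stable_hom _ _ _ (la_graded C) eC) => d x hx; rewrite /= /mkset.
rewrite (gr_pr_map (la_graded C) (la_graded C) (n := 0) (la_mulLr e')) ?addr0 ?hx // => m y hy.
by rewrite addrC; apply: la_degM => //; exact: idem_deg.
Qed.
Lemma Ce_hom : Ce `<=` span (Ce `&` homogeneous (la_deg C)).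
Proof.
apply: (@gr_stable_hom _ _ _ (la_graded C) Ce) => d x hx; rewrite /= /mkset.
rewrite (gr_pr_map (la_graded C) (la_graded C) (n := 0) (la_mulLl e')) ?addr0 ?hx // => m y hy.
by apply: la_degM => //; exact: idem_deg.
Qed.
Lemma eCe_hom : eCe `<=` span (eCe `&` homogeneous (la_deg C)).
Proof.
apply: (@gr_stable_hom _ _ _ (la_graded C) eCe) => d x [h1 h2]; split.
  by apply: (gr_pr_stable (la_graded C) eC_hom).
by apply: (gr_pr_stable (la_graded C) Ce_hom).
Qed.

Section CornerAlg.
Implicit Types x y z : sub_lmod eCe.

Lemma corner_in x y : eCe (sub_val x ** sub_val y).
Proof.
have [hx _] := sub_valP x; have [_ hy] := sub_valP y.
by split; rewrite /= /mkset ?la_mulA ?hx // -la_mulA hy.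
Qed.

Definition corner_mul x y : sub_lmod eCe := ssub (corner_in x y).

Lemma corner_mulLl y : linear (corner_mul^~ y).
Proof. by move=> c a b; apply: sub_val_inj; exact: la_mulLl. Qed.
Lemma corner_mulLr x : linear (corner_mul x).
Proof. by move=> c a b; apply: sub_val_inj; exact: la_mulLr. Qed.
Lemma corner_mulA x y z : corner_mul x (corner_mul y z) = corner_mul (corner_mul x y) z.
Proof. by apply: sub_val_inj; exact: la_mulA. Qed.

Lemma corner_one_in : eCe e'.
Proof. by split; exact: idemK. Qed.
Definition corner_one (_ : unit) : sub_lmod eCe := ssub corner_one_in.

Lemma corner_orth i j : corner_mul (corner_one i) (corner_one j) =
  if i == j then corner_one i else 0.
Proof. by case: i j => [] []; apply: sub_val_inj; exact: idemK. Qed.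

Lemma corner_1l x : corner_mul (corner_one tt) x = x.
Proof. by apply: sub_val_inj; case: (sub_valP x). Qed.
Lemma corner_1r x : corner_mul x (corner_one tt) = x.
Proof. by apply: sub_val_inj; case: (sub_valP x). Qed.

Lemma corner_unital x : exists s : seq unit, uniq s /\
  x = \sum_(i <- s) \sum_(j <- s) corner_mul (corner_mul (corner_one i) x) (corner_one j).
Proof. by exists [:: tt]; rewrite !big_seq1 corner_1l corner_1r. Qed.

Lemma corner_degM m n x y : sub_gr (la_deg C) eCe m x -> sub_gr (la_deg C) eCe n y ->
  sub_gr (la_deg C) eCe (m + n) (corner_mul x y).
Proof. exact: la_degM. Qed.
Lemma corner_deg1 i : sub_gr (la_deg C) eCe 0 (corner_one i).
Proof. exact: idem_deg. Qed.

(* the unital algebra eCe, whose single distinguished idempotent is its unit e *)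
Definition corner : lualg k := LUAlg corner_mulLl corner_mulLr corner_mulA corner_orth
  corner_unital (sub_is_grading (la_graded C) eCe_hom) corner_degM corner_deg1.

End CornerAlg.

(* Ce as a (C, eCe)-bimodule and eC as an (eCe, C)-bimodule *)

Lemma Ce_lact_in (a : C) (x : sub_lmod Ce) : Ce (a ** sub_val x).
Proof. by rewrite /= /mkset -la_mulA (sub_valP x). Qed.
Definition Ce_lact a x : sub_lmod Ce := ssub (Ce_lact_in a x).

Lemma Ce_ract_in (x : sub_lmod Ce) (a : corner) : Ce (sub_val x ** sub_val a).
Proof. by rewrite /= /mkset -la_mulA; have [_ ->] := sub_valP a. Qed.
Definition Ce_ract x a : sub_lmod Ce := ssub (Ce_ract_in x a).

Lemma eC_lact_in (a : corner) (x : sub_lmod eC) : eC (sub_val a ** sub_val x).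
Proof. by rewrite /= /mkset la_mulA; have [-> _] := sub_valP a. Qed.
Definition eC_lact a x : sub_lmod eC := ssub (eC_lact_in a x).

Lemma eC_ract_in (x : sub_lmod eC) (a : C) : eC (sub_val x ** a).
Proof. by rewrite /= /mkset la_mulA (sub_valP x). Qed.
Definition eC_ract x a : sub_lmod eC := ssub (eC_ract_in x a).

Definition Ce_deg d : subspace (sub_lmod Ce) := sub_gr (la_deg C) Ce d.
Definition eC_deg d : subspace (sub_lmod eC) := sub_gr (la_deg C) eC d.

Lemma Ce_graded : is_grading Ce_deg.
Proof. exact: (@sub_is_grading _ _ _ (la_graded C) Ce Ce_hom). Qed.
Lemma eC_graded : is_grading eC_deg.
Proof. exact: (@sub_is_grading _ _ _ (la_graded C) eC eC_hom). Qed.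

Section Tensor.
Context (V : gmod corner).
Implicit Types (x y : sub_lmod Ce) (u v : V).

Definition ten_free : lmodType k := {freeg (sub_lmod Ce * V)%type / k}.
Definition ten_gen x v : ten_free := Freeg [:: (1, (x, v))].

Definition ten_rel : set ten_free :=
  [set t | exists c x y v, t = ten_gen (c *: x + y) v - (c *: ten_gen x v + ten_gen y v)]
  `|` [set t | exists c x u v,
        t = ten_gen x (c *: u + v) - (c *: ten_gen x u + ten_gen x v)]
  `|` [set t | exists x a v, t = ten_gen (Ce_ract x a) v - ten_gen x (a |> v)].

Definition ten_lmod : lmodType k := quo_lmod (span ten_rel).
Definition ten x v : ten_lmod := qpi (span ten_rel) (ten_gen x v).

Definition balanced (U : lmodType k) (f : sub_lmod Ce -> V -> U) :=
  [/\ forall v, linear (f^~ v), forall x, linear (f x) &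
      forall x a v, f (Ce_ract x a) v = f x (a |> v)].

Lemma freegZ (c d : k) (p : sub_lmod Ce * V) :
  Freeg [:: (c * d, p)] = c *: (Freeg [:: (d, p)] : ten_free).
Proof. by apply/eqP/freeg_eqP => q; rewrite coeffZ !coeffU mulrA. Qed.

Lemma fglift_lin (U : lmodType k) (f : sub_lmod Ce * V -> U) :
  linear (fglift f : ten_free -> U).
Proof.
have hB := lift_is_additive f.
have h0 : fglift f 0 = 0 by rewrite -(subrr 0) hB subrr.
have hN D : fglift f (- D) = - fglift f D by rewrite -sub0r hB h0 sub0r.
have hD D E : fglift f (D + E) = fglift f D + fglift f E.
  by rewrite -{1}[E]opprK hB hN opprK.
move=> c D E; rewrite hD; congr (_ + _).
rewrite -{1 2}[D]freeg_sumE scaler_sumr !(big_morph _ hD h0) scaler_sumr.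
by apply: eq_bigr => p _; rewrite -freegZ !liftU scalerA.
Qed.

Definition tlift (U : lmodType k) (f : sub_lmod Ce -> V -> U) (t : ten_lmod) : U :=
  fglift (fun p => f p.1 p.2) (qrepr t).

Section Lift.
Context (U : lmodType k) (f : sub_lmod Ce -> V -> U) (hf : balanced f).
Let g : ten_free -> U := fglift (fun p => f p.1 p.2).

Lemma fglift_gen x v : g (ten_gen x v) = f x v.
Proof. by rewrite /g /ten_gen liftU scale1r. Qed.

Lemma fglift_rel t : span ten_rel t -> g t = 0.
Proof.
have lg : linear g by exact: fglift_lin.
have [h1 h2 h3] := hf.
apply: (@span_min _ _ _ (pre_ss lg (zero_ss U))) => {}t.
rewrite /= /preimage /= => -[[]|].
- by move=> [c [x [y [v ->]]]]; rewrite (linB _ _ lg) lg !fglift_gen h1 subrr.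
- by move=> [c [x [u [v ->]]]]; rewrite (linB _ _ lg) lg !fglift_gen h2 subrr.
- by move=> [x [a [v ->]]]; rewrite (linB _ _ lg) !fglift_gen h3 subrr.
Qed.

Lemma tlift_qpi t : tlift f (qpi _ t) = g t.
Proof.
have lg : linear g by exact: fglift_lin.
apply/eqP; rewrite -subr_eq0 /tlift -/g -(linB _ _ lg); apply/eqP/fglift_rel.
by apply/qpi_eq; rewrite qreprK.
Qed.

Lemma tlift_ten x v : tlift f (ten x v) = f x v.
Proof. by rewrite tlift_qpi fglift_gen. Qed.

Lemma tlift_lin : linear (tlift f).
Proof.
move=> c s t; rewrite -[s]qreprK -[t]qreprK -qpiL !tlift_qpi.
exact: fglift_lin.
Qed.
End Lift.

Lemma ten_balanced : balanced ten.
Proof.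
split=> [v c x y|x c u v|x a v]; rewrite /ten -?qpiL; apply/qpi_eq/span_sub.
- by left; left; exists c, x, y, v.
- by left; right; exists c, x, u, v.
- by right; exists x, a, v.
Qed.

Lemma tenLl v : linear (ten^~ v). Proof. by case: ten_balanced. Qed.
Lemma tenLr x : linear (ten x). Proof. by case: ten_balanced. Qed.
Lemma tenA x a v : ten (Ce_ract x a) v = ten x (a |> v).
Proof. by case: ten_balanced. Qed.

Lemma ten_span t : span [set ten p.1 p.2 | p in [set: sub_lmod Ce * V]] t.
Proof.
rewrite -[t]qreprK -[qrepr t]freeg_sumE (lin_sum _ _ _ (@qpiL _ _ _)).
apply: ss_sum => -[x v] _; rewrite -[coeff _ _]mulr1 freegZ.
by rewrite (linZ _ _ (@qpiL _ _ _)); apply/ssZ/span_sub; exists (x, v).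
Qed.

Lemma ten_ind (S : subspace ten_lmod) : (forall x v, S (ten x v)) -> forall t, S t.
Proof. by move=> h t; apply: span_min (ten_span t) => _ [[x v] _ <-]. Qed.

Lemma ten_ext (U : lmodType k) (f g : ten_lmod -> U) : linear f -> linear g ->
  (forall x v, f (ten x v) = g (ten x v)) -> f =1 g.
Proof.
move=> lf lg h t; apply/eqP; rewrite -subr_eq0; apply/eqP.
apply: (@ten_ind (pre_ss (lin_eq_ss lf lg) (zero_ss U))) => x v.
by rewrite /= /preimage /= h subrr.
Qed.

Definition ten_act (a : C) : ten_lmod -> ten_lmod :=
  tlift (fun x v => ten (Ce_lact a x) v).

Lemma Ce_lactLr a : linear (Ce_lact a).
Proof. by move=> c x y; apply: sub_val_inj; exact: la_mulLr. Qed.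
Lemma Ce_lactLl x : linear (Ce_lact^~ x).
Proof. by move=> c x' y; apply: sub_val_inj; exact: la_mulLl. Qed.
Lemma Ce_ractLr x : linear (Ce_ract x).
Proof. by move=> c x' y; apply: sub_val_inj; exact: la_mulLr. Qed.
Lemma Ce_ractLl a : linear (Ce_ract^~ a).
Proof. by move=> c x y; apply: sub_val_inj; exact: la_mulLl. Qed.
Lemma Ce_lractA a x b : Ce_lact a (Ce_ract x b) = Ce_ract (Ce_lact a x) b.
Proof. by apply: sub_val_inj; exact: la_mulA. Qed.

Lemma ten_act_balanced a : balanced (fun x v => ten (Ce_lact a x) v).
Proof.
split=> [v c x y|x|x b v]; first by rewrite Ce_lactLr tenLl.
- exact: tenLr.
- by rewrite Ce_lractA tenA.
Qed.

Lemma ten_actE a x v : ten_act a (ten x v) = ten (Ce_lact a x) v.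
Proof. exact: tlift_ten (ten_act_balanced a) _ _. Qed.

Lemma ten_actLr a : linear (ten_act a).
Proof. exact: tlift_lin (ten_act_balanced a). Qed.

Lemma ten_actLl t : linear (ten_act^~ t).
Proof.
move=> c a b; move: t; apply: ten_ext => [||x v].
- exact: ten_actLr.
- by apply: lin_comb; exact: ten_actLr.
- by rewrite !ten_actE Ce_lactLl tenLl.
Qed.

Lemma ten_actA a b t : ten_act a (ten_act b t) = ten_act (a ** b) t.
Proof.
move: t; apply: ten_ext => [c s t||x v].
- by rewrite !ten_actLr.
- exact: ten_actLr.
- rewrite !ten_actE; congr ten; apply: sub_val_inj; exact: la_mulA.
Qed.

Lemma ten_unital t : locally_unital (fun i => ten_act (la_one C i)) t.
Proof.
have orth i j s : ten_act (la_one C i) (ten_act (la_one C j) s) =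
    if i == j then ten_act (la_one C j) s else 0.
  rewrite ten_actA la_orth; case: eqP => [->|_] //.
  exact: lin0 (ten_actLl s).
apply: (@ten_ind (lu_ss (fun i => ten_actLr (la_one C i)) orth)) => x v.
have [s [us ex]] := la_unitl (sub_val x).
have -> : ten x v = \sum_(i <- s) ten_act (la_one C i) (ten x v).
  under eq_bigr do rewrite ten_actE.
  rewrite -(lin_sum _ _ _ (tenLl v)); congr ten.
  by apply: sub_val_inj; rewrite (lin_sum _ _ _ (@sub_valL _ _ _)).
apply: ss_sum => i _; apply: (@lu_fixed _ _ _ _ i).
by rewrite orth eqxx.
Qed.

Definition ten_hom (d : int) : set ten_lmod :=
  [set t | exists m n x v, [/\ d = m + n, Ce_deg m x, gm_deg V n v & t = ten x v]].
Definition ten_deg d : subspace ten_lmod := span (ten_hom d).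

Local Notation prA := (gr_pr Ce_graded).
Local Notation prV := (gr_pr (gm_graded V)).

Let supp x := projT1 (cid (gr_pr_finsupp Ce_graded x)).
Let suppP x m : m \notin supp x -> prA m x = 0.
Proof. by rewrite /supp; case: cid => s /= h /h. Qed.

Let beta d x v : ten_lmod :=
  \sum_(m <- undup (supp x)) ten (prA m x) (prV (d - m) v).

Lemma ten_betaE d x v (s : seq int) : uniq s -> {subset supp x <= s} ->
  beta d x v = \sum_(m <- s) ten (prA m x) (prV (d - m) v).
Proof.
move=> us hs; rewrite /beta -(@big_ext _ _ (undup (supp x)) s) ?undup_uniq //.
  apply: eq_bigr => m _; rewrite mem_undup; case: ifPn => // /suppP ->.
  by rewrite (lin0 (tenLl _)).
by move=> m; rewrite mem_undup; exact: hs.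
Qed.

Lemma ten_beta_balanced d : balanced (beta d).
Proof.
have hl v : linear ((beta d)^~ v).
  move=> c x y; pose s := undup (supp x ++ supp y ++ supp (c *: x + y)).
  have us : uniq s by exact: undup_uniq.
  rewrite !(@ten_betaE _ _ _ s) //;
    try by move=> m hm; rewrite mem_undup !mem_cat hm ?orbT.
  rewrite scaler_sumr -big_split; apply: eq_bigr => m _ /=.
  by rewrite gr_pr_lin tenLl.
have hr x : linear (beta d x).
  move=> c u v; rewrite /beta scaler_sumr -big_split; apply: eq_bigr => m _ /=.
  by rewrite gr_pr_lin tenLr.
split=> // x a v; apply/eqP; rewrite -subr_eq0; apply/eqP.
have l1 : linear (fun a => beta d (Ce_ract x a) v).
  by move=> c b b'; rewrite Ce_ractLr hl.
have l2 : linear (fun a : corner => beta d x (a |> v)).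
  by move=> c b b'; rewrite gm_actLl hr.
apply: (@span_min _ _ _ (pre_ss (lin_eq_ss l1 l2) (zero_ss _)) _ a
          (gr_span (la_graded corner) a)) => {}a [n ha].
rewrite /= /preimage /=; apply/eqP; rewrite subr_eq0; apply/eqP.
pose s := undup (supp x ++ [seq m - n | m <- supp (Ce_ract x a)]).
have us : uniq s by exact: undup_uniq.
rewrite (@ten_betaE d x _ s) //; last first.
  by move=> m hm; rewrite mem_undup mem_cat hm.
rewrite (@ten_betaE d (Ce_ract x a) _ [seq m + n | m <- s]); last 2 first.
- by rewrite map_inj_uniq // => p q; exact: addIr.
- move=> m hm; rewrite -[m](subrK n); apply: (map_f (fun x : int => x + n)).
  by rewrite mem_undup mem_cat; apply/orP; right; apply: (map_f (fun x : int => x - n)).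
rewrite big_map; apply: eq_bigr => m _.
rewrite -(gr_pr_map Ce_graded Ce_graded (Ce_ractLl a)) => [|p y hy]; last first.
  exact: (la_degM hy ha).
rewrite tenA; congr ten.
have -> : d - m = d - (m + n) + n by rewrite opprD addrA subrK.
apply: (gr_pr_map (gm_graded V) (gm_graded V) (gm_actLr a)) => p y hy.
by rewrite addrC; exact: gm_degM.
Qed.

Lemma ten_beta_hom d m n x v : Ce_deg m x -> gm_deg V n v ->
  beta d x v = if m + n == d then ten x v else 0.
Proof.
move=> hx hv; pose s := undup (m :: supp x).
rewrite (@ten_betaE d x v s) ?undup_uniq //; last first.
  by move=> p hp; rewrite mem_undup inE hp orbT.
rewrite (bigD1_seq m) ?undup_uniq ?mem_undup ?inE ?eqxx //=.
rewrite big1 ?addr0 => [|p ne]; last first.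
  by rewrite (@gr_pr_ne _ _ _ _ m) 1?eq_sym // (lin0 (tenLl _)).
rewrite gr_pr_id //; case: eqP => [<-|ne].
  by rewrite addrC addKr gr_pr_id.
rewrite (@gr_pr_ne _ _ _ _ n) ?(lin0 (tenLr _)) //.
by apply: contra_not_neq ne => ->; rewrite addrC subrK.
Qed.

Lemma ten_graded : is_grading ten_deg.
Proof.
pose pr d := tlift (beta d).
have lpr d : linear (pr d) by exact: tlift_lin (ten_beta_balanced d).
have prE d := tlift_ten (ten_beta_balanced d).
apply: (gr_intro lpr) => [d t ht|d e1 t ne ht|t].
- have lid : linear (fun t : ten_lmod => t) by [].
  apply/eqP; rewrite -subr_eq0; apply/eqP.
  apply: (@span_min _ _ _ (pre_ss (lin_eq_ss (lpr d) lid) (zero_ss _)) _ t ht).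
  move=> _ [m [n [x [v [-> hx hv ->]]]]]; rewrite /= /preimage /=.
  by rewrite /pr prE (ten_beta_hom _ hx hv) eqxx subrr.
- apply: (@span_min _ _ _ (pre_ss (lpr e1) (zero_ss _)) _ t ht).
  move=> _ [m [n [x [v [ed hx hv ->]]]]]; rewrite /= /preimage /=.
  by rewrite /pr prE (ten_beta_hom _ hx hv) -ed (negbTE ne).
- apply: (@ten_ind (span (homogeneous ten_deg))) => x v.
  apply: (@span_min _ _ _ (pre_ss (tenLl v) (span (homogeneous ten_deg))) _ x
            (gr_span Ce_graded x)) => {}x [m hx].
  apply: (@span_min _ _ _ (pre_ss (tenLr x) (span (homogeneous ten_deg))) _ v
            (gr_span (gm_graded V) v)) => {}v [n hv].
  by apply: span_sub; exists (m + n); apply: span_sub; exists m, n, x, v.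
Qed.

Lemma ten_degM m n a t : la_deg C m a -> ten_deg n t -> ten_deg (m + n) (ten_act a t).
Proof.
move=> ha; apply: (@span_min _ _ _ (pre_ss (ten_actLr a) (ten_deg (m + n)))).
move=> _ [p [q [x [v [-> hx hv ->]]]]]; rewrite /= /preimage /= ten_actE.
apply: span_sub; exists (m + p), q, (Ce_lact a x), v; split=> //; first exact: addrA.
exact: (la_degM ha hx).
Qed.

(* Ce ⊗_{eCe} V *)
Definition jshriek : gmod C := GMod ten_actLl ten_actLr ten_actA ten_unital
  ten_graded ten_degM.

End Tensor.

Section CoInd.
Context (V : gmod corner).
Implicit Types (x y : sub_lmod eC) (f : sub_lmod eC -> V).

(* Hom_{eCe}(eC1_i, V)_d, its elements being extended by zero to all of
   eC = ⊕_j eC1_j *)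
Definition co_hom (i : la_idx C) (d : int) : set (sub_lmod eC -> V) :=
  [set f | [/\ linear f, forall a x, f (eC_lact a x) = a |> f x,
     forall n x, eC_deg n x -> gm_deg V (n + d) (f x) &
     forall j x, j != i -> f (eC_ract x (la_one C j)) = 0]].

(* ⊕_i Hom_{eCe}(eC1_i, V) *)
Definition co_ss : subspace (sub_lmod eC -> V) :=
  span [set f | exists i d, co_hom i d f].

Definition co_homd (d : int) : subspace (sub_lmod eC -> V) :=
  span [set f | exists i, co_hom i d f].

Local Notation W := (sub_lmod co_ss).

Definition co_deg (d : int) : subspace W := pre_ss (@sub_valL _ _ co_ss) (co_homd d).

Lemma lin_setL (c : k) f g : linear f -> linear g -> linear (c *: f + g).
Proof. exact: lin_comb. Qed.
Definition lin_ss : subspace (sub_lmod eC -> V) :=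
  @Subspace _ _ [set f | linear f] (@lin_zero _ _ _) lin_setL.

Lemma co_lin f : co_ss f -> linear f.
Proof. by apply: (@span_min _ _ _ lin_ss) => {}f [i [d []]]. Qed.

Lemma eC_ractLr x : linear (eC_ract x).
Proof. by move=> c x' y; apply: sub_val_inj; exact: la_mulLr. Qed.
Lemma eC_ractLl a : linear (eC_ract^~ a).
Proof. by move=> c x y; apply: sub_val_inj; exact: la_mulLl. Qed.
Lemma eC_lactLr a : linear (eC_lact a).
Proof. by move=> c x y; apply: sub_val_inj; exact: la_mulLr. Qed.
Lemma eC_ractA x a b : eC_ract (eC_ract x a) b = eC_ract x (a ** b).
Proof. by apply: sub_val_inj; rewrite /= la_mulA. Qed.
Lemma eC_lractA a x b : eC_lact a (eC_ract x b) = eC_ract (eC_lact a x) b.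
Proof. by apply: sub_val_inj; exact: la_mulA. Qed.

Definition co_pre (a : C) f : sub_lmod eC -> V := fun x => f (eC_ract x a).

Lemma co_preLr a : linear (co_pre a).
Proof. by []. Qed.

Lemma co_pre_hom a i d j m f : la_deg C m a -> co_hom i d f ->
  co_hom j (m + d) (co_pre (la_one C j ** a) f).
Proof.
move=> ha [h1 h2 h3 h4]; split.
- by move=> c x y; rewrite /co_pre eC_ractLl h1.
- by move=> b x; rewrite /co_pre -eC_lractA h2.
- move=> n x hx; rewrite /co_pre addrA; apply: h3.
  by apply: la_degM => //; rewrite -[m]add0r; apply: la_degM => //; exact: la_deg1.
- move=> l x ne; rewrite /co_pre eC_ractA la_mulA la_orth (negbTE ne) mul0A.
  by rewrite (lin0 (eC_ractLr x)) (lin0 h1).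
Qed.

Lemma co_pre_degM m n a f : la_deg C m a -> co_homd n f -> co_homd (m + n) (co_pre a f).
Proof.
move=> ha; apply: (@span_min _ _ _ (pre_ss (co_preLr a) (co_homd (m + n)))).
move=> {}f [i hf]; rewrite /= /preimage /=.
have [s [us e0]] := la_unitl a.
have -> : co_pre a f = \sum_(j <- s) co_pre (la_one C j ** a) f.
  apply/funext => x; rewrite fct_sumE {1}/co_pre {1}e0.
  have [lf _ _ _] := hf.
  by rewrite (lin_sum _ _ _ (eC_ractLr x)) (lin_sum _ _ _ lf).
apply: (ss_sum (S := co_homd (m + n))) => j _; apply: span_sub; exists j.
exact: co_pre_hom hf.
Qed.

Lemma co_homd_sub d f : co_homd d f -> co_ss f.
Proof. by apply: span_mono => {}f [i h]; exists i, d. Qed.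

Lemma co_pre_in a f : co_ss f -> co_ss (co_pre a f).
Proof.
move=> hf; have lf := co_lin hf.
have la : linear (fun a => co_pre a f).
  by move=> c b b'; apply/funext => x; rewrite /co_pre eC_ractLr lf.
apply: (@span_min _ _ _ (pre_ss la co_ss) _ a (gr_span (la_graded C) a)) => {}a [m ha].
rewrite /= /preimage /=.
apply: (@span_min _ _ _ (pre_ss (co_preLr a) co_ss) _ f hf) => {}f' [i [d hf']].
rewrite /= /preimage /=; apply: (@co_homd_sub (m + d)); apply: co_pre_degM => //.
by apply: span_sub; exists i.
Qed.

Definition co_act (a : C) (f : W) : W := ssub (co_pre_in a (sub_valP f)).

Lemma co_actLr a : linear (co_act a).
Proof. by move=> c f g; apply: sub_val_inj. Qed.
Lemma co_actLl (f : W) : linear (co_act^~ f).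
Proof.
move=> c a b; apply: sub_val_inj; apply/funext => x /=.
by rewrite /co_pre eC_ractLr (co_lin (sub_valP f)).
Qed.
Lemma co_actA a b (f : W) : co_act a (co_act b f) = co_act (a ** b) f.
Proof.
by apply: sub_val_inj; apply/funext => x; rewrite /= /co_pre eC_ractA.
Qed.

Lemma co_one_lin i : linear (co_act (la_one C i)).
Proof. exact: co_actLr. Qed.
Lemma co_one_orth i j (f : W) : co_act (la_one C i) (co_act (la_one C j) f) =
  if i == j then co_act (la_one C j) f else 0.
Proof.
rewrite co_actA la_orth; case: eqP => [->|_] //; exact: lin0 (co_actLl f).
Qed.

Lemma co_hom_one i d f x : co_hom i d f -> f (eC_ract x (la_one C i)) = f x.
Proof.
move=> [lf _ _ h]; have [s e0] := la_unitr (sub_val x).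
have {}e0 : x = \sum_(j <- s) eC_ract x (la_one C j).
  by apply: sub_val_inj; rewrite (lin_sum _ _ _ (@sub_valL _ _ _)).
rewrite {1 2}e0 (lin_sum _ _ _ (eC_ractLl _)) !(lin_sum _ _ _ lf).
apply: eq_bigr => j _; rewrite eC_ractA la_orth.
by case: eqP => [->|/eqP ne] //; rewrite (lin0 (eC_ractLr x)) (lin0 lf) h.
Qed.

Lemma co_unital (f : W) : locally_unital (fun i => co_act (la_one C i)) f.
Proof.
pose S := lu_ss co_one_lin co_one_orth.
suff [h hS] : exists h : co_ss (sub_val f), S (ssub h).
  by move: hS; congr (S _); apply: sub_val_inj.
have [l [hl e0]] := sub_valP f.
have inl p : p \in l -> co_ss p.2 by move=> /hl h; exact: span_sub.
pose g (p : k * (sub_lmod eC -> V)) : W :=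
  if pselect (co_ss p.2) is left h then ssub h else 0.
have eg p : p \in l -> sub_val (g p) = p.2.
  by move=> /inl h; rewrite /g; case: pselect.
have ef : f = \sum_(p <- l) p.1 *: g p.
  apply: sub_val_inj; rewrite e0 (lin_sum _ _ _ (@sub_valL _ _ _)).
  by apply: eq_big_seq => p /eg <-; rewrite -(linZ _ _ (@sub_valL _ _ _)).
exists (sub_valP f).
have -> : ssub (sub_valP f) = f by apply: sub_val_inj.
rewrite ef; apply: ss_sum_seq => p pl; apply: ssZ.
have [i [d hp]] := hl p pl; apply: (@lu_fixed _ _ _ _ i).
apply: sub_val_inj; apply/funext => x; rewrite /= /co_pre eg //.
exact: co_hom_one hp.
Qed.

Lemma co_homd_deg d f n x : co_homd d f -> eC_deg n x -> gm_deg V (n + d) (f x).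
Proof.
move=> hf hx; have la : linear (fun f : sub_lmod eC -> V => f x) by [].
apply: (@span_min _ _ _ (pre_ss la (gm_deg V (n + d))) _ f hf) => f' [i [_ _ h _]].
exact: h.
Qed.

Lemma co_graded : is_grading co_deg.
Proof.
split=> [f|s c us hc e0 d ds].
  apply: gr_exists; have [l [hl ef]] := sub_valP f.
  have inl p : p \in l -> co_ss p.2 by move=> /hl h; exact: span_sub.
  pose g (p : k * (sub_lmod eC -> V)) : W :=
    if pselect (co_ss p.2) is left h then ssub h else 0.
  have eg p : p \in l -> sub_val (g p) = p.2.
    by move=> /inl h; rewrite /g; case: pselect.
  have -> : f = \sum_(p <- l) p.1 *: g p.
    apply: sub_val_inj; rewrite ef (lin_sum _ _ _ (@sub_valL _ _ _)).
    by apply: eq_big_seq => p /eg <-; rewrite -(linZ _ _ (@sub_valL _ _ _)).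
  apply: ss_sum_seq => p pl; apply/ssZ/span_sub; have [i [d hp]] := hl p pl.
  have h : co_homd d (sub_val (g p)) by rewrite eg //; apply: span_sub; exists i.
  by exists d.
apply: sub_val_inj; apply/funext => x.
have lx : linear (sub_val (c d)) by exact: co_lin (sub_valP (c d)).
apply: (@span_min _ _ _ (pre_ss lx (zero_ss V)) _ x (gr_span eC_graded x)) => {}x [n hx].
rewrite /= /preimage /=.
have := (gm_graded V).2 [seq n + d | d <- s] (fun m => sub_val (c (m - n)) x).
rewrite map_inj_uniq ?big_map; last by move=> p q; exact: addrI.
move=> /(_ us) h; rewrite -[d](addKr n) [- n + _]addrC; apply: h.
- move=> m; have := co_homd_deg (hc (m - n)) hx; by rewrite addrC subrK.
- under eq_bigr => m _ do rewrite addrC addKr.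
  have := congr1 (fun f : W => sub_val f x) e0.
  by rewrite (lin_sum _ _ _ (@sub_valL _ _ co_ss)) fct_sumE.
- exact: map_f.
Qed.

Lemma co_degM m n a (f : W) : la_deg C m a -> co_deg n f -> co_deg (m + n) (co_act a f).
Proof. exact: co_pre_degM. Qed.

(* ⊕_i Hom_{eCe}(eC1_i, V) *)
Definition jstar : gmod C := GMod co_actLl co_actLr co_actA co_unital co_graded co_degM.

End CoInd.
End Truncation.

Section GradedCategory.
Context (k : fieldType) (A : lualg k).
Implicit Types V W : gmod A.

(* Hom_A(V, W)_d; the morphisms of A-gmod are those of degree 0 *)
Definition ghom V W (d : int) : set (V -> W) :=
  [set f | [/\ linear f, forall a v, f (a |> v) = a |> f v &
             forall n v, gm_deg V n v -> gm_deg W (n + d) (f v)]].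

(* Hom_A(V, W) = ⊕_d Hom_A(V, W)_d *)
Definition HomA V W : subspace (V -> W) := span [set f | exists d, ghom d f].

Definition giso V W := exists2 f : V -> W, ghom 0 f & bijective f.

Definition projective_gmod (P : gmod A) :=
  forall V W (p : V -> W) (f : P -> W), ghom 0 p -> (forall w, exists v, p v = w) ->
  ghom 0 f -> exists2 g : P -> V, ghom 0 g & p \o g = f.

Definition injective_gmod (Q : gmod A) :=
  forall V W (i : V -> W) (f : V -> Q), ghom 0 i -> injective i ->
  ghom 0 f -> exists2 g : W -> Q, ghom 0 g & g \o i = f.

Definition irreducible_gmod V :=
  (exists v : V, v <> 0) /\
  (forall N : gsubmod V, (forall v, N v -> v = 0) \/ (forall v, N v)).

(* a projective module with an epimorphism onto V whose kernel is superfluous *)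
Definition projective_cover (P V : gmod A) :=
  projective_gmod P /\ exists p : P -> V, [/\ ghom 0 p, forall v, exists x, p x = v &
    forall N : gsubmod P,
      (forall x, exists n z, [/\ N n, p z = 0 & x = n + z]) -> forall x, N x].

Definition locally_fd V := forall i d,
  fin_dim [set v | gm_deg V d v /\ la_one A i |> v = v].

Definition bounded_above V := forall i, exists N : int, forall d, N < d ->
  forall v, gm_deg V d v -> la_one A i |> v = v -> v = 0.

Definition alg_locally_fd := forall i j d,
  fin_dim [set a | [/\ la_deg A d a, la_one A i ** a = a & a ** la_one A j = a]].

Definition alg_bounded_below := forall i j, exists N : int, forall d, d < N ->
  forall a, la_deg A d a -> la_one A i ** a = a -> a ** la_one A j = a -> a = 0.

Record proj_resolution V := ProjResolution {
  res_obj : nat -> gmod A;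
  res_d : forall n, res_obj n.+1 -> res_obj n;
  res_aug : res_obj 0 -> V;
  res_proj : forall n, projective_gmod (res_obj n);
  res_d_hom : forall n, ghom 0 (@res_d n);
  res_aug_hom : ghom 0 res_aug;
  res_aug_surj : forall v, exists x, res_aug x = v;
  res_exact0 : forall x, res_aug x = 0 <-> exists y, res_d y = x;
  res_exactS : forall n (x : res_obj n.+1), res_d x = 0 <-> exists y, res_d y = x }.

Section Ext.
Context (V W : gmod A) (R : proj_resolution V).
Local Notation P := (res_obj R).

Lemma ghom0 (U : gmod A) : ghom 0 (0 : U -> W).
Proof.
split=> [|a v|n v _]; first exact: lin_zero.
- by rewrite (lin0 (gm_actLr a)).
- exact: ss0.
Qed.

Lemma ghomL (U : gmod A) (c : k) (f g : U -> W) :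
  ghom 0 f -> ghom 0 g -> ghom 0 (c *: f + g).
Proof.
move=> [f1 f2 f3] [g1 g2 g3]; split=> [|a v|n v h]; first exact: lin_comb.
- by rewrite gm_actLr -f2 -g2.
- by apply: ssL; [exact: f3 | exact: g3].
Qed.

Definition cocycle_set n : set (P n -> W) :=
  [set f | ghom 0 f /\ forall x, f (res_d x) = 0].

Lemma cocycle0 n : cocycle_set (0 : P n -> W).
Proof. by split=> //; exact: ghom0. Qed.
Lemma cocycleL n (c : k) (f g : P n -> W) :
  cocycle_set f -> cocycle_set g -> cocycle_set (c *: f + g).
Proof.
move=> [f1 f2] [g1 g2]; split=> [|x]; first exact: ghomL.
by have := zero_ssL c (f2 x) (g2 x).
Qed.
Definition cocycle n : subspace (P n -> W) := Subspace (@cocycle0 n) (@cocycleL n).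

Lemma coboundary0 n : exists2 g : P n -> W, ghom 0 g & 0 = g \o @res_d _ R n.
Proof. by exists 0 => //; exact: ghom0. Qed.
Lemma coboundaryL n (c : k) (f f' : P n.+1 -> W) :
  (exists2 g : P n -> W, ghom 0 g & f = g \o @res_d _ R n) ->
  (exists2 g : P n -> W, ghom 0 g & f' = g \o @res_d _ R n) ->
  exists2 g : P n -> W, ghom 0 g & c *: f + f' = g \o @res_d _ R n.
Proof. by move=> [g hg ->] [g' hg' ->]; exists (c *: g + g') => //; exact: ghomL. Qed.

Definition coboundary n : subspace (P n -> W) :=
  match n with
  | 0 => zero_ss (P 0 -> W)
  | m.+1 => @Subspace _ (P m.+1 -> W)
      [set f | exists2 g : P m -> W, ghom 0 g & f = g \o @res_d _ R m]
      (coboundary0 m) (@coboundaryL m)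
  end.

(* Ext^n_{A-gmod}(V, W), computed from the projective resolution R of V *)
Definition Ext_gmod n : lmodType k := subquo_lmod (cocycle n) (coboundary n).

End Ext.

(* Ext^n_A(V, W) = ⊕_d Ext^n_{A-gmod}(q^d V, W) vanishes; A-gmod has enough projectives,
   and Ext_gmod does not depend on the resolution R up to isomorphism. *)
Definition ExtA_zero n V W :=
  forall d (R : proj_resolution (shift d V)) (x : Ext_gmod W R n), x = 0.

End GradedCategory.

Arguments ghom {k A} V W d.
Arguments HomA {k A} V W.

Record triangular_basis (k : fieldType) (A : lualg k) (disp : Order.disp_t)
    (Lam : porderType disp) := TriangularBasis {
  tb_S : set (la_idx A);
  tb_dot : tb_S -> Lam;
  tb_X : la_idx A -> tb_S -> set A;
  tb_H : tb_S -> tb_S -> set A;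
  tb_Y : tb_S -> la_idx A -> set A;
  tb_lower_finite : forall l : Lam, finite_set [set m : Lam | (m <= l)%O];
  tb_fibers : forall l : Lam, finite_set [set s | tb_dot s = l];
  tb_X_hom : forall i s x, tb_X i s x ->
    [/\ homogeneous (la_deg A) x, la_one A i ** x = x & x ** la_one A (val s) = x];
  tb_H_hom : forall s t h, tb_H s t h ->
    [/\ homogeneous (la_deg A) h, la_one A (val s) ** h = h & h ** la_one A (val t) = h];
  tb_Y_hom : forall t j y, tb_Y t j y ->
    [/\ homogeneous (la_deg A) y, la_one A (val t) ** y = y & y ** la_one A j = y];
  tb_basis : basis_family
    [set p : A * A * A | exists s t,
       [/\ exists i, tb_X i s p.1.1, tb_H s t p.1.2 & exists j, tb_Y t j p.2]]
    (fun p => p.1.1 ** p.1.2 ** p.2);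
  tb_diag : forall s, tb_X (val s) s = [set la_one A (val s)] /\
                    tb_Y s (val s) = [set la_one A (val s)];
  tb_order : forall s t, s != t ->
    [/\ tb_X (val s) t !=set0 -> (tb_dot t < tb_dot s)%O,
        tb_H s t !=set0 -> tb_dot s = tb_dot t &
        tb_Y s (val t) !=set0 -> (tb_dot s < tb_dot t)%O];
  tb_outside : forall i, ~ tb_S i ->
    finite_set [set s | tb_X i s !=set0] /\ finite_set [set s | tb_Y s i !=set0] }.

Section Strata.
Context (k : fieldType) (A : lualg k) (disp : Order.disp_t) (Lam : porderType disp).
Context (T : triangular_basis A Lam).
Implicit Types l m : Lam.

(* e_λ; the fibres are finite, so that the sum is the genuine one *)
Definition tb_e l : A :=
  \sum_(s \in [set s : tb_S T | tb_dot s = l]) la_one A (val s).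

Lemma tb_e_deg l : la_deg A 0 (tb_e l).
Proof. by apply: ss_sum => s _; exact: la_deg1. Qed.

Lemma tb_eK l : tb_e l ** tb_e l = tb_e l.
Proof.
rewrite /tb_e mulA_suml; apply: eq_big_seq => s hs.
rewrite mulA_sumr (bigD1_seq s) //=.
rewrite la_orth eqxx big1 ?addr0 // => t ne.
by rewrite la_orth (inj_eq val_inj) eq_sym (negbTE ne).
Qed.

Lemma tb_gen_hom l :
  [set tb_e m | m in [set m | ~~ (l <= m)%O]] `<=` homogeneous (la_deg A).
Proof. by move=> _ [m _ <-]; exists 0; exact: tb_e_deg. Qed.

(* A_{≥λ} *)
Definition alg_ge l : lualg k := quo_alg (gen_ideal (@tb_gen_hom l)).

Definition proj_ge l : A -> alg_ge l := quo_proj _.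

Lemma ebarK l : proj_ge l (tb_e l) ** proj_ge l (tb_e l) = proj_ge l (tb_e l).
Proof. by rewrite -quo_projM tb_eK. Qed.
Lemma ebar_deg l : la_deg (alg_ge l) 0 (proj_ge l (tb_e l)).
Proof. by exists (tb_e l) => //; exact: tb_e_deg. Qed.
Definition ebar l : idem (alg_ge l) := Idem (ebarK l) (ebar_deg l).

(* A_λ *)
Definition alg_at l : lualg k := corner (ebar l).

(* j^λ_! and j^λ_*, followed by inflation to A *)
Definition j_shriek l (V : gmod (alg_at l)) : gmod A := inflate (jshriek V).
Definition j_star l (V : gmod (alg_at l)) : gmod A := inflate (jstar V).

Definition full_irreducibles (B : Lam -> Type) (L : forall l, B l -> gmod (alg_at l)) :=
  [/\ forall l (b : B l), irreducible_gmod (L l b),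
      forall l (S : gmod (alg_at l)), irreducible_gmod S ->
        exists (b : B l) d, giso S (shift d (L l b)) &
      forall l (b b' : B l) d, giso (L l b) (shift d (L l b')) -> b = b'].

Definition nabla_layer l (M : gmod A) := exists V : gmod (alg_at l),
  [/\ injective_gmod V, locally_fd V, bounded_above V & giso M (j_star V)].

Definition nablabar_layer l (M : gmod A) := exists V : gmod (alg_at l),
  [/\ locally_fd V, bounded_above V & giso M (j_star V)].

Definition has_flag (layer : Lam -> gmod A -> Prop) (V : gmod A) :=
  exists (n : nat) (F : nat -> gsubmod V) (w : 'I_n -> Lam),
  [/\ forall v, F 0 v, forall v, F n v -> v = 0, injective w &
      forall r : 'I_n, F r.+1 `<=` F r /\ layer (w r) (subquo_gmod (F r) (F r.+1))].

(* the weights of the b such that Hom_A(D b, V) ≠ 0 *)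
Definition hom_supp (B : Lam -> Type) (D : forall l, B l -> gmod A) (V : gmod A) : set Lam :=
  [set l | exists b : B l, exists2 f, HomA (D l b) V f & f <> 0].

End Strata.

Arguments alg_at {k A disp Lam} T l.
Arguments j_shriek {k A disp Lam} T {l} V.
Arguments j_star {k A disp Lam} T {l} V.
Arguments nabla_layer {k A disp Lam} T l M.
Arguments nablabar_layer {k A disp Lam} T l M.

(* Main.v *)
From mathcomp Require Import all_boot all_order all_algebra.
From mathcomp Require Import all_classical.
From mathcomp Require Import zify.
Require Import Defs.

(** Fix a weight [l], with ideal [J = J_l], idempotent [e] and weight algebra
    [A_l = e (A / J) e], and write [j_!] and [j_*] for induction and coinduction from
    [A_l]. Both parts of the theorem follow from one argument ([flag_criterion]), for
    test modules [D b] that are induced from projective or from irreducible modules, and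
    for layers [j_* W] with [W] arbitrary or injective.

    Vanishing of extensions. The functor [G M = e (M / J M)] is left adjoint to [j_*], and
    a map from [U] to [j_* W] extends to [X] if and only if its adjoint [G U -> W] extends
    to [G X]. When [0 -> U -> X -> M -> 0] is exact and [Tor_1] of the right standard
    modules with [M] vanishes, [0 -> G U -> G X -> G M -> 0] is exact, and the extension
    exists if [W] is injective or [G M] is projective ([ext1z_star]). The triangular basis
    turns the Tor condition into a statement on elements: relations between the [x] of one
    weight are trivial modulo smaller weights ([tor_free]). In this form it holds for
    induced modules and for projectives, by taking coefficients with respect to the basis
    ([shriek_tor_free], [projective_tor_free]), and it passes to kernels, by moving the
    coefficients of one maximal weight after the other into the kernel ([Jm_exact],
    [tor_free_ker]). Projectivity of all [G M] passes to kernels too, and holds for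
    projective [M] because [j_*] preserves surjections ([projective_mumap_lift]). So all
    syzygies of the test modules are acyclic for the layers, and the higher Ext groups of
    the test modules with values in a module with a flag vanish. The support is contained
    in the set of weights of the flag, because [j_!] and [j_*] of different weights have no
    nonzero homomorphisms between them.

    Construction of flags. Let the first extension groups into [V] vanish, and let [l] be
    maximal in the finite support of [V]. Let [Y] be the largest submodule of [V] that is
    killed by [J]. It is isomorphic to [j_* W], for [W = e Y], because a nonzero kernel or
    cokernel of the canonical map [Y -> j_* W] would admit a nonzero map from a [D b] of
    weight larger than [l]. In the first case this contradicts the maximality of [l]. In the
    second case it contradicts [Ext^1(D b, Y) = 0], which holds as there are no maps from
    [D b] to [V / Y] ([bottom_layer]). Since the second extension groups into [Y] vanish,
    [V / Y] inherits the assumption, and the weight [l] disappears from its support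
    ([build_flag]).

    For the test modules induced from irreducibles it remains to see that [W] is injective.
    Its first extensions by irreducibles vanish ([ext1z_corner]), and a Baer argument
    suffices: [W] is bounded above and [A_l] is bounded below, so that elements of large
    degree can only be sent to zero, and the quotient by the domain of a maximal extension,
    being bounded above, has an irreducible submodule unless it is zero ([baer],
    [socle]). *)

Set Implicit Arguments.
Unset Strict Implicit.
Unset Printing Implicit Defensive.

Import Order.TTheory GRing.Theory Num.Theory.

Local Open Scope classical_set_scope.
Local Open Scope ring_scope.

(** * Homomorphisms of degree zero and graded submodules *)

Lemma span_map (k : fieldType) (U V : lmodType k) (f : U -> V) (P : set U)
  (S : subspace V) : linear f -> (forall x, P x -> S (f x)) ->
  forall x, span P x -> S (f x).
Proof. by move=> lf h; exact: (@span_min _ _ P (pre_ss lf S)). Qed.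

Lemma gr_span_map (k : fieldType) (U V : lmodType k) (F : int -> subspace U)
  (hF : is_grading F) (f : U -> V) (S : subspace V) : linear f ->
  (forall n x, F n x -> S (f x)) -> forall x, S (f x).
Proof.
by move=> lf h x; apply: (span_map lf _ (gr_span hF x)) => y [n]; exact: h.
Qed.

Section Homs.
Context (k : fieldType) (A : lualg k).
Implicit Types U V W X Y Z M : gmod A.

Definition hom0 V W (f : V -> W) :=
  [/\ linear f, forall a v, f (a |> v) = a |> f v &
      forall n v, gm_deg V n v -> gm_deg W n (f v)].

Lemma ghom0P V W (f : V -> W) : ghom V W 0 f <-> hom0 f.
Proof.
by split=> -[h1 h2 h3]; split=> // n v /h3; rewrite addr0.
Qed.

Lemma ghom_shiftP d V W (f : V -> W) : ghom V W d f <-> hom0 (f : shift d V -> W).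
Proof.
split=> -[h1 h2 h3]; split=> // n v hv.
  by rewrite -[n](subrK d); apply: h3.
by apply: h3; rewrite /= addrK.
Qed.

Lemma hom0_lin V W (f : V -> W) : hom0 f -> linear f. Proof. by case. Qed.
Lemma hom0_act V W (f : V -> W) : hom0 f -> forall a v, f (a |> v) = a |> f v.
Proof. by case. Qed.
Lemma hom0_deg V W (f : V -> W) : hom0 f -> forall n v, gm_deg V n v -> gm_deg W n (f v).
Proof. by case. Qed.

Lemma hom0_0 V W (f : V -> W) : hom0 f -> f 0 = 0.
Proof. by move/hom0_lin/lin0. Qed.
Lemma hom0D V W (f : V -> W) u v : hom0 f -> f (u + v) = f u + f v.
Proof. by move/hom0_lin/linD. Qed.
Lemma hom0B V W (f : V -> W) u v : hom0 f -> f (u - v) = f u - f v.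
Proof. by move/hom0_lin/linB. Qed.
Lemma hom0_pr V W (f : V -> W) : hom0 f ->
  forall n v, f (gr_pr (gm_graded V) n v) = gr_pr (gm_graded W) n (f v).
Proof.
move=> [lf _ df] n v.
rewrite (@gr_pr_map _ _ _ _ _ (gm_graded V) (gm_graded W) f 0) ?addr0 // => d w hw.
by rewrite addr0; exact: df.
Qed.

Lemma hom0_inj V W (f : V -> W) : hom0 f -> (forall v, f v = 0 -> v = 0) -> injective f.
Proof.
move=> hf h x y e; apply/eqP; rewrite -subr_eq0; apply/eqP/h.
by rewrite (hom0B _ _ hf) e subrr.
Qed.

Lemma hom0_inj0 V W (f : V -> W) : hom0 f -> injective f -> forall v, f v = 0 -> v = 0.
Proof. by move=> hf hi v e; apply: hi; rewrite e (hom0_0 hf). Qed.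

Lemma hom0_id V : hom0 (fun v : V => v).
Proof. by []. Qed.

Lemma hom0_zero V W : hom0 (fun _ : V => 0 : W).
Proof.
split=> [c u v|a v|n v _]; first by rewrite scaler0 addr0.
- by rewrite (lin0 (gm_actLr a)).
- exact: ss0.
Qed.

Lemma hom0_comp U V W (f : U -> V) (g : V -> W) :
  hom0 f -> hom0 g -> hom0 (fun x => g (f x)).
Proof.
move=> [f1 f2 f3] [g1 g2 g3]; split=> [c x y|a x|n x hx].
- by rewrite f1 g1.
- by rewrite f2 g2.
- by apply: g3; exact: f3.
Qed.

Lemma hom0_comb V W (f g : V -> W) : hom0 f -> hom0 g -> hom0 (fun x => f x + g x).
Proof.
move=> [f1 f2 f3] [g1 g2 g3]; split=> [c x y|a x|n x hx].
- by rewrite f1 g1 scalerDr addrACA.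
- by rewrite f2 g2 (linD _ _ (gm_actLr a)).
- by apply: ssD; [exact: f3 | exact: g3].
Qed.

Lemma hom0_diff V W (f g : V -> W) : hom0 f -> hom0 g -> hom0 (fun x => f x - g x).
Proof.
move=> [f1 f2 f3] [g1 g2 g3]; split=> [c x y|a x|n x hx].
- by rewrite f1 g1 scalerBr opprD addrACA.
- by rewrite f2 g2 (linB _ _ (gm_actLr a)).
- by apply: ssB; [exact: f3 | exact: g3].
Qed.

Lemma gs_pr V (N : gsubmod V) d v : N v -> N (gr_pr (gm_graded V) d v).
Proof. by move=> h; apply: gr_pr_stable => //; exact: gs_hom. Qed.

Definition mk_gsub V (S : subspace V) (h1 : forall a v, S v -> S (a |> v))
  (h2 : forall d v, S v -> S (gr_pr (gm_graded V) d v)) : gsubmod V :=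
  GSubmod h1 (gr_stable_hom h2).

Section PreIm.
Context (V W : gmod A) (f : V -> W) (hf : hom0 f).

Lemma gpre_act (N : gsubmod W) a v :
  pre_ss (hom0_lin hf) N v -> pre_ss (hom0_lin hf) N (a |> v).
Proof. by rewrite /= /preimage /= hom0_act //; exact: gs_act. Qed.
Lemma gpre_pr (N : gsubmod W) d v :
  pre_ss (hom0_lin hf) N v -> pre_ss (hom0_lin hf) N (gr_pr (gm_graded V) d v).
Proof. by rewrite /= /preimage /= hom0_pr //; exact: gs_pr. Qed.
Definition gpre (N : gsubmod W) : gsubmod V := mk_gsub (@gpre_act N) (@gpre_pr N).

Lemma gim_act (N : gsubmod V) a v :
  im_ss (hom0_lin hf) N v -> im_ss (hom0_lin hf) N (a |> v).
Proof. by move=> [x hx <-]; exists (a |> x); [exact: gs_act | exact: hom0_act]. Qed.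
Lemma gim_pr (N : gsubmod V) d v :
  im_ss (hom0_lin hf) N v -> im_ss (hom0_lin hf) N (gr_pr (gm_graded W) d v).
Proof.
by move=> [x hx <-]; exists (gr_pr (gm_graded V) d x); [exact: gs_pr | exact: hom0_pr].
Qed.
Definition gim (N : gsubmod V) : gsubmod W := mk_gsub (@gim_act N) (@gim_pr N).
End PreIm.

Lemma gfull_pr V d v : full_ss V v -> full_ss V (gr_pr (gm_graded V) d v).
Proof. by []. Qed.
Definition gfull V : gsubmod V := @mk_gsub V (full_ss V) (fun _ _ _ => I) (@gfull_pr V).

Lemma gzero_act V a v : zero_ss V v -> zero_ss V (a |> v).
Proof. by rewrite /= /set1 /mkset => ->; exact: lin0 (gm_actLr a). Qed.
Lemma gzero_pr V d v : zero_ss V v -> zero_ss V (gr_pr (gm_graded V) d v).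
Proof. by rewrite /= /set1 /mkset => ->; exact: lin0 (gr_pr_lin _ _). Qed.
Definition gzero V : gsubmod V := mk_gsub (@gzero_act V) (@gzero_pr V).

Definition gker V W (f : V -> W) (hf : hom0 f) : gsubmod V := gpre hf (gzero W).

Lemma hom0_sub V (N : gsubmod V) : hom0 (@sub_val k V N : sub_gmod N -> V).
Proof. by split=> // n v. Qed.

Lemma hom0_quo V (N : gsubmod V) : hom0 (qpi N : V -> quo_gmod N).
Proof.
split=> [|a v|n v hv]; first exact: qpiL.
- by rewrite -[LHS]quo_actE.
- by exists v.
Qed.

Lemma quo_surj V (N : gsubmod V) (x : quo_gmod N) : exists v, qpi N v = x.
Proof. by exists (qrepr x); exact: qreprK. Qed.

Lemma factor_surj V W Z (q : V -> W) (f : V -> Z) :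
  hom0 q -> (forall w, exists v, q v = w) -> hom0 f -> (forall v, q v = 0 -> f v = 0) ->
  exists2 g : W -> Z, hom0 g & forall v, g (q v) = f v.
Proof.
move=> hq sq hf h.
pose c w := projT1 (cid (sq w)); have cE w : q (c w) = w by rewrite /c; case: cid.
have gE v : f (c (q v)) = f v.
  apply/eqP; rewrite -subr_eq0 -(hom0B _ _ hf); apply/eqP/h.
  by rewrite (hom0B _ _ hq) cE subrr.
exists (fun w => f (c w)) => //; split=> [a x y|a x|n x hx].
- by rewrite -{1}[x]cE -{1}[y]cE -(hom0_lin hq) gE (hom0_lin hf).
- by rewrite -{1}[x]cE -(hom0_act hq) gE (hom0_act hf).
(* a homogeneous element has a homogeneous preimage *)
- have e : q (gr_pr (gm_graded V) n (c x)) = x by rewrite (hom0_pr hq) cE gr_pr_id.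
  by rewrite -e gE; apply: (hom0_deg hf); exact: gr_prP.
Qed.

Lemma factor_inj V W Z (u : W -> Z) (f : V -> Z) :
  hom0 u -> injective u -> hom0 f -> (forall v, exists w, u w = f v) ->
  exists2 g : V -> W, hom0 g & forall v, u (g v) = f v.
Proof.
move=> hu iu hf h.
pose c v := projT1 (cid (h v)); have cE v : u (c v) = f v by rewrite /c; case: cid.
exists c => //; split=> [a x y|a x|n x hx].
- by apply: iu; rewrite (hom0_lin hu) !cE (hom0_lin hf).
- by apply: iu; rewrite (hom0_act hu) !cE (hom0_act hf).
- have <- : gr_pr (gm_graded W) n (c x) = c x; last exact: gr_prP.
  by apply: iu; rewrite (hom0_pr hu) cE gr_pr_id //; exact: hom0_deg hf _ _ hx.
Qed.

Lemma hom0_inverse V W (f : V -> W) : hom0 f -> bijective f ->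
  exists g : W -> V, [/\ hom0 g, cancel f g & cancel g f].
Proof.
move=> hf [g h1 h2].
have [g' hg' h] := factor_inj hf (can_inj h1) (@hom0_id W) (fun w => ex_intro _ (g w) (h2 w)).
by exists g'; split=> // v; apply: (can_inj h1); rewrite h.
Qed.

Lemma hom0_bij V W (f : V -> W) : hom0 f -> (forall v, f v = 0 -> v = 0) ->
  (forall w, exists v, f v = w) -> bijective f.
Proof.
move=> hf fi fs; have ii := hom0_inj hf fi.
exists (fun w => projT1 (cid (fs w))) => [v|w]; last by case: cid.
by case: cid => v' /= /ii.
Qed.

Section Gen.
Context (V : gmod A) (H : set V) (hH : H `<=` homogeneous (gm_deg V)).
Let S := span [set x | exists a h, H h /\ x = a |> h].

Lemma ggen_act a v : S v -> S (a |> v).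
Proof.
apply: (span_map (gm_actLr a)) => _ [b [h [hh ->]]].
by apply: span_sub; exists (a ** b), h; rewrite gm_actA.
Qed.

Lemma ggen_pr d v : S v -> S (gr_pr (gm_graded V) d v).
Proof.
apply: (span_map (gr_pr_lin (gm_graded V) d)) => _ [b [h [hh ->]]].
have [n hn] := hH hh.
have lb : linear (fun b : A => gr_pr (gm_graded V) d (b |> h)).
  by move=> c x y; rewrite gm_actLl gr_pr_lin.
apply: (gr_span_map (la_graded A) lb) => m {}b hb.
have hd : gm_deg V (m + n) (b |> h) by exact: gm_degM.
case: (eqVneq (m + n) d) => [<-|ne].
  by rewrite gr_pr_id //; apply: span_sub; exists b, h.
by rewrite (gr_pr_ne _ ne) //; exact: ss0.
Qed.

Definition ggen : gsubmod V := mk_gsub ggen_act ggen_pr.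

Lemma ggen_min (N : gsubmod V) : H `<=` N -> ggen `<=` N.
Proof. by move=> h x; apply: (@span_min _ _ _ N) => _ [a [y [/h hy ->]]]; exact: gs_act. Qed.

Lemma ggen_sub : H `<=` ggen.
Proof.
move=> h hh; have [s [_ ->]] := gm_unital h.
by apply: (@ss_sum _ _ S) => i _; apply: span_sub; exists (la_one A i), h.
Qed.
End Gen.

End Homs.

Section Prod.
Context (k : fieldType) (A : lualg k) (V W : gmod A).

Lemma fst_lin : linear (fun p : V * W => p.1). Proof. by []. Qed.
Lemma snd_lin : linear (fun p : V * W => p.2). Proof. by []. Qed.
Lemma inl_lin : linear (fun v : V => (v, 0) : V * W).
Proof. by move=> c u v; congr (_, _); rewrite /= scaler0 addr0. Qed.
Lemma inr_lin : linear (fun w : W => (0, w) : V * W).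
Proof. by move=> c u v; congr (_, _); rewrite /= scaler0 addr0. Qed.

Definition prod_act (a : A) (p : V * W) : V * W := (a |> p.1, a |> p.2).
Definition prod_deg n : subspace (V * W)%type :=
  @Subspace k (V * W)%type [set p | gm_deg V n p.1 /\ gm_deg W n p.2]
  (conj (ss0 (gm_deg V n)) (ss0 (gm_deg W n)))
  (fun c u v hu hv => conj (ssL c hu.1 hv.1) (ssL c hu.2 hv.2)).

Lemma prod_actLl p : linear (prod_act^~ p).
Proof. by move=> c a b; congr (_, _); rewrite /= gm_actLl. Qed.
Lemma prod_actLr a : linear (prod_act a).
Proof. by move=> c u v; congr (_, _); rewrite /= gm_actLr. Qed.
Lemma prod_actA a b p : prod_act a (prod_act b p) = prod_act (a ** b) p.
Proof. by congr (_, _); rewrite /= gm_actA. Qed.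
Lemma prod_unital p : locally_unital (fun i => prod_act (la_one A i)) p.
Proof.
have [s [us hs]] := gm_unital p.1; have [t [ut ht]] := gm_unital p.2.
exists (undup (s ++ t)); split; first exact: undup_uniq.
have h1 := lu_ext (@act_one_lin _ _ V) (@act_orth _ _ V) us (undup_uniq (s ++ t)) _ hs.
have h2 := lu_ext (@act_one_lin _ _ W) (@act_orth _ _ W) ut (undup_uniq (s ++ t)) _ ht.
rewrite [LHS]surjective_pairing [RHS]surjective_pairing; congr (_, _).
- rewrite {1}h1; last by move=> x xs; rewrite mem_undup mem_cat xs.
  by rewrite (lin_sum _ _ _ fst_lin).
- rewrite {1}h2; last by move=> x xs; rewrite mem_undup mem_cat xs orbT.
  by rewrite (lin_sum _ _ _ snd_lin).
Qed.

Lemma prod_graded : is_grading prod_deg.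
Proof.
pose pr d (p : V * W) : V * W := (gr_pr (gm_graded V) d p.1, gr_pr (gm_graded W) d p.2).
apply: (@gr_intro _ _ _ pr) => [d c u v|d v [h1 h2]|d e v ne [h1 h2]|v].
- by rewrite /pr /= !gr_pr_lin.
- by rewrite /pr !gr_pr_id // -surjective_pairing.
- by rewrite /pr !(gr_pr_ne _ ne).
have -> : v = (v.1, 0) + (0, v.2).
  by rewrite [LHS]surjective_pairing; congr (_, _); rewrite /= ?addr0 ?add0r.
apply: ssD.
- apply: (gr_span_map (gm_graded V) inl_lin) => n x hx.
  by apply: span_sub; exists n; split=> //; exact: ss0.
- apply: (gr_span_map (gm_graded W) inr_lin) => n x hx.
  by apply: span_sub; exists n; split=> //; exact: ss0.
Qed.

Lemma prod_degM m n a p : la_deg A m a -> prod_deg n p -> prod_deg (m + n) (prod_act a p).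
Proof. by move=> ha [h1 h2]; split; exact: gm_degM. Qed.

Definition prod_gmod : gmod A :=
  GMod prod_actLl prod_actLr prod_actA prod_unital prod_graded prod_degM.

Lemma hom0_fst : hom0 (fun p : prod_gmod => p.1).
Proof. by split=> // n v []. Qed.
Lemma hom0_snd : hom0 (fun p : prod_gmod => p.2).
Proof. by split=> // n v []. Qed.
End Prod.

(** * Free modules *)

Section Free.
Context (k : fieldType) (A : lualg k).
Context (G : choiceType) (ix : G -> la_idx A) (dg : G -> int).

Lemma free_ss0 : (forall g, (0 : G -> A) g ** la_one A (ix g) = 0) /\
  exists s : seq G, forall g, g \notin s -> (0 : G -> A) g = 0.
Proof. by split; [move=> g; exact: mul0A | exists [::]]. Qed.

Lemma free_ssL (c : k) (u v : G -> A) :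
  (forall g, u g ** la_one A (ix g) = u g) /\
    (exists s : seq G, forall g, g \notin s -> u g = 0) ->
  (forall g, v g ** la_one A (ix g) = v g) /\
    (exists s : seq G, forall g, g \notin s -> v g = 0) ->
  (forall g, (c *: u + v) g ** la_one A (ix g) = (c *: u + v) g) /\
    (exists s : seq G, forall g, g \notin s -> (c *: u + v) g = 0).
Proof.
move=> [u1 [s us]] [v1 [t vt]]; split=> [g|].
  change ((c *: u g + v g) ** la_one A (ix g) = c *: u g + v g).
  by rewrite la_mulLl u1 v1.
exists (s ++ t) => g; rewrite mem_cat negb_or => /andP[gs gt].
by change (c *: u g + v g = 0); rewrite us // vt // scaler0 addr0.
Qed.

Definition free_ss : subspace (G -> A) :=
  @Subspace k (G -> A) [set f | (forall g, f g ** la_one A (ix g) = f g) /\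
    exists s : seq G, forall g, g \notin s -> f g = 0] free_ss0 free_ssL.

Local Notation F := (sub_lmod free_ss).
Let ev (f : F) g : A := sub_val f g.

Lemma free_evL c (f f' : F) g : ev (c *: f + f') g = c *: ev f g + ev f' g.
Proof. by []. Qed.
Let ev_lin g : linear (ev^~ g). Proof. by move=> c f f'. Qed.

Lemma free_inj (f f' : F) : ev f =1 ev f' -> f = f'.
Proof. by move=> h; apply: sub_val_inj; apply/funext. Qed.

Lemma free_single_in g a :
  free_ss (fun g' => if g' == g then a ** la_one A (ix g) else 0).
Proof.
split=> [g'|]; last by exists [:: g] => g'; rewrite inE => /negbTE ->.
by case: eqP => [->|_]; rewrite ?mul0A // -la_mulA la_orth eqxx.
Qed.
Definition single g a : F := ssub (free_single_in g a).

Lemma single_lin g : linear (single g).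
Proof.
move=> c a b; apply: free_inj => g'; rewrite free_evL /ev /=.
by case: eqP => _; rewrite ?la_mulLl // scaler0 addr0.
Qed.

Lemma free_dec (f : F) (s : seq G) : uniq s -> (forall g, g \notin s -> ev f g = 0) ->
  f = \sum_(g <- s) single g (ev f g).
Proof.
move=> us hs; apply: free_inj => g; rewrite (lin_sum _ _ _ (ev_lin g)).
case: (boolP (g \in s)) => gs; last first.
  rewrite hs // big_seq big1 // => g' g's; rewrite /ev /=.
  by case: eqP gs => // ->; rewrite g's.
rewrite (bigD1_seq g) //= big1 => [|g' ne]; rewrite /ev /=.
  by rewrite eqxx addr0; have [-> _] := sub_valP f.
by rewrite eq_sym (negbTE ne).
Qed.

Lemma free_supp (f : F) : exists s : seq G, uniq s /\ forall g, g \notin s -> ev f g = 0.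
Proof.
have [_ [s hs]] := sub_valP f; exists (undup s); split; first exact: undup_uniq.
by move=> g; rewrite mem_undup; exact: hs.
Qed.

Lemma free_ind (S : subspace F) : (forall g a, S (single g a)) -> forall f, S f.
Proof.
move=> h f; have [s [us hs]] := free_supp f; rewrite (free_dec us hs).
by apply: ss_sum => g _; exact: h.
Qed.

Lemma free_act_in a (f : F) : free_ss (fun g => a ** ev f g).
Proof.
have [f1 [s fs]] := sub_valP f; split=> [g|]; first by rewrite -la_mulA f1.
by exists s => g gs; rewrite /ev fs // mulA0.
Qed.
Definition free_act a (f : F) : F := ssub (free_act_in a f).

Lemma free_actLl f : linear (free_act^~ f).
Proof. by move=> c a b; apply: free_inj => g; rewrite free_evL; exact: la_mulLl. Qed.
Lemma free_actLr a : linear (free_act a).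
Proof. by move=> c f f'; apply: free_inj => g; rewrite free_evL; exact: la_mulLr. Qed.
Lemma free_actA a b f : free_act a (free_act b f) = free_act (a ** b) f.
Proof. by apply: free_inj => g; exact: la_mulA. Qed.

Lemma act_single b g a : free_act b (single g a) = single g (b ** a).
Proof.
apply: free_inj => g'; rewrite /ev /= /ev /=.
by case: eqP => _; [rewrite la_mulA | rewrite mulA0].
Qed.

Lemma free_unital f : locally_unital (fun i => free_act (la_one A i)) f.
Proof.
have orth i j h : free_act (la_one A i) (free_act (la_one A j) h) =
    if i == j then free_act (la_one A j) h else 0.
  rewrite free_actA la_orth; case: eqP => [->|_] //.
  exact: lin0 (free_actLl h).
apply: (@free_ind (lu_ss (fun i => free_actLr (la_one A i)) orth)) => g a.
have [s [us ea]] := la_unitl a.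
have -> : single g a = \sum_(i <- s) free_act (la_one A i) (single g a).
  by under eq_bigr do rewrite act_single; rewrite -(lin_sum _ _ _ (single_lin g)) -ea.
apply: ss_sum => i _; apply: (@lu_fixed _ _ _ _ i).
by rewrite orth eqxx.
Qed.

Definition free_deg n : subspace F :=
  @Subspace k F [set f | forall g, la_deg A (n - dg g) (ev f g)]
    (fun g => ss0 _) (fun c u v hu hv g => ssL c (hu g) (hv g)).

Lemma single_deg g a n : la_deg A n a -> free_deg (n + dg g) (single g a).
Proof.
move=> ha g'; rewrite /ev /=; case: eqP => [->|_]; last exact: ss0.
by rewrite addrK -[n]addr0; apply: la_degM => //; exact: la_deg1.
Qed.

Let prA := gr_pr (la_graded A).

Lemma free_pr_in n (f : F) : free_ss (fun g => prA (n - dg g) (ev f g)).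
Proof.
have [f1 [s fs]] := sub_valP f; split=> [g|].
  have := @gr_pr_map _ _ _ _ _ (la_graded A) (la_graded A)
    (fun a => a ** la_one A (ix g)) 0 (la_mulLl _).
  move=> /(_ _ (n - dg g) (ev f g)); rewrite addr0 /prA /ev f1; apply.
  by move=> d v hv; apply: la_degM => //; exact: la_deg1.
by exists s => g gs; rewrite /prA /ev fs // (lin0 (gr_pr_lin _ _)).
Qed.

Lemma free_graded : is_grading free_deg.
Proof.
apply: (@gr_intro _ _ _ (fun n f => ssub (free_pr_in n f))) => [d c u v|d v h|d e v ne h|].
- by apply: free_inj => g; rewrite free_evL; exact: gr_pr_lin.
- by apply: free_inj => g; exact: gr_pr_id (h g).
- apply: free_inj => g; rewrite /ev /=; apply: gr_pr_ne (h g).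
  by apply: contra_neq ne; exact: addIr.
apply: free_ind => g a; apply: (gr_span_map (la_graded A) (single_lin g)) => n x hx.
by apply: span_sub; exists (n + dg g); exact: single_deg.
Qed.

Lemma free_degM m n a f : la_deg A m a -> free_deg n f -> free_deg (m + n) (free_act a f).
Proof. by move=> ha hf g; rewrite -addrA; apply: la_degM. Qed.

(** As [A 1_i] consists of the [a] with [a 1_i = a], this is the direct sum of the
    [A 1_{ix g}], shifted so that the generator of index [g] has degree [dg g]. *)
Definition free : gmod A :=
  GMod free_actLl free_actLr free_actA free_unital free_graded free_degM.

Section FreeHom.
Context (X : gmod A) (x : G -> X).
Hypothesis x1 : forall g, la_one A (ix g) |> x g = x g.
Hypothesis xd : forall g, gm_deg X (dg g) (x g).

Let supp (f : F) := projT1 (cid (free_supp f)).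
Definition free_hom (f : free) : X := \sum_(g <- supp f) ev f g |> x g.

Lemma free_homE (f : free) (s : seq G) : uniq s -> (forall g, g \notin s -> ev f g = 0) ->
  free_hom f = \sum_(g <- s) ev f g |> x g.
Proof.
move=> us hs; have [uf hf] := projT2 (cid (free_supp f)).
pose t := undup (supp f ++ s).
have ext r : uniq r -> (forall g, g \notin r -> ev f g = 0) -> {subset r <= t} ->
    \sum_(g <- r) ev f g |> x g = \sum_(g <- t) ev f g |> x g.
  move=> ur hr rt; rewrite -(@big_ext _ _ r t) ?undup_uniq //.
  apply: eq_bigr => g _; case: ifPn => // /hr ->.
  by rewrite (lin0 (gm_actLl _)).
by rewrite /free_hom !ext // => g hg; rewrite mem_undup mem_cat hg ?orbT.
Qed.

Lemma free_hom_single g a : free_hom (single g a) = a |> x g.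
Proof.
rewrite (@free_homE _ [:: g]) // => [|g']; last first.
  by rewrite inE /ev /= => /negbTE ->.
by rewrite big_seq1 /ev /= eqxx -gm_actA x1.
Qed.

Lemma free_hom_lin : linear free_hom.
Proof.
move=> c f f'; have [s [us hs]] := free_supp f; have [t [ut ht]] := free_supp f'.
pose r := undup (s ++ t); have ur : uniq r by exact: undup_uniq.
have hr g : g \notin r -> ev f g = 0 /\ ev f' g = 0.
  by rewrite mem_undup mem_cat negb_or => /andP[/hs ? /ht ?].
rewrite !(@free_homE _ r) //; try by move=> g /hr[e e'].
  rewrite scaler_sumr -big_split; apply: eq_bigr => g _; exact: gm_actLl.
move=> g /hr[e e']; have -> : ev (c *: f + f') g = c *: ev f g + ev f' g by [].
by rewrite e e' scaler0 addr0.
Qed.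

Lemma hom0_free : hom0 free_hom.
Proof.
split; first exact: free_hom_lin.
- move=> a f.
  have l1 : linear (fun f : free => free_hom (a |> f)).
    by move=> c u v; rewrite gm_actLr free_hom_lin.
  have l2 : linear (fun f : free => a |> free_hom f).
    by move=> c u v; rewrite free_hom_lin gm_actLr.
  apply/eqP; rewrite -subr_eq0; apply/eqP.
  apply: (@free_ind (pre_ss (lin_eq_ss l1 l2) (zero_ss X))) => g b.
  rewrite /= /preimage /=; apply/eqP; rewrite subr_eq0; apply/eqP.
  transitivity (free_hom (single g (a ** b))); first by congr free_hom; exact: act_single.
  by rewrite !free_hom_single gm_actA.
- move=> n f hf; apply: ss_sum => g _.
  by rewrite -[n](subrK (dg g)); apply: gm_degM.
Qed.
End FreeHom.

Lemma hom0_free_eq (X : gmod A) (f f' : free -> X) : linear f -> linear f' ->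
  (forall g a, f (single g a) = f' (single g a)) -> f =1 f'.
Proof.
move=> lf lf' h t; apply/eqP; rewrite -subr_eq0; apply/eqP.
apply: (@free_ind (pre_ss (lin_eq_ss lf lf') (zero_ss X))) => g a.
by rewrite /= /preimage /= h subrr.
Qed.

Lemma single1 g : la_one A (ix g) |> (single g (la_one A (ix g)) : free) =
  single g (la_one A (ix g)).
Proof.
by apply: etrans (act_single _ _ _) _; rewrite la_orth eqxx.
Qed.

Lemma single_act1 g a : (a |> (single g (la_one A (ix g)) : free)) = single g a.
Proof.
apply: etrans (act_single _ _ _) _; apply: free_inj => g'; rewrite /ev /=.
by case: eqP => // _; rewrite -la_mulA la_orth eqxx.
Qed.

Lemma free_projective : projective_gmod free.
Proof.
move=> V W p f /ghom0P hp sp /ghom0P hf.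
pose y g := f (single g (la_one A (ix g))).
have [c cE] := choice (fun g => sp (y g)).
pose x g := gr_pr (gm_graded V) (dg g) (la_one A (ix g) |> c g).
have x1 g : la_one A (ix g) |> x g = x g.
  have h d v : gm_deg V d v -> gm_deg V (d + 0) (la_one A (ix g) |> v).
    by move=> hv; rewrite addrC; apply: gm_degM => //; exact: la_deg1.
  have := gr_pr_map (gm_graded V) (gm_graded V) (gm_actLr (la_one A (ix g))) h.
  by rewrite /x => ->; rewrite addr0 act_orth eqxx.
have xd g : gm_deg V (dg g) (x g) by exact: gr_prP.
have hx := hom0_free x1 xd.
exists (free_hom x); first exact/ghom0P.
apply/funext; apply: hom0_free_eq => [||g a]; rewrite /comp.
- exact: hom0_lin (hom0_comp hx hp).
- exact: hom0_lin hf.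
rewrite free_hom_single // (hom0_act hp).
have -> : p (x g) = y g.
  rewrite /x (hom0_pr hp) (hom0_act hp) cE /y -(hom0_act hf) single1 gr_pr_id //.
  by apply: (hom0_deg hf); rewrite -[dg g]add0r; apply: single_deg; exact: la_deg1.
by rewrite /y -(hom0_act hf); congr f; exact: single_act1.
Qed.

End Free.

Section Cover.
Context (k : fieldType) (A : lualg k) (M : gmod A).

Let G : choiceType := (la_idx A * int * M)%type.
Let ix (g : G) := g.1.1.
Let dg (g : G) := g.1.2.
Let x (g : G) : M := gr_pr (gm_graded M) (dg g) (la_one A (ix g) |> g.2).

(** A free module with a surjection onto [M]: one generator for each homogeneous
    component of each [1_i m]. *)
Definition cover : gmod A := free ix dg.
Definition cover_map : cover -> M := free_hom x.

Let x1 g : la_one A (ix g) |> x g = x g.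
Proof.
have h d v : gm_deg M d v -> gm_deg M (d + 0) (la_one A (ix g) |> v).
  by move=> hv; rewrite addrC; apply: gm_degM => //; exact: la_deg1.
have := gr_pr_map (gm_graded M) (gm_graded M) (gm_actLr (la_one A (ix g))) h.
by rewrite /x => ->; rewrite addr0 act_orth eqxx.
Qed.

Lemma cover_map_hom : hom0 cover_map.
Proof. by apply: hom0_free => // g; exact: gr_prP. Qed.

Lemma cover_projective : projective_gmod cover.
Proof. exact: free_projective. Qed.

Lemma cover_map_surj v : exists t, cover_map t = v.
Proof.
pose S := im_ss (hom0_lin cover_map_hom) (full_ss cover).
suff [t _ <-] : S v by exists t.
have [s [_ ->]] := gm_unital v; apply: ss_sum => i _.
have [t /(_ _ (undup_uniq t)) ->] := gr_pr_sum (gm_graded M) (la_one A i |> v).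
  apply: ss_sum => d _; exists (single ix (i, d, v) (la_one A i)) => //.
  have e1 := @free_hom_single _ _ _ ix dg _ _ x1 (i, d, v) (la_one A i).
  exact: (etrans e1 (x1 (i, d, v))).
by move=> ?; rewrite mem_undup.
Qed.
End Cover.
Arguments cover_projective {k A} M.
Arguments cover_map_hom {k A} M.

(** * First extension groups *)

Section Ext.
Context (k : fieldType) (A : lualg k).
Implicit Types U V W X Y Z M N P Q : gmod A.

Definition surj V W (q : V -> W) := forall w, exists v, q v = w.

Lemma projP P V W (p : V -> W) (f : P -> W) : projective_gmod P ->
  hom0 p -> surj p -> hom0 f -> exists2 g : P -> V, hom0 g & forall x, p (g x) = f x.
Proof.
move=> hP /ghom0P hp sp /ghom0P hf; have [g /ghom0P hg e] := hP _ _ _ _ hp sp hf.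
by exists g => // x; rewrite -e.
Qed.

Lemma injP Q V W (i : V -> W) (f : V -> Q) : injective_gmod Q ->
  hom0 i -> injective i -> hom0 f -> exists2 g : W -> Q, hom0 g & forall x, g (i x) = f x.
Proof.
move=> hQ /ghom0P hi ii /ghom0P hf; have [g /ghom0P hg e] := hQ _ _ _ _ hi ii hf.
by exists g => // x; rewrite -e.
Qed.

Definition ses U X M (u : U -> X) (p : X -> M) :=
  [/\ hom0 u, hom0 p, injective u, surj p & forall x, p x = 0 <-> exists y, u y = x].

(** Vanishing of [Ext^1(M, V)] in degree 0, in the form that needs no resolution. *)
Definition ext1z M V := forall U X (u : U -> X) (p : X -> M) (f : U -> V),
  ses u p -> hom0 f -> exists2 g : X -> V, hom0 g & forall y, g (u y) = f y.

Lemma ses_quo V (N : gsubmod V) :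
  ses (@sub_val k V N : sub_gmod N -> V) (qpi N : V -> quo_gmod N).
Proof.
split; [exact: hom0_sub | exact: hom0_quo | exact: sub_val_inj | exact: quo_surj |].
move=> x; split=> [/(qpi_eq0 N) h|[y <-]]; first by exists (ssub h).
by apply/(qpi_eq0 N); exact: sub_valP.
Qed.

Lemma ses_ker X M (p : X -> M) (hp : hom0 p) : surj p ->
  ses (@sub_val k X (gker hp) : sub_gmod (gker hp) -> X) p.
Proof.
move=> sp; split; [exact: hom0_sub | exact: hp | exact: sub_val_inj | exact: sp |].
move=> x; split=> [h|[y <-]]; first by exists (ssub (S := gker hp) h).
exact: (sub_valP y).
Qed.

(** Lifting [P -> M] to [P -> X] makes [X] a quotient of [P x U'], and the extension is
    the map that [P x U' -> V] induces on this quotient. *)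
Lemma ext1z_test U P M V (u : U -> P) (p : P -> M) : projective_gmod P -> ses u p ->
  (forall f : U -> V, hom0 f -> exists2 g : P -> V, hom0 g & forall y, g (u y) = f y) ->
  ext1z M V.
Proof.
move=> hP [hu hp iu sp exp] h U' X u' p' f [hu' hp' iu' sp' exp'] hf.
have [q hq qE] := projP hP hp' sp' hp.
have [t ht tE] : exists2 t : U -> U', hom0 t & forall x, u' (t x) = q (u x).
  apply: factor_inj => //; first exact: hom0_comp.
  by move=> y; apply/exp'; rewrite qE; apply/exp; exists y.
have [g hg gE] := h _ (hom0_comp ht hf).
pose s (z : prod_gmod P U') := q z.1 + u' z.2.
have hs : hom0 s.
  apply: hom0_comb; [exact: (hom0_comp (hom0_fst _ _) hq)|].
  exact: (hom0_comp (hom0_snd _ _) hu').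
pose F (z : prod_gmod P U') := g z.1 + f z.2.
have hF : hom0 F.
  apply: hom0_comb; [exact: (hom0_comp (hom0_fst _ _) hg)|].
  exact: (hom0_comp (hom0_snd _ _) hf).
have ss : surj s.
  move=> x; have [r rE] := sp (p' x).
  have /exp' [y yE] : p' (x - q r) = 0 by rewrite (hom0B _ _ hp') qE rE subrr.
  by exists (r, y); rewrite /s /= yE addrC subrK.
have [r hr rE] : exists2 r : X -> V, hom0 r & forall z, r (s z) = F z.
  apply: (factor_surj hs ss hF) => -[x y]; rewrite /s /F /= => e.
  have : p' (q x + u' y) = 0 by rewrite e (hom0_0 hp').
  rewrite (hom0D _ _ hp') qE [X in _ + X](_ : _ = 0) ?addr0; last by apply/exp'; exists y.
  move=> /exp[z zE]; rewrite -zE gE -(hom0D _ _ hf).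
  suff -> : t z + y = 0 by rewrite (hom0_0 hf).
  by apply: iu'; rewrite (hom0D _ _ hu') tE zE e (hom0_0 hu').
exists r => // y; have := rE (0, y); rewrite /s /F /=.
by rewrite (hom0_0 hq) (hom0_0 hg) !add0r.
Qed.

Lemma enough_projectives M : exists P U (u : U -> P) (p : P -> M),
  projective_gmod P /\ ses u p.
Proof.
exists (cover M), (sub_gmod (gker (cover_map_hom M))), (@sub_val _ _ _), (@cover_map _ _ M).
split; first exact: cover_projective.
by apply: ses_ker; exact: cover_map_surj.
Qed.

Section Exact.
Context (V' V V'' : gmod A) (i : V' -> V) (q : V -> V'') (hV : ses i q).

(** The obstruction to lifting a map [M -> V''] lies in [Ext^1(M, V')]. *)
Lemma ext1z_lift M (f : M -> V'') : ext1z M V' -> hom0 f ->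
  exists2 g : M -> V, hom0 g & forall x, q (g x) = f x.
Proof.
move=> h hf; have [hi hq ii sq exq] := hV.
have [P [U [u [p [hP hs]]]]] := enough_projectives M; have [hu hp iu sp exp] := hs.
have [g hg gE] := projP hP hq sq (hom0_comp hp hf).
have [t ht tE] : exists2 t : U -> V', hom0 t & forall y, i (t y) = g (u y).
  apply: factor_inj => //; first exact: hom0_comp hu hg.
  move=> y; apply/exq; rewrite gE.
  by have /exp -> : exists z, u z = u y; [exists y | rewrite (hom0_0 hf)].
have [r hr rE] := h _ _ _ _ _ hs ht.
have hd := hom0_diff hg (hom0_comp hr hi).
have [s hs' sE] : exists2 s : M -> V, hom0 s & forall z, s (p z) = g z - i (r z).
  by apply: (factor_surj hp sp hd) => _ /exp[y <-]; rewrite rE tE subrr.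
exists s => // x; have [z <-] := sp x; rewrite sE (hom0B _ _ hq) gE.
by have /exq -> : exists y, i y = i (r z); [exists (r z) | rewrite subr0].
Qed.

(** This lemma and the next two extract from the long exact sequence what is needed at
    [Ext^1(M, V)], [Ext^1(M, V')] and [Ext^1(M, V'')]. At the last one [Ext^2(M, V')]
    enters, in the form of [Ext^1(U, V')] for a syzygy [U] of [M]. *)
Lemma ext1z_mid M : ext1z M V' -> ext1z M V'' -> ext1z M V.
Proof.
move=> h' h''; have [hi hq ii sq exq] := hV.
have [P [U [u [p [hP hs]]]]] := enough_projectives M; have [hu hp iu sp exp] := hs.
apply: (ext1z_test hP hs) => f hf.
have [g hg gE] := h'' _ _ _ _ _ hs (hom0_comp hf hq).
have [r hr rE] := projP hP hq sq hg.
have hd := hom0_diff hf (hom0_comp hu hr).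
have [t ht tE] : exists2 t : U -> V', hom0 t & forall y, i (t y) = f y - r (u y).
  apply: factor_inj => // y; apply/exq.
  by rewrite (hom0B _ _ hq) rE gE subrr.
have [s hs' sE] := h' _ _ _ _ _ hs ht.
exists (fun z => r z + i (s z)); first by apply: hom0_comb => //; exact: hom0_comp hs' hi.
by move=> y; rewrite sE tE addrC subrK.
Qed.

Lemma ext1z_sub M : ext1z M V ->
  (forall f : M -> V'', hom0 f -> forall x, f x = 0) -> ext1z M V'.
Proof.
move=> h h0 U X u p f hX hf; have [hi hq ii sq exq] := hV.
have [hu hp iu sp exp] := hX.
have [g hg gE] := h _ _ _ _ _ hX (hom0_comp hf hi).
have [r hr rE] : exists2 r : M -> V'', hom0 r & forall x, r (p x) = q (g x).
  apply: (factor_surj hp sp (hom0_comp hg hq)) => _ /exp[y <-].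
  by rewrite gE; apply/exq; exists (f y).
have [s hs sE] : exists2 s : X -> V', hom0 s & forall x, i (s x) = g x.
  by apply: factor_inj => // x; apply/exq; rewrite -rE h0.
by exists s => // y; apply: ii; rewrite sE gE.
Qed.

Lemma ext1z_quo U P M (u : U -> P) (p : P -> M) : projective_gmod P -> ses u p ->
  ext1z U V' -> ext1z M V -> ext1z M V''.
Proof.
move=> hP hX hU hM; have [hi hq ii sq exq] := hV.
apply: (ext1z_test hP hX) => f hf.
have [g hg gE] := ext1z_lift hU hf.
have [r hr rE] := hM _ _ _ _ _ hX hg.
exists (fun x => q (r x)); first exact: hom0_comp.
by move=> y; rewrite rE gE.
Qed.
End Exact.

Lemma ext1z_isoV M V W (f : V -> W) : hom0 f -> bijective f -> ext1z M V -> ext1z M W.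
Proof.
move=> hf bf h U X u p g hX hg; have [f' [hf' fK f'K]] := hom0_inverse hf bf.
have [r hr rE] := h _ _ _ _ _ hX (hom0_comp hg hf').
exists (fun x => f (r x)); first exact: hom0_comp.
by move=> y; rewrite rE f'K.
Qed.

Lemma ext1z_isoM M N V (f : M -> N) : hom0 f -> bijective f -> ext1z M V -> ext1z N V.
Proof.
move=> hf bf h U X u p g [hu hp iu sp exp] hg; have [f' [hf' fK f'K]] := hom0_inverse hf bf.
apply: (h U X u (fun x => f' (p x))) => //; split=> //; first exact: hom0_comp.
  by move=> w; have [x xE] := sp (f w); exists x; rewrite xE fK.
move=> x; rewrite -exp; split=> [e|->]; last by rewrite (hom0_0 hf').
by rewrite -[p x]f'K e (hom0_0 hf).
Qed.

(** * Ext groups from resolutions *)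

Section Res.
Context (M : gmod A) (R : proj_resolution M).

Lemma res_d_hom0 n : hom0 (@res_d _ _ _ R n).
Proof. by apply/ghom0P; exact: res_d_hom. Qed.
Lemma res_aug_hom0 : hom0 (@res_aug _ _ _ R).
Proof. by apply/ghom0P; exact: res_aug_hom. Qed.

Lemma Ext_zeroP V n : (forall x : Ext_gmod V R n.+1, x = 0) <->
  (forall f : res_obj R n.+1 -> V, hom0 f -> (forall x, f (res_d x) = 0) ->
    exists2 g : res_obj R n -> V, hom0 g & forall x, g (res_d x) = f x).
Proof.
split=> [h f /ghom0P hf fd|h x].
  have hc : cocycle V R n.+1 f by split.
  have := h (qpi _ (ssub hc)); move/(qpi_eq0 (pre_ss _ _)) => -[g /ghom0P hg e].
  by exists g => // x; have := congr1 (fun f => f x) e.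
rewrite -[x]qreprK; apply/(qpi_eq0 (pre_ss _ _)).
have [/ghom0P hf fd] := sub_valP (qrepr x).
have [g /ghom0P hg gE] := h _ hf fd.
by exists g => //; apply/funext => y; rewrite /= gE.
Qed.

(** The zeroth syzygy is [M] itself, so that [Ext^(n+1)] of [M] is always [Ext^1] of the
    [n]-th one. *)
Definition syz n : gmod A :=
  if n is m.+1 then sub_gmod (gim (res_d_hom0 m) (gfull _)) else M.

Lemma syz_incl n : exists u : syz n.+1 -> res_obj R n,
  [/\ hom0 u, injective u & forall x, (exists y, u y = x) <-> exists y, res_d y = x].
Proof.
exists (@sub_val k _ (gim (res_d_hom0 n) (gfull _))); split.
- exact: hom0_sub.
- exact: sub_val_inj.
- move=> x; split=> [[y <-]|[y yE]].
    by have [z _ <-] := sub_valP y; exists z.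
  have hx : gim (res_d_hom0 n) (gfull _) x by exists y.
  by exists (ssub hx).
Qed.

Lemma ses_syz n : exists (u : syz n.+1 -> res_obj R n) (p : res_obj R n -> syz n),
  ses u p /\ forall x, (exists y, u y = x) <-> exists y, res_d y = x.
Proof.
have [u [hu iu uE]] := syz_incl n.
case: n u hu iu uE => [|n] u hu iu uE.
  exists u, (@res_aug _ _ _ R); split=> //; split=> //.
  - exact: res_aug_hom0.
  - exact: res_aug_surj.
  - by move=> x; rewrite uE; exact: res_exact0.
have [v [hv iv vE]] := syz_incl n.
have [p hp pE] : exists2 p : res_obj R n.+1 -> syz n.+1, hom0 p & forall x, v (p x) = res_d x.
  apply: factor_inj => //; first exact: res_d_hom0.
  by move=> x; apply/vE; exists x.
exists u, p; split=> //; split=> //.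
- move=> w; have /vE[y yE] : exists y, v y = v w by exists w.
  by exists y; apply: iv; rewrite pE.
- move=> x; rewrite uE -res_exactS -pE; split=> [->|]; first exact: hom0_0.
  exact: hom0_inj0.
Qed.

Lemma ext1z_Ext V n : ext1z (syz n) V -> forall x : Ext_gmod V R n.+1, x = 0.
Proof.
move=> h; apply/Ext_zeroP => f hf fd.
have [u [p [hs uE]]] := ses_syz n; have [hu hp iu sp exp] := hs.
have [v [q [[hv hq iv sq exq] vE]]] := ses_syz n.+1.
have [d hd dE] : exists2 d : res_obj R n.+1 -> syz n.+1, hom0 d & forall x, u (d x) = res_d x.
  apply: factor_inj => //; first exact: res_d_hom0.
  by move=> x; apply/uE; exists x.
have sd : surj d.
  move=> w; have /uE[y yE] : exists y, u y = u w by exists w.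
  by exists y; apply: iu; rewrite dE.
have [t ht tE] : exists2 t : syz n.+1 -> V, hom0 t & forall x, t (d x) = f x.
  apply: (factor_surj hd sd hf) => x e.
  have /res_exactS[y <-] : res_d x = 0 by rewrite -dE e (hom0_0 hu).
  exact: fd.
have [g hg gE] := h _ _ _ _ _ hs ht.
by exists g => // x; rewrite -dE gE tE.
Qed.

Lemma Ext_ext1z V : (forall x : Ext_gmod V R 1, x = 0) -> ext1z M V.
Proof.
move=> /Ext_zeroP h; have [u [p [hs uE]]] := ses_syz 0.
have [hu hp iu sp exp] := hs.
have hP : projective_gmod (res_obj R 0) by exact: res_proj.
apply: (ext1z_test hP hs) => f hf.
have [d hd dE] : exists2 d : res_obj R 1 -> syz 1, hom0 d & forall x, u (d x) = res_d x.
  apply: factor_inj => //; first exact: res_d_hom0.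
  by move=> x; apply/uE; exists x.
have [x|g hg gE] := h _ (hom0_comp hd hf).
  have -> : d (res_d x) = 0; last exact: hom0_0.
  apply: iu; rewrite dE (hom0_0 hu).
  by apply/res_exactS; exists x.
exists g => // y; have /uE[x xE] : exists z, u z = u y by exists y.
by rewrite -xE gE; congr f; apply: iu; rewrite dE.
Qed.

(** With [ext1z_Ext] this turns a statement on [Ext^1] for a suitable class of modules
    into one on all higher [Ext]. *)
Lemma syz_class (C : gmod A -> Prop) :
  (forall U P N (u : U -> P) (p : P -> N), projective_gmod P -> ses u p -> C N -> C U) ->
  C M -> forall n, C (syz n).
Proof.
move=> h hM; elim=> // n hn; have [u [p [hs _]]] := ses_syz n.
by apply: h hs hn; exact: res_proj.
Qed.
End Res.

Section Existence.
Context (M : gmod A).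

Fixpoint std_syz n : gmod A :=
  if n is m.+1 then sub_gmod (gker (cover_map_hom (std_syz m))) else M.

Definition std_d n (x : cover (std_syz n.+1)) : cover (std_syz n) :=
  sub_val (cover_map x : sub_gmod (gker (cover_map_hom (std_syz n)))).

Lemma std_d_hom n : ghom _ _ 0 (@std_d n).
Proof.
by apply/ghom0P; exact: hom0_comp (cover_map_hom (std_syz n.+1)) (hom0_sub _).
Qed.

Lemma std_exact0 n (x : cover (std_syz n)) : cover_map x = 0 <-> exists y, std_d y = x.
Proof.
split=> [h|[y <-]]; last exact: (sub_valP (cover_map y)).
have [y yE] := cover_map_surj (ssub (S := gker (cover_map_hom (std_syz n))) h : std_syz n.+1).
by exists y; rewrite /std_d yE.
Qed.

Lemma std_exactS n (x : cover (std_syz n.+1)) : std_d x = 0 <-> exists y, std_d y = x.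
Proof.
rewrite -std_exact0; split=> [h|h]; first exact: sub_val_inj.
by rewrite /std_d h.
Qed.

Lemma std_aug_hom : ghom _ _ 0 (@cover_map _ _ M).
Proof. by apply/ghom0P; exact: cover_map_hom. Qed.

Definition std_resolution : proj_resolution M :=
  @ProjResolution _ _ M (fun n => cover (std_syz n)) std_d (@cover_map _ _ M)
   (fun n => cover_projective (std_syz n)) std_d_hom std_aug_hom (@cover_map_surj _ _ M)
   (@std_exact0 0) std_exactS.
End Existence.

Lemma ExtA_zero1 M V : ExtA_zero 1 M V -> forall d, ext1z (shift d M) V.
Proof. by move=> h d; apply: (@Ext_ext1z _ (std_resolution _)); exact: h. Qed.

Lemma ExtA_zeroI M V (C : gmod A -> Prop) :
  (forall U P N (u : U -> P) (p : P -> N), projective_gmod P -> ses u p -> C N -> C U) ->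
  (forall N, C N -> ext1z N V) -> (forall d, C (shift d M)) ->
  forall n, (1 <= n)%N -> ExtA_zero n M V.
Proof.
move=> h1 h2 h3 [//|n] _ d R; apply: ext1z_Ext; apply: h2.
by apply: syz_class => //; exact: h1.
Qed.

End Ext.

(** * Corner algebras *)

Section Corner.
Context (k : fieldType) (C : lualg k) (e : idem C).

Lemma eCe_in (c : C) : eCe e (id_elt e ** c ** id_elt e).
Proof. by split; rewrite /= /mkset; [rewrite !la_mulA idemK | rewrite -la_mulA idemK]. Qed.

(** Elements of the corner are handled through this retraction: every one of them is
    [kapq c] for some [c], and linear maps on it are defined on [C]. *)
Definition kapq (c : C) : corner e := ssub (eCe_in c).

Lemma kapq_val c : sub_val (kapq c) = id_elt e ** c ** id_elt e. Proof. by []. Qed.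
Lemma corner_val (c d : corner e) : sub_val (c ** d) = sub_val c ** sub_val d.
Proof. by []. Qed.
Lemma corner_el (c : corner e) : id_elt e ** sub_val c = sub_val c.
Proof. by case: (sub_valP c). Qed.
Lemma corner_er (c : corner e) : sub_val c ** id_elt e = sub_val c.
Proof. by case: (sub_valP c). Qed.
Lemma eC_el (x : sub_lmod (eC e)) : id_elt e ** sub_val x = sub_val x.
Proof. exact: (sub_valP x). Qed.
Lemma Ce_er (x : sub_lmod (Ce e)) : sub_val x ** id_elt e = sub_val x.
Proof. exact: (sub_valP x). Qed.

Lemma kapq_lin : linear kapq.
Proof.
by move=> c a b; apply: sub_val_inj; rewrite sub_valL !kapq_val la_mulLr la_mulLl.
Qed.

Lemma kapq_id (c : corner e) : kapq (sub_val c) = c.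
Proof. by apply: sub_val_inj; rewrite kapq_val corner_el corner_er. Qed.

Lemma kapqM c d : kapq (c ** id_elt e ** d) = kapq c ** kapq d.
Proof.
apply: sub_val_inj; rewrite corner_val !kapq_val !la_mulA.
by congr (_ ** _ ** _); rewrite -[RHS]la_mulA idemK.
Qed.

Lemma kapq_el c : kapq (id_elt e ** c) = kapq c.
Proof. by apply: sub_val_inj; rewrite !kapq_val la_mulA idemK. Qed.
Lemma kapq_er c : kapq (c ** id_elt e) = kapq c.
Proof. by apply: sub_val_inj; rewrite !kapq_val -!la_mulA idemK. Qed.
Lemma kapq_e : kapq (id_elt e) = la_one (corner e) tt.
Proof. by apply: sub_val_inj; rewrite kapq_val !idemK. Qed.

Lemma kapq_deg n a : la_deg C n a -> la_deg (corner e) n (kapq a).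
Proof.
move=> ha; rewrite -[n]add0r -[0 + n]addr0.
have h0 : la_deg C 0 (id_elt e) by exact: idem_deg.
exact: (la_degM (la_degM h0 ha) h0).
Qed.

Definition eC_one : sub_lmod (eC e) := @ssub _ _ (eC e) (id_elt e) (idemK e).
Definition Ce_one : sub_lmod (Ce e) := @ssub _ _ (Ce e) (id_elt e) (idemK e).

Lemma eC_ract_one (a : C) : eC_ract (eC_ract eC_one a) (id_elt e) = eC_lact (kapq a) eC_one.
Proof.
by apply: sub_val_inj; change (id_elt e ** a ** id_elt e = (id_elt e ** a ** id_elt e) ** id_elt e);
  rewrite -[RHS]la_mulA idemK.
Qed.

Lemma eC_ract_oneE (x : sub_lmod (eC e)) : eC_ract eC_one (sub_val x) = x.
Proof. by apply: sub_val_inj; exact: eC_el. Qed.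

Lemma Ce_lact_one (x : sub_lmod (Ce e)) : Ce_lact (sub_val x) Ce_one = x.
Proof. by apply: sub_val_inj; exact: Ce_er. Qed.

Lemma Ce_lact_e : Ce_lact (id_elt e) Ce_one = Ce_one.
Proof. by apply: sub_val_inj; exact: idemK. Qed.

Lemma Ce_ract_one (a : C) : Ce_ract Ce_one (kapq a) = Ce_lact (id_elt e) (Ce_lact a Ce_one).
Proof.
apply: sub_val_inj; change (id_elt e ** (id_elt e ** a ** id_elt e) = id_elt e ** (a ** id_elt e)).
by rewrite !la_mulA idemK.
Qed.

Lemma kapq_Ce_lact (a : C) : kapq (sub_val (Ce_lact a Ce_one)) = kapq a.
Proof. exact: kapq_er. Qed.

Lemma kapq_ract (x : sub_lmod (Ce e)) (a : corner e) :
  kapq (sub_val (Ce_ract x a)) = kapq (sub_val x) ** a.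
Proof.
apply: sub_val_inj; rewrite corner_val !kapq_val.
change (id_elt e ** (sub_val x ** sub_val a) ** id_elt e = id_elt e ** sub_val x ** id_elt e ** sub_val a).
by rewrite -!la_mulA corner_el corner_er.
Qed.
End Corner.

Section Recollement.
Context (k : fieldType) (A : lualg k) (J : gideal A) (e0 : A).
Hypotheses (e0K : e0 ** e0 = e0) (e0d : la_deg A 0 e0).
Context (e : idem (quo_alg J)) (eE : id_elt e = quo_proj J e0).
Local Notation C := (corner e).
Local Notation pi := (quo_proj J).
Implicit Types (M X Y V : gmod A) (N W Z : gmod C) (a b : A).

Lemma quo_projL c a b : pi (c *: a + b) = c *: pi a + pi b.
Proof. exact: qpiL. Qed.
Lemma quo_projK (x : quo_alg J) : pi (qrepr x) = x. Proof. exact: qreprK. Qed.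
Lemma quo_proj_eq a b : pi a = pi b <-> J (a - b). Proof. exact: qpi_eq. Qed.
Lemma quo_proj_eq0 a : pi a = 0 <-> J a. Proof. exact: (qpi_eq0 J). Qed.

Definition kap a : C := kapq e (pi a).

Lemma kap_lin : linear kap.
Proof. by move=> c a b; rewrite /kap quo_projL kapq_lin. Qed.

Lemma kap_surj (c : C) : kap (qrepr (sub_val c)) = c.
Proof. by rewrite /kap quo_projK kapq_id. Qed.

Lemma kap_J a : J a -> kap a = 0.
Proof. by move=> /quo_proj_eq0 h; rewrite /kap h (lin0 (@kapq_lin _ _ e)). Qed.

Lemma kap_deg n a : la_deg A n a -> la_deg C n (kap a).
Proof. by move=> ha; apply: kapq_deg; exists a. Qed.

Lemma kap_e0 : kap e0 = la_one C tt.
Proof. by rewrite /kap -eE kapq_e. Qed.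

Lemma kapM a b : kap (a ** e0 ** b) = kap a ** kap b.
Proof. by rewrite /kap !quo_projM -eE kapqM. Qed.

Lemma kap_el a : kap (e0 ** a) = kap a.
Proof. by rewrite /kap quo_projM -eE kapq_el. Qed.
Lemma kap_er a : kap (a ** e0) = kap a.
Proof. by rewrite /kap quo_projM -eE kapq_er. Qed.

(** * Modules killed by an ideal, cut down by an idempotent *)

Definition killed V := forall a (v : V), J a -> a |> v = 0.

Lemma ann0 V : forall a, J a -> a |> (0 : V) = 0.
Proof. by move=> a _; exact: lin0 (gm_actLr a). Qed.
Lemma annL V (c : k) (u v : V) : (forall a, J a -> a |> u = 0) ->
  (forall a, J a -> a |> v = 0) -> forall a, J a -> a |> (c *: u + v) = 0.
Proof. by move=> hu hv a ha; rewrite gm_actLr hu // hv // scaler0 addr0. Qed.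
Definition ann_ss V : subspace V :=
  @Subspace k V [set v | forall a, J a -> a |> v = 0] (@ann0 V) (@annL V).

Lemma ann_act V a v : ann_ss V v -> ann_ss V (a |> v).
Proof. by move=> h b hb; rewrite gm_actA; apply: h; exact: gi_mulr. Qed.
Lemma ann_pr V d v : ann_ss V v -> ann_ss V (gr_pr (gm_graded V) d v).
Proof.
move=> h a ha; have := @gi_hom _ _ J a ha.
change (span (J `&` homogeneous (la_deg A)) a ->
  zero_ss V (a |> gr_pr (gm_graded V) d v)).
apply: (@span_map _ _ _ _ _ (zero_ss V) (gm_actLl (gr_pr (gm_graded V) d v))).
move=> b [hb [n hn]].
have hd p w : gm_deg V p w -> gm_deg V (p + n) (b |> w).
  by move=> hw; rewrite addrC; exact: gm_degM.
have := gr_pr_map (gm_graded V) (gm_graded V) (gm_actLr b) hd d v.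
by rewrite /= /set1 /mkset h // (lin0 (gr_pr_lin _ _)) => <-.
Qed.
(** The largest submodule killed by the ideal. *)
Definition ann V : gsubmod V := mk_gsub (@ann_act V) (@ann_pr V).

Lemma ann_eq V (v : V) a b : ann V v -> pi a = pi b -> a |> v = b |> v.
Proof.
move=> hv /quo_proj_eq h; apply/eqP; rewrite -subr_eq0 -(linB _ _ (gm_actLl v)).
exact/eqP/hv.
Qed.

Lemma top_ss0 V : ann V 0 /\ e0 |> (0 : V) = 0.
Proof. by split; [exact: ss0 | exact: lin0 (gm_actLr _)]. Qed.
Lemma top_ssL V (c : k) (u v : V) : ann V u /\ e0 |> u = u -> ann V v /\ e0 |> v = v ->
  ann V (c *: u + v) /\ e0 |> (c *: u + v) = c *: u + v.
Proof. by move=> [h1 h2] [h3 h4]; split; [exact: ssL | rewrite gm_actLr h2 h4]. Qed.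
Definition top_ss V : subspace V :=
  @Subspace k V [set v | ann V v /\ e0 |> v = v] (@top_ss0 V) (@top_ssL V).

Section Top.
Variable V : gmod A.
Local Notation T := (sub_lmod (top_ss V)).

Lemma e0_pr n (v : V) :
  gr_pr (gm_graded V) n (e0 |> v) = e0 |> gr_pr (gm_graded V) n v.
Proof.
have hd p w : gm_deg V p w -> gm_deg V (p + 0) (e0 |> w).
  by move=> hw; rewrite addrC; exact: gm_degM.
by have := gr_pr_map (gm_graded V) (gm_graded V) (gm_actLr e0) hd n v; rewrite addr0.
Qed.

Lemma top_hom : top_ss V `<=` span (top_ss V `&` homogeneous (gm_deg V)).
Proof.
apply: (@gr_stable_hom _ _ _ (gm_graded V) (top_ss V)) => d v [h1 h2].
by split; [exact: gs_pr | rewrite -e0_pr h2].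
Qed.

Lemma top_act_in (c : C) (v : T) : top_ss V (qrepr (sub_val c) |> sub_val v).
Proof.
have [h1 h2] := sub_valP v; split; first exact: gs_act.
rewrite gm_actA; apply: (ann_eq h1); rewrite quo_projM quo_projK -eE.
exact: corner_el.
Qed.
Definition top_act (c : C) (v : T) : T := ssub (top_act_in c v).

Lemma top_actE a c (v : T) : pi a = sub_val c -> sub_val (top_act c v) = a |> sub_val v.
Proof.
by move=> h; have [h1 _] := sub_valP v; apply: (ann_eq h1); rewrite quo_projK.
Qed.

Lemma top_actLl v : linear (top_act^~ v).
Proof.
move=> c x y; apply: sub_val_inj.
rewrite (@top_actE (c *: qrepr (sub_val x) + qrepr (sub_val y))) ?gm_actLl //.
by rewrite quo_projL !quo_projK.
Qed.
Lemma top_actLr c : linear (top_act c).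
Proof. by move=> b x y; apply: sub_val_inj; exact: gm_actLr. Qed.
Lemma top_actA c d v : top_act c (top_act d v) = top_act (c ** d) v.
Proof.
apply: sub_val_inj; rewrite (@top_actE (qrepr (sub_val c) ** qrepr (sub_val d)) (c ** d)).
  by rewrite -gm_actA.
by rewrite quo_projM !quo_projK corner_val.
Qed.
Lemma top_unital v : locally_unital (fun i => top_act (la_one C i)) v.
Proof.
exists [:: tt]; split=> //; rewrite big_seq1; apply: sub_val_inj.
by rewrite (@top_actE e0) -?eE //; case: (sub_valP v).
Qed.
Lemma top_degM m n c v : la_deg C m c -> sub_gr (gm_deg V) (top_ss V) n v ->
  sub_gr (gm_deg V) (top_ss V) (m + n) (top_act c v).
Proof.
move=> [a ha aE] hv; change (gm_deg V (m + n) (sub_val (top_act c v))).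
by rewrite (top_actE _ aE); exact: gm_degM.
Qed.

(** [e V'], for [V'] the largest submodule of [V] killed by the ideal; right adjoint
    to [j_!]. *)
Definition top : gmod C := GMod top_actLl top_actLr top_actA top_unital
  (sub_is_grading (gm_graded V) top_hom) top_degM.

Lemma top_kap a (v : top) : sub_val (kap a |> v) = e0 |> a |> sub_val v.
Proof.
rewrite (@top_actE (e0 ** a ** e0) (kap a)); last by rewrite !quo_projM -eE.
by rewrite -!gm_actA; have [_ ->] := sub_valP v.
Qed.
End Top.

(** * Maps into coinduced modules *)

(** Such a map [phi : M -> W] is the same as a homomorphism from [M] to the module
    coinduced from [W], by evaluation at [e]. *)
Definition mumap M W (phi : M -> W) :=
  [/\ linear phi, forall a m, phi (a |> e0 |> m) = kap a |> phi m,
      forall a m, J a -> phi (a |> m) = 0 &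
      forall n m, gm_deg M n m -> gm_deg W n (phi m)].

Lemma corner_act1 W (w : W) : la_one C tt |> w = w.
Proof.
have [s [us h]] := gm_unital w; move: us h; case: s => [|[] [|[] s]] //= _.
  by rewrite big_nil => ->; rewrite (lin0 (gm_actLr _)).
by rewrite big_seq1.
Qed.

Section MuMap.
Context (M : gmod A) (W : gmod C) (phi : M -> W) (hphi : mumap phi).

Lemma mumap_lin : linear phi. Proof. by case: hphi. Qed.
Lemma mumap_0 : phi 0 = 0. Proof. exact: lin0 mumap_lin. Qed.
Lemma mumapB u v : phi (u - v) = phi u - phi v. Proof. exact: linB mumap_lin. Qed.
Lemma mumap_kap a m : phi (a |> e0 |> m) = kap a |> phi m. Proof. by case: hphi. Qed.
Lemma mumap_e0 m : phi (e0 |> m) = phi m.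
Proof. by rewrite -{1}e0K -gm_actA mumap_kap kap_e0 corner_act1. Qed.
Lemma mumap_eq a b m : pi a = pi b -> phi (a |> m) = phi (b |> m).
Proof.
move=> /quo_proj_eq h; apply/eqP; rewrite -subr_eq0 -mumapB -(linB _ _ (gm_actLl m)).
by case: hphi => _ _ h0 _; rewrite h0.
Qed.
Lemma mumap_pr n m : phi (gr_pr (gm_graded M) n m) = gr_pr (gm_graded W) n (phi m).
Proof.
have := @gr_pr_map _ _ _ _ _ (gm_graded M) (gm_graded W) phi 0 mumap_lin.
move=> /(_ _ n m); rewrite addr0; apply.
by case: hphi => _ _ _ h d v hv; rewrite addr0; exact: h.
Qed.
End MuMap.

Lemma mumap_comp M W Z (phi : M -> W) (g : W -> Z) :
  mumap phi -> hom0 g -> mumap (fun m => g (phi m)).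
Proof.
move=> [p1 p2 p3 p4] [g1 g2 g3]; split=> [c u v|a m|a m ha|n m hm].
- by rewrite p1 g1.
- by rewrite p2 g2.
- by rewrite p3 // (lin0 g1).
- by apply: g3; exact: p4.
Qed.

Lemma comp_mumap X M W (f : X -> M) (phi : M -> W) :
  hom0 f -> mumap phi -> mumap (fun x => phi (f x)).
Proof.
move=> [g1 g2 g3] [p1 p2 p3 p4]; split=> [c u v|a m|a m ha|n m hm].
- by rewrite g1 p1.
- by rewrite !g2 p2.
- by rewrite g2 p3.
- by apply: p4; exact: g3.
Qed.

Lemma mumap_diff M W (phi psi : M -> W) : mumap phi -> mumap psi ->
  mumap (fun m => phi m - psi m).
Proof.
move=> [f1 f2 f3 f4] [g1 g2 g3 g4]; split=> [c x y|a x|a x ha|n x hx].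
- by rewrite f1 g1 scalerBr opprD addrACA.
- by rewrite f2 g2 (linB _ _ (gm_actLr _)).
- by rewrite f3 // g3 // subrr.
- by apply: ssB; [exact: f4 | exact: g4].
Qed.

Lemma mumap_factor_surj X W Z (q : X -> W) (f : X -> Z) :
  mumap q -> (forall w, exists v, q v = w) -> mumap f -> (forall v, q v = 0 -> f v = 0) ->
  exists2 g : W -> Z, hom0 g & forall v, g (q v) = f v.
Proof.
move=> hq sq hf h.
pose c w := projT1 (cid (sq w)); have cE w : q (c w) = w by rewrite /c; case: cid.
have gE v : f (c (q v)) = f v.
  apply/eqP; rewrite -subr_eq0 -(mumapB hf); apply/eqP/h.
  by rewrite (mumapB hq) cE subrr.
exists (fun w => f (c w)) => //; split=> [a x y|a x|n x hx].
- by rewrite -{1}[x]cE -{1}[y]cE -(mumap_lin hq) gE (mumap_lin hf).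
- by rewrite -[a]kap_surj -{1}[x]cE -(mumap_kap hq) gE (mumap_kap hf).
- have eq1 : q (gr_pr (gm_graded X) n (c x)) = x by rewrite (mumap_pr hq) cE gr_pr_id.
  by rewrite -eq1 gE (mumap_pr hf); exact: gr_prP.
Qed.

Lemma mumap_factor_inj X W Z (u : W -> Z) (f : X -> Z) :
  hom0 u -> injective u -> mumap f -> (forall v, exists w, u w = f v) ->
  exists2 g : X -> W, mumap g & forall v, u (g v) = f v.
Proof.
move=> hu iu hf h.
pose c v := projT1 (cid (h v)); have cE v : u (c v) = f v by rewrite /c; case: cid.
exists c => //; split=> [a x y|a x|a x ha|n x hx].
- by apply: iu; rewrite (hom0_lin hu) !cE (mumap_lin hf).
- by apply: iu; rewrite (hom0_act hu) !cE (mumap_kap hf).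
- by apply: iu; rewrite cE (hom0_0 hu); case: hf => _ _ h0 _; exact: h0.
- have <- : gr_pr (gm_graded W) n (c x) = c x; last exact: gr_prP.
  by apply: iu; rewrite (hom0_pr hu) cE -(mumap_pr hf) gr_pr_id.
Qed.

Section Star.
Variable W : gmod C.
Local Notation S := (inflate (jstar W)).
Local Notation E := (sub_lmod (eC e)).

Definition evs (g : S) : W := sub_val g (eC_one e).

Lemma star_killed : killed S.
Proof.
move=> a g /quo_proj_eq0 h; change (co_act (pi a) g = 0).
by rewrite h (lin0 (co_actLl g)).
Qed.

Lemma evs_act a (g : S) (x : E) : pi a = sub_val x -> evs (a |> g) = sub_val g x.
Proof.
by move=> h; rewrite /evs -[in RHS](eC_ract_oneE x) -h.
Qed.

Lemma star_eq0 (g : S) : (forall a, evs (a |> g) = 0) -> g = 0.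
Proof.
move=> h; apply: sub_val_inj; apply/funext => x.
by rewrite -(@evs_act (qrepr (sub_val x))) ?h // quo_projK.
Qed.

Lemma evs_lin : linear evs. Proof. by []. Qed.

Lemma evs_mumap : mumap evs.
Proof.
split; first exact: evs_lin.
- move=> a g; transitivity (sub_val g (eC_lact (kap a) (eC_one e))).
    by rewrite -eC_ract_one eE.
  pose hS := fun f : E -> W => f (eC_lact (kap a) (eC_one e)) - kap a |> f (eC_one e).
  have lS : linear hS.
    apply: lin_eq_ss => c f f' //=.
    by change (kap a |> (c *: f (eC_one e) + f' (eC_one e)) =
      c *: (kap a |> f (eC_one e)) + kap a |> f' (eC_one e)); rewrite gm_actLr.
  apply/eqP; rewrite -subr_eq0; apply/eqP.
  have := sub_valP g; apply: (@span_map _ _ _ hS _ (zero_ss W)) => // f [i [d [_ h _ _]]].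
  by rewrite /hS /= /set1 /mkset h subrr.
- by move=> a g ha; rewrite star_killed.
- move=> n g hg; rewrite -[n]add0r; apply: (co_homd_deg hg).
  exact: idem_deg.
Qed.

Section Up.
Context (M : gmod A) (phi : M -> W) (hphi : mumap phi).
Let fm (m : M) : E -> W := fun x => phi (qrepr (sub_val x) |> m).

Let fm_lin : linear fm.
Proof.
by move=> c u v; apply/funext => x; rewrite /fm gm_actLr (mumap_lin hphi).
Qed.

Let fm_hom i n m : gm_deg M n m ->
  @co_hom _ (quo_alg J) e W i n (fm (la_one A i |> m)).
Proof.
move=> hm; split.
- move=> c x y; rewrite /fm -(mumap_lin hphi) -gm_actLl; apply: (mumap_eq hphi).
  by rewrite quo_projL !quo_projK.
- move=> c x; rewrite /fm -[in RHS](kap_surj c) -(mumap_kap hphi) !gm_actA.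
  rewrite -[in RHS](mumap_e0 hphi) !gm_actA; apply: (mumap_eq hphi).
  rewrite !quo_projM !quo_projK -eE.
  change (sub_val c ** sub_val x ** pi (la_one A i) =
    id_elt e ** (sub_val c ** id_elt e ** sub_val x ** pi (la_one A i))).
  by rewrite corner_er !la_mulA corner_el.
- move=> p x [a ha aE]; rewrite /fm (@mumap_eq _ _ _ hphi _ a) ?quo_projK //.
  case: hphi => _ _ _; apply; apply: gm_degM => //.
  by rewrite -[n]add0r; apply: gm_degM => //; exact: la_deg1.
- move=> j x ne; rewrite /fm (@mumap_eq _ _ _ hphi _ (qrepr (sub_val x) ** la_one A j)).
    by rewrite -gm_actA act_orth (negbTE ne) (lin0 (gm_actLr _)) (mumap_0 hphi).
  by rewrite quo_projM !quo_projK.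
Qed.

Let fm_deg n m : gm_deg M n m -> co_homd W n (fm m).
Proof.
move=> hm; have [s [us ->]] := gm_unital m; rewrite (lin_sum _ _ _ fm_lin).
by apply: ss_sum => i _; apply: span_sub; exists i; exact: fm_hom.
Qed.

Let fm_in m : co_ss W (fm m).
Proof.
apply: (gr_span_map (gm_graded M) fm_lin) => n {}m hm.
exact: co_homd_sub (fm_deg hm).
Qed.

(** The map is [m |-> (x |-> phi (x m))]; its values lie in the direct sum over [i] because
    [m] is a finite sum of the [1_i m]. *)
Lemma star_up : exists2 f : M -> S, hom0 f & forall m, evs (f m) = phi m.
Proof.
exists (fun m => ssub (fm_in m)); last first.
  move=> m; rewrite /evs /= /fm (@mumap_eq _ _ _ hphi _ e0) ?(mumap_e0 hphi) //.
  by rewrite quo_projK.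
split=> [c u v|a m|n m hm].
- by apply: sub_val_inj; exact: fm_lin.
- apply: sub_val_inj; apply/funext => x; rewrite /= /co_pre /fm gm_actA.
  by apply: (mumap_eq hphi); rewrite quo_projM !quo_projK.
- exact: fm_deg.
Qed.
End Up.
End Star.

(** * The left adjoint of coinduction *)

Lemma imod_gen_hom X : [set x | exists a y,
    [/\ J a, homogeneous (la_deg A) a, homogeneous (gm_deg X) y & x = a |> y]] `<=`
  homogeneous (gm_deg X).
Proof.
by move=> _ [a [y [_ [m hm] [n hn] ->]]]; exists (m + n); exact: gm_degM.
Qed.

(** This is [J X]; the homogeneous generators make it graded. *)
Definition imod X : gsubmod X := ggen (@imod_gen_hom X).

Lemma imodI X a x : J a -> imod X (a |> x).
Proof.
move=> /(@gi_hom _ _ J); apply: (span_map (gm_actLl x)) => b [hb [m hm]].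
apply: (gr_span_map (gm_graded X) (gm_actLr b)) => n y hy.
by apply: ggen_sub; exists b, y; split=> //; [exists m | exists n].
Qed.

Lemma imod_min X (S : subspace X) : (forall a x, J a -> S (a |> x)) ->
  forall x, imod X x -> S x.
Proof.
move=> h; apply: span_min => _ [b [_ [[a [y [ha _ _ ->]]] ->]]].
by rewrite gm_actA; apply: h; exact: gi_mull.
Qed.

Lemma imod_lift X Y (f : X -> Y) : hom0 f -> surj f ->
  forall y, imod Y y -> exists2 x, imod X x & f x = y.
Proof.
move=> hf sf; apply: (imod_min (S := im_ss (hom0_lin hf) (imod X))) => a y ha.
by have [x <-] := sf y; exists (a |> x); [exact: imodI | rewrite (hom0_act hf)].
Qed.

(** This is [e (X / J X)]; by [gam_factor] it represents the functor [mumap X] and is thus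
    the left adjoint of coinduction. *)
Definition univ X : gmod C := top (quo_gmod (imod X)).

Lemma quo_killed X : killed (quo_gmod (imod X)).
Proof.
move=> a x ha; have [y <-] := quo_surj x.
by rewrite -(hom0_act (hom0_quo (imod X))); apply/(qpi_eq0 (imod X)); exact: imodI.
Qed.

Lemma tau_in V (hV : killed V) (v : V) : top_ss V (e0 |> v).
Proof. by split; [move=> a ha; exact: hV | rewrite gm_actA e0K]. Qed.
Definition tau V (hV : killed V) (v : V) : top V := ssub (tau_in hV v).

Lemma tau_mumap V (hV : killed V) : mumap (tau hV).
Proof.
split=> [c u v|a m|a m ha|n m hm].
- by apply: sub_val_inj; exact: gm_actLr.
- by apply: sub_val_inj; rewrite top_kap.
- by apply: sub_val_inj; rewrite /= (hV a) // (lin0 (gm_actLr _)).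
- by rewrite -[n]add0r; exact: gm_degM.
Qed.

Lemma tau_id V (hV : killed V) (v : top V) : tau hV (sub_val v) = v.
Proof. by apply: sub_val_inj; case: (sub_valP v). Qed.

Definition gam X (x : X) : univ X := tau (@quo_killed X) (qpi (imod X) x).

Lemma gam_mumap X : mumap (@gam X).
Proof. exact: comp_mumap (hom0_quo _) (tau_mumap _). Qed.

Lemma gam_surj X (z : univ X) : exists x, gam x = z.
Proof.
by have [x h] := quo_surj (sub_val z); exists x; rewrite /gam h tau_id.
Qed.

Lemma gam_val X (x : X) : sub_val (gam x) = qpi (imod X) (e0 |> x).
Proof. exact/esym/(hom0_act (hom0_quo (imod X))). Qed.

Lemma gam_eq0 X (x : X) : gam x = 0 <-> imod X (e0 |> x).
Proof.
split=> [h|h].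
  by apply/(qpi_eq0 (imod X)); rewrite -gam_val h.
by apply: sub_val_inj; rewrite gam_val; exact/(qpi_eq0 (imod X)).
Qed.

Lemma mumap_imod X W (phi : X -> W) : mumap phi -> forall x, imod X x -> phi x = 0.
Proof.
move=> hp; apply: (imod_min (S := pre_ss (mumap_lin hp) (zero_ss W))) => a x ha.
by have [_ _ h _] := hp; exact: h.
Qed.

Lemma gam_factor X W (phi : X -> W) : mumap phi ->
  exists2 g : univ X -> W, hom0 g & forall x, g (gam x) = phi x.
Proof.
move=> hp; apply: (mumap_factor_surj (gam_mumap X)) => //; first exact: gam_surj.
by move=> x /gam_eq0 h; rewrite -(mumap_e0 hp) (mumap_imod hp h).
Qed.

(** * Induced modules *)

Section Shriek.
Variable N : gmod C.
Local Notation I := (inflate (jshriek N)).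

Definition ind_unit (n : N) : I := ten (Ce_one e) n.

Lemma shriek_killed : killed I.
Proof.
move=> a t /quo_proj_eq0 h; change (ten_act (pi a) t = 0).
by rewrite h (lin0 (ten_actLl t)).
Qed.

Lemma ind_unit_lin : linear ind_unit. Proof. exact: tenLr. Qed.

Lemma ind_unit_act a n : ind_unit (kap a |> n) = e0 |> a |> ind_unit n.
Proof.
change (ten (Ce_one e) (kap a |> n) = ten_act (pi e0) (ten_act (pi a) (ten (Ce_one e) n))).
by rewrite !ten_actE -tenA -eE -Ce_ract_one.
Qed.

Lemma ind_unit_e0 n : e0 |> ind_unit n = ind_unit n.
Proof.
by change (ten_act (pi e0) (ten (Ce_one e) n) = ten (Ce_one e) n);
  rewrite ten_actE -eE Ce_lact_e.
Qed.

Lemma ind_unit_deg d n : gm_deg N d n -> gm_deg I d (ind_unit n).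
Proof.
move=> h; apply: span_sub; exists 0, d, (Ce_one e), n; split=> //; first by rewrite add0r.
exact: idem_deg.
Qed.

Lemma shriek_ten (x : sub_lmod (Ce e)) n : (ten x n : I) = qrepr (sub_val x) |> ind_unit n.
Proof.
change (ten x n = ten_act (pi (qrepr (sub_val x))) (ten (Ce_one e) n)).
by rewrite ten_actE quo_projK Ce_lact_one.
Qed.

Lemma shriek_ind (S : subspace I) : (forall a n, S (a |> ind_unit n)) -> forall t, S t.
Proof. by move=> h; apply: ten_ind => x n; rewrite shriek_ten. Qed.

Lemma ind_unit_top_in n : top_ss I (ind_unit n).
Proof. by split; [move=> a ha; exact: shriek_killed | exact: ind_unit_e0]. Qed.
Definition ind_unitt n : top I := ssub (ind_unit_top_in n).

Lemma ind_unitt_hom : hom0 ind_unitt.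
Proof.
split=> [c u v|c n|d n h].
- by apply: sub_val_inj; exact: ind_unit_lin.
- by apply: sub_val_inj; rewrite -[c]kap_surj top_kap -ind_unit_act.
- exact: ind_unit_deg.
Qed.

(* [e A e (x) N] is [N], by [e a e (x) n |-> (e a e) n] *)
Let rho0 (x : sub_lmod (Ce e)) (n : N) : N := kapq e (sub_val x) |> n.

Let rho0_bal : balanced rho0.
Proof.
split=> [n c x y|x|x a n]; rewrite /rho0.
- by rewrite sub_valL kapq_lin gm_actLl.
- exact: gm_actLr.
- by rewrite gm_actA kapq_ract.
Qed.

Definition ind_counit : I -> N := tlift rho0.

Lemma ind_counit_lin : linear ind_counit. Proof. exact: tlift_lin rho0_bal. Qed.
Lemma ind_counit_ten x n : ind_counit (ten x n) = kapq e (sub_val x) |> n.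
Proof. exact: tlift_ten rho0_bal _ _. Qed.

Lemma ind_counit_act a n : ind_counit (a |> ind_unit n) = kap a |> n.
Proof.
have -> : a |> ind_unit n = ten (Ce_lact (pi a) (Ce_one e)) n by exact: ten_actE.
by rewrite ind_counit_ten kapq_Ce_lact.
Qed.

Lemma ind_counitK n : ind_counit (ind_unit n) = n.
Proof. by rewrite -[ind_unit n]ind_unit_e0 ind_counit_act kap_e0 corner_act1. Qed.

Lemma ind_unitK t : ind_unit (ind_counit t) = e0 |> t.
Proof.
have l1 : linear (fun t : I => ind_unit (ind_counit t)).
  by move=> c u v; rewrite ind_counit_lin ind_unit_lin.
apply/eqP; rewrite -subr_eq0; apply/eqP.
apply: (@shriek_ind (pre_ss (lin_eq_ss l1 (gm_actLr e0)) (zero_ss I))) => a n.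
change (ind_unit (ind_counit (a |> ind_unit n)) - e0 |> a |> ind_unit n = 0).
by rewrite ind_counit_act ind_unit_act subrr.
Qed.

Lemma ind_counit_mumap : mumap ind_counit.
Proof.
split; first exact: ind_counit_lin.
- move=> a t.
  have l1 : linear (fun t : I => ind_counit (a |> e0 |> t)).
    by move=> c u v; rewrite !gm_actLr ind_counit_lin.
  have l2 : linear (fun t : I => kap a |> ind_counit t).
    by move=> c u v; rewrite ind_counit_lin gm_actLr.
  apply/eqP; rewrite -subr_eq0; apply/eqP.
  apply: (@shriek_ind (pre_ss (lin_eq_ss l1 l2) (zero_ss N))) => b n.
  change (ind_counit (a |> e0 |> b |> ind_unit n) - kap a |> ind_counit (b |> ind_unit n) = 0).
  by rewrite !gm_actA !ind_counit_act gm_actA -kapM subrr.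
- by move=> a t ha; rewrite shriek_killed // (lin0 ind_counit_lin).
- move=> d t; apply: (span_map ind_counit_lin) => _ [p [q [x [n [-> [a ha aE] hn ->]]]]].
  rewrite ind_counit_ten -aE; apply: gm_degM => //; exact: kap_deg.
Qed.

(** The adjunction: [e a (x) n] must go to [a psi(n)]. *)
Lemma shriek_up V (psi : N -> top V) : hom0 psi ->
  exists2 f : I -> V, hom0 f & forall n, f (ind_unit n) = sub_val (psi n).
Proof.
move=> hp.
pose f0 (x : sub_lmod (Ce e)) (n : N) : V := qrepr (sub_val x) |> sub_val (psi n).
have annp n : ann V (sub_val (psi n)) by case: (sub_valP (psi n)).
have f0_bal : balanced f0.
  split=> [n c x y|x c u v|x c n]; rewrite /f0.
  - rewrite -gm_actLl; apply: ann_eq; first exact: annp.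
    by rewrite quo_projL !quo_projK.
  - by rewrite (hom0_lin hp) -gm_actLr.
  - rewrite (hom0_act hp) (@top_actE _ (qrepr (sub_val c)) c) ?quo_projK // gm_actA.
    by apply: ann_eq; [exact: annp | rewrite quo_projM !quo_projK].
have fl := tlift_lin f0_bal.
have fi n : tlift f0 (ind_unit n) = sub_val (psi n).
  rewrite (tlift_ten f0_bal) /f0 (@ann_eq V _ _ e0) ?quo_projK //.
  by case: (sub_valP (psi n)).
exists (tlift f0) => //; split=> //.
- move=> a t; have l1 : linear (fun t : I => tlift f0 (a |> t)).
    by move=> c u v; rewrite gm_actLr fl.
  have l2 : linear (fun t : I => a |> tlift f0 t) by move=> c u v; rewrite fl gm_actLr.
  apply/eqP; rewrite -subr_eq0; apply/eqP.
  apply: (@ten_ind _ _ _ _ (pre_ss (lin_eq_ss l1 l2) (zero_ss V))) => x n.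
  change (tlift f0 (a |> (ten x n : I)) - a |> tlift f0 (ten x n) = 0).
  have -> : a |> (ten x n : I) = ten (Ce_lact (pi a) x) n by exact: ten_actE.
  rewrite !(tlift_ten f0_bal) /f0 gm_actA; apply/eqP; rewrite subr_eq0; apply/eqP.
  by apply: ann_eq; [exact: annp | rewrite quo_projM !quo_projK].
- move=> d t; apply: (span_map fl) => _ [p [q [x [n [-> [a ha aE] hn ->]]]]].
  rewrite (tlift_ten f0_bal) /f0 (@ann_eq V _ _ a) ?quo_projK //.
  by apply: gm_degM => //; exact: (hom0_deg hp).
Qed.
End Shriek.

End Recollement.

(** * Weights of a triangular basis *)

Section BasisSpan.
Context (k : fieldType) (A : lualg k) (disp : Order.disp_t) (Lam : porderType disp).
Context (T : triangular_basis A Lam).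
Implicit Types (l m : Lam) (Gam : set Lam) (M K P V : gmod A).
Local Notation S := (set_type (tb_S T)).
Implicit Types (s t : S).
Local Notation dot := (@tb_dot _ _ _ _ T).
Local Notation one s := (la_one A (val s)).

Lemma seq_extremal (R : Lam -> Lam -> Prop) (P : Lam -> Prop) (ls : seq Lam) :
  (forall x, ~ R x x) -> (forall x y z, R x y -> R y z -> R x z) ->
  (exists2 x, x \in ls & P x) ->
  exists x, [/\ x \in ls, P x & forall y, y \in ls -> P y -> ~ R y x].
Proof.
move=> ir tr; elim: ls => [[] //|a ls ih] [x].
case: (pselect (exists2 x, x \in ls & P x)) => [h|nh].
  have [z [zl pz hz]] := ih h => _ _.
  case: (pselect (P a /\ R a z)) => [[pa ra]|na].
    exists a; rewrite inE eqxx; split=> // y; rewrite inE => /orP[/eqP -> _|yl py ry].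
      exact: ir.
    exact: (hz y yl py (tr _ _ _ ry ra)).
  exists z; rewrite inE zl orbT; split=> // y; rewrite inE => /orP[/eqP -> pa ra|]; last exact: hz.
  exact: na.
rewrite inE => /orP[/eqP -> pa|xl px]; last by case: nh; exists x.
exists a; rewrite inE eqxx; split=> // y; rewrite inE => /orP[/eqP -> _|yl py _]; first exact: ir.
by apply: nh; exists y.
Qed.

Lemma down_seq l : exists ls : seq Lam, forall m, (m \in ls) = (m <= l)%O.
Proof.
have /finite_seqP[ls e] := tb_lower_finite T l; exists ls => m.
by apply/idP/idP => h; [have : [set` ls] m by []|have : [set m | (m <= l)%O] m by []];
  rewrite ?e // -e.
Qed.

Lemma lam_min (P : Lam -> Prop) l : P l -> exists m, P m /\ forall n, (n < m)%O -> ~ P n.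
Proof.
move=> pl; have [ls lsE] := down_seq l.
have [|||m [ml pm hm]] := @seq_extremal (fun x y => (x < y)%O) P ls.
- by move=> x; rewrite ltxx.
- by move=> x y z; exact: lt_trans.
- by exists l => //; rewrite lsE.
exists m; split=> // n nm pn; apply: (hm n) => //.
by rewrite lsE (le_trans (ltW nm)) // -lsE.
Qed.

Lemma lam_ind (P : Lam -> Prop) : (forall l, (forall m, (m < l)%O -> P m) -> P l) ->
  forall l, P l.
Proof.
move=> h l; apply: contrapT => nl; have [m [nm hm]] := @lam_min (fun l => ~ P l) l nl.
by apply: nm; apply: h => n /hm /contrapT.
Qed.

Definition lower Gam := forall l m, (m <= l)%O -> Gam l -> Gam m.
Definition nge l : set Lam := [set m | ~~ (l <= m)%O].

Lemma nge_lower l : lower (nge l).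
Proof. by move=> m n nm; apply: contra => ln; exact: le_trans nm. Qed.
Lemma nge_lt l m : (m < l)%O -> nge l m.
Proof. by move=> h; rewrite /nge /= -?leNgt; apply/negP => h'; have := le_lt_trans h' h; rewrite ltxx. Qed.

Lemma H_dot s t h : tb_H s t h -> dot s = dot t.
Proof.
move=> hh; case: (eqVneq s t) => [-> //|ne].
by have [_ H _] := tb_order ne; apply: H; exists h.
Qed.

Lemma X_dot s t x : tb_X (val s) t x -> (s = t /\ x = one s) \/ (dot t < dot s)%O.
Proof.
move=> hx; case: (eqVneq s t) => [e|ne]; last first.
  by right; have [H _ _] := tb_order ne; apply: H; exists x.
by left; split=> //; move: hx; rewrite -e; have [-> _] := tb_diag s.
Qed.

Lemma Y_dot s t y : tb_Y s (val t) y -> (s = t /\ y = one s) \/ (dot s < dot t)%O.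
Proof.
move=> hy; case: (eqVneq s t) => [e|ne]; last first.
  by right; have [_ _ H] := tb_order ne; apply: H; exists y.
by left; split=> //; move: hy; rewrite -e; have [_ ->] := tb_diag s.
Qed.

Lemma X_l i s x : tb_X i s x -> la_one A i ** x = x. Proof. by case/tb_X_hom. Qed.
Lemma X_r i s x : tb_X i s x -> x ** one s = x. Proof. by case/tb_X_hom. Qed.
Lemma H_l s t x : tb_H s t x -> one s ** x = x. Proof. by case/tb_H_hom. Qed.
Lemma H_r s t x : tb_H s t x -> x ** one t = x. Proof. by case/tb_H_hom. Qed.
Lemma Y_l s i x : tb_Y s i x -> one s ** x = x. Proof. by case/tb_Y_hom. Qed.
Lemma Y_r s i x : tb_Y s i x -> x ** la_one A i = x. Proof. by case/tb_Y_hom. Qed.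

(** For a lower set [Gam] of weights this is a two-sided ideal, by [Bs_ideal]. *)
Definition basis_in Gam : set A := [set a | exists i s t j x h y,
  [/\ tb_X i s x, tb_H s t h, tb_Y t j y, Gam (dot t) & a = x ** h ** y]].
Definition Bs Gam : subspace A := span (basis_in Gam).

Lemma Bs_all a : Bs setT a.
Proof.
have [h _] := tb_basis T; apply: span_mono (h a) => _ [[[x h0] y]] /= D <-.
have [s [t [[i hx] hh [j hy]]]] := D.
by exists i, s, t, j, x, h0, y.
Qed.

Lemma Bs_mono Gam Gam' : Gam `<=` Gam' -> Bs Gam `<=` Bs Gam'.
Proof.
move=> h; apply: span_mono => a [i [s [t [j [x [h0 [y [hx hh hy /h hg ->]]]]]]]].
by exists i, s, t, j, x, h0, y.
Qed.

(** The basis elements in the expansion of an [a] of [1_t A] begin with an [x] of [X(t, s)],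
    so that [s = t] and [x = 1_t], or [s] has smaller weight. *)
Lemma left_ind (W : subspace A) t a : one t ** a = a ->
  (forall s j h y, tb_H t s h -> tb_Y s j y -> W (h ** y)) ->
  (forall s s' j x h y, tb_X (val t) s x -> tb_H s s' h -> tb_Y s' j y ->
    (dot s < dot t)%O -> W (x ** h ** y)) -> W a.
Proof.
move=> ta h1 h2; rewrite -ta.
apply: (span_map (la_mulLr (one t)) _ (Bs_all a)).
move=> _ [i [s [s' [j [x [h [y [hx hh hy _ ->]]]]]]]].
rewrite -(X_l hx) !la_mulA la_orth; case: eqP => [ei|_]; last first.
  by rewrite !mul0A; exact: ss0.
rewrite ei (X_l hx); move: hx; rewrite -ei => hx.
case: (X_dot hx) => [[e ->]|lt]; last exact: h2 hx hh hy lt.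
by rewrite {1}e (H_l hh); apply: h1 hy; rewrite e.
Qed.

Lemma right_ind (W : subspace A) t a : a ** one t = a ->
  (forall i s x h, tb_X i s x -> tb_H s t h -> W (x ** h)) ->
  (forall i s s' x h y, tb_X i s x -> tb_H s s' h -> tb_Y s' (val t) y ->
    (dot s' < dot t)%O -> W (x ** h ** y)) -> W a.
Proof.
move=> ta h1 h2; rewrite -ta.
apply: (span_map (la_mulLl (one t)) _ (Bs_all a)).
move=> _ [i [s [s' [j [x [h [y [hx hh hy _ ->]]]]]]]].
rewrite -(Y_r hy) -!la_mulA la_orth; case: eqP => [ej|_]; last first.
  by rewrite !mulA0; exact: ss0.
rewrite (Y_r hy) la_mulA; move: hy; rewrite ej => hy.
case: (Y_dot hy) => [[e ->]|lt]; last exact: h2 hx hh hy lt.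
by rewrite -la_mulA (H_r hh); apply: (h1 i s) => //; rewrite -e.
Qed.

Lemma left_map (U : lmodType k) (f : A -> U) (W : subspace U) t a : linear f ->
  one t ** a = a ->
  (forall s j h y, tb_H t s h -> tb_Y s j y -> W (f (h ** y))) ->
  (forall s s' j x h y, tb_X (val t) s x -> tb_H s s' h -> tb_Y s' j y ->
    (dot s < dot t)%O -> W (f (x ** h ** y))) -> W (f a).
Proof. by move=> lf ta h1 h2; exact: (@left_ind (pre_ss lf W) t). Qed.

Lemma right_map (U : lmodType k) (f : A -> U) (W : subspace U) t a : linear f ->
  a ** one t = a ->
  (forall i s x h, tb_X i s x -> tb_H s t h -> W (f (x ** h))) ->
  (forall i s s' x h y, tb_X i s x -> tb_H s s' h -> tb_Y s' (val t) y ->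
    (dot s' < dot t)%O -> W (f (x ** h ** y))) -> W (f a).
Proof. by move=> lf ta h1 h2; exact: (@right_ind (pre_ss lf W) t). Qed.

(** For a lower set of weights the span is the two-sided ideal generated by the
    corresponding idempotents; the expansions strictly lower the weight, so that
    well-founded induction applies. *)
Lemma Bs_ideal Gam : lower Gam -> forall t a b, Gam (dot t) -> Bs Gam (a ** one t ** b).
Proof.
move=> low t; move e: (dot t) => l; move: l t e; apply: lam_ind => l ih t e a b gl.
have lin1 : linear (fun a => a ** one t ** b) by move=> c u v; rewrite !la_mulLl.
apply: (span_map lin1 _ (Bs_all a)).
move=> _ [i [s [s' [j [x [h [y [hx hh hy _ ->]]]]]]]].
rewrite -(Y_r hy) -[_ ** _ ** one t]la_mulA -[_ ** _ ** one t]la_mulA la_orth.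
case: eqP => [ej|_]; last first.
  by rewrite !mulA0 mul0A; exact: ss0.
rewrite (Y_r hy); move: hy; rewrite ej => hy.
case: (Y_dot hy) => [[et ->]|lt]; last first.
  rewrite -(Y_l hy) [x ** h ** _]la_mulA -[_ ** y ** b]la_mulA.
  apply: (ih (dot s')) => //; first by rewrite -e.
  by apply: low gl; rewrite -e ltW.
rewrite -[x ** h ** _]la_mulA (H_r hh) -la_mulA.
have ds : dot s = l by rewrite (H_dot hh) et.
apply: (@left_ind (pre_ss (la_mulLr x) (Bs Gam)) s); first by rewrite la_mulA (H_l hh).
- move=> s2 j2 h2 y2 hh2 hy2; rewrite /= /preimage /mkset la_mulA; apply: span_sub.
  by exists i, s, s2, j2, x, h2, y2; split=> //; rewrite -(H_dot hh2) ds.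
- move=> s2 s3 j2 x2 h2 y2 hx2 hh2 hy2 lt; rewrite /= /preimage /mkset.
  have -> : x ** (x2 ** h2 ** y2) = x ** x2 ** one s2 ** (h2 ** y2).
    by rewrite -(la_mulA x x2 (one s2)) (X_r hx2) !la_mulA.
  apply: (ih (dot s2)) => //; first by rewrite -ds.
  by apply: low gl; rewrite -ds ltW.
Qed.

Lemma Bs_mull Gam : lower Gam -> forall b a, Bs Gam a -> Bs Gam (b ** a).
Proof.
move=> low b; apply: (span_map (la_mulLr b)).
move=> _ [i [s [s' [j [x [h [y [hx hh hy g ->]]]]]]]].
have -> : b ** (x ** h ** y) = b ** x ** one s ** (h ** y).
  by rewrite -(la_mulA b x (one s)) (X_r hx) !la_mulA.
by apply: Bs_ideal => //; rewrite (H_dot hh).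
Qed.

Lemma Bs_mulr Gam : lower Gam -> forall b a, Bs Gam a -> Bs Gam (a ** b).
Proof.
move=> low b; apply: (span_map (la_mulLl b)).
move=> _ [i [s [s' [j [x [h [y [hx hh hy g ->]]]]]]]].
have -> : x ** h ** y ** b = x ** h ** one s' ** (y ** b).
  by rewrite [RHS]la_mulA -[_ ** one s' ** y]la_mulA (Y_l hy).
exact: Bs_ideal.
Qed.

Lemma e_sum l : exists ss : seq S, [/\ uniq ss, forall s, (s \in ss) = (dot s == l) &
  tb_e T l = \sum_(s <- ss) one s].
Proof.
have /finite_seqP[ls e] := tb_fibers T l.
have us : uniq (undup ls) by exact: undup_uniq.
have e' : [set s | dot s = l] = [set` undup ls].
  by rewrite e; apply/seteqP; split=> s /=; rewrite mem_undup.
exists (undup ls); split=> // [s|]; last by rewrite /tb_e e'; apply/esym; exact: fsbig_seq.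
apply/idP/eqP => h; first by have : [set s | dot s = l] s by rewrite e'.
by have : [set` undup ls] s by rewrite -e'.
Qed.

Lemma one_e s l : one s ** tb_e T l = if dot s == l then one s else 0.
Proof.
have [ss [us mE ->]] := e_sum l; rewrite mulA_sumr -mE; case: ifPn => ds.
  rewrite (bigD1_seq s) //= la_orth eqxx big1 ?addr0 // => t ne.
  by rewrite la_orth (inj_eq val_inj) eq_sym (negbTE ne).
rewrite big_seq big1 // => t ts; rewrite la_orth (inj_eq val_inj).
by case: eqP ds => // ->; rewrite ts.
Qed.

Lemma e_one s l : tb_e T l ** one s = if dot s == l then one s else 0.
Proof.
have [ss [us mE ->]] := e_sum l; rewrite mulA_suml -mE; case: ifPn => ds.
  rewrite (bigD1_seq s) //= la_orth eqxx big1 ?addr0 // => t ne.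
  by rewrite la_orth (inj_eq val_inj) (negbTE ne).
rewrite big_seq big1 // => t ts; rewrite la_orth (inj_eq val_inj).
by case: eqP ds => // <-; rewrite ts.
Qed.

Definition Jl l : gideal A := gen_ideal (@tb_gen_hom _ _ _ _ T l).

Lemma one_J l s : nge l (dot s) -> Jl l (one s).
Proof.
move=> h; have := one_e s (dot s); rewrite eqxx => <-.
by apply: gi_mull; apply: gen_sub; exists (dot s).
Qed.

Lemma e_J l m : nge l m -> Jl l (tb_e T m).
Proof. by move=> h; apply: gen_sub; exists m. Qed.

Lemma JlP l a : Jl l a <-> Bs (nge l) a.
Proof.
split=> [h|].
  have low := @nge_lower l.
  apply: h => [b x|b x|_ [m hm <-]]; [exact: Bs_mull | exact: Bs_mulr |].
  have [ss [_ sd ->]] := e_sum m; apply: ss_sum_seq => s; rewrite sd => /eqP e.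
  have -> : one s = one s ** one s ** one s by rewrite !la_orth eqxx la_orth eqxx.
  by apply: Bs_ideal => //; rewrite e.
apply: (@span_min _ _ _ (Jl l)) => _ [i [s [s' [j [x [h [y [hx hh hy g ->]]]]]]]].
rewrite -(Y_l hy) la_mulA; apply: gi_mulr; apply: gi_mull; exact: one_J.
Qed.

(** * The submodules generated by sets of weights *)

(** For lower [Gam] this is [I M], for [I] the ideal [Bs Gam]; by [imodP] the case of the
    weights not above [l] gives [J_l M]. Only the [x] are needed in front, because [h y m]
    lies in [1_t M] again. *)
Definition Jm Gam M : subspace M := span [set v : M | exists i t x (m : M),
  [/\ tb_X i t x, Gam (dot t), one t |> m = m & v = x |> m]].

Lemma Jm_gen Gam M i t x (m : M) : tb_X i t x -> Gam (dot t) -> one t |> m = m ->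
  Jm Gam M (x |> m).
Proof. by move=> hx g tm; apply: span_sub; exists i, t, x, m. Qed.

Lemma Jm_mono Gam Gam' M : Gam `<=` Gam' -> Jm Gam M `<=` Jm Gam' M.
Proof.
move=> h; apply: span_mono => v [i [t [x [m [hx /h g tm ->]]]]].
by exists i, t, x, m.
Qed.

Lemma Jm_map Gam M M' (f : M -> M') : hom0 f -> forall v, Jm Gam M v -> Jm Gam M' (f v).
Proof.
move=> hf; apply: (span_map (hom0_lin hf)) => _ [i [t [x [m [hx g tm ->]]]]].
by rewrite (hom0_act hf); apply: (Jm_gen hx) => //; rewrite -(hom0_act hf) tm.
Qed.

Lemma Bs_act Gam M a (m : M) : Bs Gam a -> Jm Gam M (a |> m).
Proof.
apply: (span_map (gm_actLl m)) => _ [i [s [s' [j [x [h [y [hx hh hy g ->]]]]]]]].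
rewrite -!gm_actA; apply: (Jm_gen hx); first by rewrite (H_dot hh).
by rewrite gm_actA (H_l hh).
Qed.

Lemma Jm_act Gam M : lower Gam -> forall a (m : M), Jm Gam M m -> Jm Gam M (a |> m).
Proof.
move=> low a; apply: (span_map (gm_actLr a)) => _ [i [t [x [m [hx g tm ->]]]]].
rewrite -tm -(X_r hx) !gm_actA; apply: Bs_act.
by rewrite la_mulA; apply: Bs_ideal.
Qed.

Lemma imodP l M (v : M) : imod (Jl l) M v <-> Jm (nge l) M v.
Proof.
split.
  by apply: imod_min => a x /JlP; exact: Bs_act.
apply: (@span_min _ _ _ (imod (Jl l) M)) => _ [i [t [x [m [hx g tm ->]]]]].
by rewrite -(X_r hx) -gm_actA; apply: gs_act; apply: imodI; exact: one_J.
Qed.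

Lemma Jm_fin l M (v : M) : Jm (nge l) M v ->
  exists ls : seq Lam, [/\ lower [set` ls], [set` ls] `<=` nge l & Jm [set` ls] M v].
Proof.
pose Q (v : M) := exists ls : seq Lam,
  [/\ lower [set` ls], [set` ls] `<=` nge l & Jm [set` ls] M v].
have Q0 : Q 0 by exists [::]; split=> // ; exact: ss0.
have QL (c : k) u w : Q u -> Q w -> Q (c *: u + w).
  move=> [ls [h1 h2 h3]] [ls' [h1' h2' h3']]; exists (ls ++ ls'); split.
  - move=> m n nm; rewrite /= !mem_cat => /orP[/(h1 _ _ nm) ->//|/(h1' _ _ nm) ->].
    by rewrite orbT.
  - by move=> m; rewrite /= mem_cat => /orP[/h2|/h2'].
  - apply: ssL; [apply: Jm_mono h3|apply: Jm_mono h3'] => m /= hm;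
    by rewrite mem_cat hm ?orbT.
apply: (@span_min _ _ _ (Subspace Q0 QL)) => _ [i [t [x [m [hx g tm ->]]]]].
have [ls lsE] := down_seq (dot t); exists ls; split.
- by move=> m' n nm; rewrite /= !lsE; exact: le_trans.
- by move=> n; rewrite /= lsE => h; exact: nge_lower h g.
- by apply: (Jm_gen hx) => //=; rewrite lsE.
Qed.

(** * Tor-free modules *)

(** The relations [sum_x x m_x = 0] between the [x] of weight [l] are trivial modulo
    [J_l M]; equivalently the natural map from the module induced from the weight [l]
    part to [M / J_l M] is injective. It stands in for the vanishing of all [Tor_n],
    [n >= 1], of [M] with the right standard modules. *)
Definition tor_free M := forall l (ps : seq (A * S)) (m : A * S -> M), uniq ps ->
  (forall p, p \in ps ->
    [/\ exists i, tb_X i p.2 p.1, dot p.2 = l & one p.2 |> m p = m p]) ->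
  Jm (nge l) M (\sum_(p <- ps) p.1 |> m p) -> forall p, p \in ps -> Jm (nge l) M (m p).

(** Collecting the coefficients of equal [x] puts the terms of one weight in the form
    that [tor_free] speaks of. *)
Lemma Jm_split Gam l M v : Jm Gam M v -> exists (ps : seq (A * S)) (m : A * S -> M),
  [/\ uniq ps, forall p, p \in ps ->
    [/\ exists i, tb_X i p.2 p.1, dot p.2 = l & one p.2 |> m p = m p] &
    Jm [set n | Gam n /\ n <> l] M (v - \sum_(p <- ps) p.1 |> m p)].
Proof.
pose G' := [set n | Gam n /\ n <> l].
pose ok (ps : seq (A * S)) (m : A * S -> M) := forall p, p \in ps ->
    [/\ exists i, tb_X i p.2 p.1, dot p.2 = l & one p.2 |> m p = m p].
pose Q (v : M) := exists (ps : seq (A * S)) (m : A * S -> M),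
  [/\ uniq ps, ok ps m & Jm G' M (v - \sum_(p <- ps) p.1 |> m p)].
have Q0 : Q 0.
  by exists [::], (fun => 0); split=> //; rewrite big_nil subrr; exact: ss0.
have QL (c : k) u w : Q u -> Q w -> Q (c *: u + w).
  move=> [ps [m [ups hps hu]]] [ps' [m' [ups' hps' hw]]].
  pose ext (qs : seq (A * S)) (n : A * S -> M) p := if p \in qs then n p else 0.
  have extE qs n : uniq qs -> {subset qs <= undup (ps ++ ps')} ->
      \sum_(p <- undup (ps ++ ps')) p.1 |> ext qs n p = \sum_(p <- qs) p.1 |> n p.
    move=> uqs sub; rewrite -(big_ext (fun p : A * S => p.1 |> n p) uqs (undup_uniq _) sub).
    by apply: eq_bigr => p _; rewrite /ext; case: ifP => // _; exact: lin0 (gm_actLr _).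
  exists (undup (ps ++ ps')), (fun p => c *: ext ps m p + ext ps' m' p); split.
  - exact: undup_uniq.
  - move=> p; rewrite mem_undup mem_cat => hp.
    have [h1 h2] : (exists i, tb_X i p.2 p.1) /\ dot p.2 = l.
      by case/orP: hp => [/hps|/hps'] [].
    split=> //; rewrite gm_actLr /ext; congr (_ *: _ + _).
    + by case: ifP => [/hps[]//|_]; exact: lin0 (gm_actLr _).
    + by case: ifP => [/hps'[]//|_]; exact: lin0 (gm_actLr _).
  - under eq_bigr do rewrite gm_actLr.
    rewrite big_split /= -scaler_sumr !extE //; last 2 first.
      by move=> p hp; rewrite mem_undup mem_cat hp orbT.
      by move=> p hp; rewrite mem_undup mem_cat hp.
    by rewrite opprD addrACA -scalerBr; exact: (@ssL _ _ (Jm G' M)).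
apply: (@span_min _ _ _ (Subspace Q0 QL)) => _ [i [t [x [m [hx g tm ->]]]]].
case: (eqVneq (dot t) l) => [e|ne].
  exists [:: (x, t)], (fun => m); split=> //; last by rewrite big_seq1 subrr; exact: ss0.
  by move=> p; rewrite inE => /eqP ->; split=> //; exists i.
exists [::], (fun => 0); split=> //; rewrite big_nil subr0.
by apply: (Jm_gen hx) => //; split=> //; exact/eqP.
Qed.

(** Again because [X(t, s)] is empty unless [s = t] or [s] has smaller weight than [t]. *)
Lemma Jm_lt M t v : one t |> v = v -> Jm (nge (dot t)) M v ->
  Jm [set n | (n < dot t)%O] M v.
Proof.
move=> tv h; rewrite -tv; move: h.
apply: (span_map (gm_actLr (one t))) => _ [i [t' [x [m [hx g tm ->]]]]].
rewrite gm_actA -(X_l hx) la_mulA la_orth; case: eqP => [ei|_]; last first.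
  by rewrite mul0A (lin0 (gm_actLl _)); exact: ss0.
rewrite ei (X_l hx); move: hx; rewrite -ei => hx.
case: (X_dot hx) => [[e _]|lt]; last exact: (Jm_gen hx).
by move: g; rewrite -e /nge /= lexx.
Qed.

(** If [P / K] is Tor-free then [K] meets [J_Gam P] in [J_Gam K]: peel off the terms of
    a maximal weight, whose coefficients can be moved to [K] at the cost of terms of
    smaller weight. *)
Lemma Jm_ses K P M (u : K -> P) (p : P -> M) : ses u p -> tor_free M ->
  forall (n : nat) (ls : seq Lam), (size ls <= n)%N -> lower [set` ls] ->
  forall y, Jm [set` ls] P (u y) -> Jm [set` ls] K y.
Proof.
move=> [hu hp iu sp exp] hM; elim=> [|n ih] ls hs low y hy.
  have e : [set` ls] = set0.
    by apply/seteqP; split=> // l; move: hs; rewrite leqn0 size_eq0 => /eqP ->.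
  suff -> : y = 0 by exact: ss0.
  apply: (hom0_inj0 hu iu); move: hy; rewrite e.
  by apply: (@span_min _ _ _ (zero_ss P)) => _ [? [? [? [? [_ []]]]]].
case: (pselect (exists l, l \in ls)) => [[l0 l0s]|nl]; last first.
  by apply: Jm_mono (ih [::] _ _ y _) => //; apply: Jm_mono hy => l hl; case: nl; exists l.
have [|||l [ls' _ lmax]] := @seq_extremal (fun x y => (y < x)%O) (fun=> True) ls.
- by move=> x; rewrite ltxx.
- by move=> x y' z h1 h2; exact: lt_trans h2 h1.
- by exists l0.
have {}lmax m : m \in ls -> (l < m)%O -> False by move=> h; exact: (lmax m h).
have [ps [m [ups hps hr]]] := Jm_split l hy.
set G' := [set n | _] in hr.
pose lsr := [seq m <- ls | m != l].
(* as [l] is maximal, the remaining weights are not above it, and form a lower set *)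
have G'E : G' = [set` lsr].
  apply/seteqP; split=> j; rewrite /G' /= mem_filter; first by move=> [-> /eqP ->].
  by move=> /andP[/eqP h ->].
have lowr : lower G'.
  move=> a b ba [ha na]; split; first exact: low ha.
  move=> e; move: ba; rewrite e le_eqVlt => /orP[/eqP e'|]; last exact: lmax.
  by apply: na; rewrite e'.
have G'nge : G' `<=` nge l.
  move=> a [ha na]; rewrite /nge /=; apply/negP; rewrite le_eqVlt => /orP[/eqP e|].
    by apply: na; rewrite e.
  exact: lmax.
have pu z : p (u z) = 0 by apply/exp; exists z.
have pm q : q \in ps -> Jm (nge l) M (p (m q)).
  apply: (hM l ps (fun q => p (m q)) ups).
    by move=> q' /hps[h1 h2 h3]; split=> //; rewrite -(hom0_act hp) h3.
  have := Jm_map hp hr; rewrite (hom0B _ _ hp) pu sub0r (lin_sum _ _ _ (hom0_lin hp)).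
  move=> /(ssN (S := Jm G' M)); rewrite opprK => h.
  apply: (Jm_mono G'nge); move: h; congr (Jm G' M _).
  by apply: eq_bigr => q' _; rewrite (hom0_act hp).
(* [m q] is congruent to an element of [K], up to terms of weight smaller than [l] *)
have ex q : q \in ps -> exists kq, one q.2 |> kq = kq /\ Jm G' P (q.1 |> (m q - u kq)).
  move=> qs; have [[i hx] dq tq] := hps q qs.
  have hlt : Jm [set n | (n < dot q.2)%O] M (p (m q)).
    by apply: Jm_lt; [rewrite -(hom0_act hp) tq | rewrite dq; exact: pm].
  have [r hr' rE] : exists2 r, Jm [set n | (n < dot q.2)%O] P r & p r = p (m q).
    move: hlt; apply: (@span_min _ _ _ (im_ss (hom0_lin hp) (Jm _ P))).
    move=> _ [j [t [x [v [hx' g tv ->]]]]]; have [w wE] := sp v.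
    exists (x |> one t |> w); first by apply: (Jm_gen hx') => //; rewrite act_orth eqxx.
    by rewrite !(hom0_act hp) wE tv.
  have /exp[z zE] : p (m q - one q.2 |> r) = 0.
    by rewrite (hom0B _ _ hp) (hom0_act hp) rE -(hom0_act hp) tq subrr.
  exists z; split.
    apply: iu; rewrite (hom0_act hu) zE (linB _ _ (gm_actLr _)) tq.
    by rewrite act_orth eqxx.
  rewrite zE opprB addrC subrK; apply: Jm_mono (Jm_act _ q.1 (Jm_act _ (one q.2) hr')).
  - move=> a ha; split; last by move=> e; move: ha; rewrite /= e dq ltxx.
    by apply: (low l) => //; rewrite -dq; exact: ltW.
  - by move=> a b ba; exact: le_lt_trans.
  - by move=> a b ba; exact: le_lt_trans.
pose kq (q : A * S) : K := if pselect (q \in ps) is left h then projT1 (cid (ex q h)) else 0.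
have kqP q : q \in ps -> one q.2 |> kq q = kq q /\ Jm G' P (q.1 |> (m q - u (kq q))).
  by rewrite /kq; case: pselect => // h _; case: cid.
pose w := \sum_(q <- ps) q.1 |> kq q.
have hw : Jm [set` ls] K w.
  apply: ss_sum_seq => q qs; have [[i hx] dq tq] := hps q qs.
  by apply: (Jm_gen hx); [rewrite /= dq | case: (kqP q qs)].
have hyw : Jm G' K (y - w).
  rewrite G'E; apply: ih.
  - rewrite -ltnS; apply: leq_trans hs; rewrite size_filter -(count_predC (pred1 l) ls).
    by rewrite -[X in (X < _)%N]add0n ltn_add2r -has_count; apply/hasP; exists l => //=.
  - by rewrite -G'E.
  rewrite -G'E (hom0B _ _ hu).
  have -> : u y - u w = (u y - \sum_(q <- ps) q.1 |> m q) +
      \sum_(q <- ps) q.1 |> (m q - u (kq q)).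
    have -> : \sum_(q <- ps) q.1 |> (m q - u (kq q)) = \sum_(q <- ps) q.1 |> m q - u w.
      rewrite (lin_sum _ _ _ (hom0_lin hu)) -sumrB; apply: eq_bigr => q _.
      by rewrite (linB _ _ (gm_actLr _)) (hom0_act hu).
    by rewrite addrA subrK.
  by apply: ssD hr _; apply: ss_sum_seq => q /kqP[].
rewrite -[y](subrK w); apply: ssD => //.
by apply: Jm_mono hyw => a [].
Qed.

Lemma Jm_exact K P M (u : K -> P) (p : P -> M) : ses u p -> tor_free M ->
  forall l y, Jm (nge l) P (u y) -> Jm (nge l) K y.
Proof.
move=> hs hM l y /Jm_fin[ls [h1 h2 h3]].
exact: Jm_mono (Jm_ses hs hM (leqnn _) h1 h3).
Qed.

Lemma tor_free_ker K P M (u : K -> P) (p : P -> M) : ses u p -> tor_free M ->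
  tor_free P -> tor_free K.
Proof.
move=> hs hM hP l ps m ups hps h q qs; apply: (Jm_exact hs hM).
have [hu _ _ _ _] := hs.
apply: (hP l ps (fun q => u (m q)) ups) => //.
  by move=> q' /hps[h1 h2 h3]; split=> //; rewrite -(hom0_act hu) h3.
have := Jm_map hu h; rewrite (lin_sum _ _ _ (hom0_lin hu)).
by congr (Jm _ P _); apply: eq_bigr => q' _; rewrite (hom0_act hu).
Qed.

Lemma tor_free_retract M P (f : M -> P) (g : P -> M) : hom0 f -> hom0 g ->
  (forall x, g (f x) = x) -> tor_free P -> tor_free M.
Proof.
move=> hf hg fK hP l ps m ups hps h q qs; rewrite -[m q]fK; apply: (Jm_map hg).
apply: (hP l ps (fun q => f (m q)) ups) => //.
  by move=> q' /hps[h1 h2 h3]; split=> //; rewrite -(hom0_act hf) h3.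
have := Jm_map hf h; rewrite (lin_sum _ _ _ (hom0_lin hf)).
by congr (Jm _ P _); apply: eq_bigr => q' _; rewrite (hom0_act hf).
Qed.

End BasisSpan.

(** * Coefficients with respect to the triangular basis *)

Section BasisExt.
Context (k : fieldType) (V U : lmodType k) (I : choiceType) (D : set I) (f : I -> V).
Hypothesis hD : basis_family D f.

(** A linear map may be prescribed on a basis: the graph spanned by the prescribed
    pairs is functional because of the linear independence. *)
Lemma basis_ext (phi : I -> U) : exists2 F : V -> U, linear F &
  forall p, D p -> F (f p) = phi p.
Proof.
pose Gr : subspace (V * U)%type :=
  span [set q : V * U | exists2 p, D p & q = (f p, phi p)].
pose Q (q : V * U) := exists (s : seq I) (c : I -> k),
  [/\ uniq s, forall t, t \in s -> D t & q = \sum_(t <- s) c t *: (f t, phi t)].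
have Q0 : Q 0 by exists [::], (fun => 0); split=> //; rewrite big_nil.
have QL (a : k) u w : Q u -> Q w -> Q (a *: u + w).
  move=> [s [c [us hs ->]]] [t [d [ut ht ->]]].
  exists (undup (s ++ t)),
    (fun x => a * (if x \in s then c x else 0) + (if x \in t then d x else 0)).
  split; first exact: undup_uniq.
    by move=> x; rewrite mem_undup mem_cat => /orP[/hs|/ht].
  under [RHS]eq_bigr do rewrite scalerDl -scalerA.
  rewrite big_split -scaler_sumr; congr (_ *: _ + _).
    rewrite -(big_ext _ us (undup_uniq (s ++ t))); last first.
      by move=> x hx; rewrite mem_undup mem_cat hx.
    by apply: eq_bigr => x _; case: ifP; rewrite ?scale0r.
  rewrite -(big_ext _ ut (undup_uniq (s ++ t))); last first.
    by move=> x hx; rewrite mem_undup mem_cat hx orbT.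
  by apply: eq_bigr => x _; case: ifP; rewrite ?scale0r.
have GrQ q : Gr q -> Q q.
  apply: (@span_min _ _ _ (Subspace Q0 QL)) => _ [p hp ->].
  exists [:: p], (fun => 1); split=> //; last by rewrite big_seq1 scale1r.
  by move=> t; rewrite inE => /eqP ->.
have fstL : linear (fun q : V * U => q.1) by [].
have sndL : linear (fun q : V * U => q.2) by [].
have fn u : Gr (0, u) -> u = 0.
  move=> /GrQ[s [c [us hs e]]].
  have e1 : \sum_(t <- s) c t *: f t = 0.
    by have := congr1 (fun q => q.1) e; rewrite (lin_sum _ _ _ fstL) => <-.
  have := congr1 (fun q => q.2) e; rewrite (lin_sum _ _ _ sndL) /= => ->.
  by rewrite big_seq big1 // => t ts; rewrite (hD.2 s c us hs e1 t ts) scale0r.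
have tot v : exists u, Gr (v, u).
  have : im_ss fstL Gr v.
    apply: (@span_min _ _ _ (im_ss fstL Gr) _ v (hD.1 v)) => _ [p hp <-].
    by exists (f p, phi p) => //; apply: span_sub; exists p.
  by move=> [[v' u] h <-]; exists u.
pose F v := projT1 (cid (tot v)).
have FP v : Gr (v, F v) by rewrite /F; case: cid.
have FE v u : Gr (v, u) -> F v = u.
  move=> h; apply/eqP; rewrite -subr_eq0; apply/eqP/fn.
  have := ssB (FP v) h; congr (Gr _).
  by change ((v - v, F v - u) = (0, F v - u)); rewrite subrr.
exists F; first by move=> c u v; apply: FE; have := ssL c (FP u) (FP v).
by move=> p hp; apply: FE; apply: span_sub; exists p.
Qed.
End BasisExt.

Section TorFree.
Context (k : fieldType) (A : lualg k) (disp : Order.disp_t) (Lam : porderType disp).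
Context (T : triangular_basis A Lam).
Implicit Types (l m : Lam) (Gam : set Lam) (M N K P V : gmod A).
Local Notation S := (set_type (tb_S T)).
Implicit Types (s t : S).
Local Notation dot := (@tb_dot _ _ _ _ T).
Local Notation one s := (la_one A (val s)).
Local Notation Bs := (Bs T).
Local Notation nge := (@nge _ Lam).

Lemma basis_mem i s t j x h y : @tb_X _ _ _ _ T i s x -> tb_H s t h -> tb_Y t j y ->
  exists s t, [/\ exists i, tb_X i s (x, h, y).1.1, tb_H s t (x, h, y).1.2 &
    exists j, tb_Y t j (x, h, y).2].
Proof. by move=> hx hh hy; exists s, t; split=> //; [exists i | exists j]. Qed.

Lemma Bs_nge l i s t j x h y : tb_X i s x -> tb_H s t h -> tb_Y t j y ->
  (dot s < l)%O -> Bs (nge l) (x ** h ** y).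
Proof.
move=> hx hh hy lt; apply: span_sub; exists i, s, t, j, x, h, y; split=> //.
by rewrite -(H_dot hh); exact: nge_lt.
Qed.

(** The linear map [x h y |-> h y] for [x = x0], and [0] for the other [x]. Modulo the ideal
    it also computes the coefficient [a] of [x0 a] for [a] that is not a product [h y], since
    the other terms of [a] have smaller weight. *)
Lemma left_coeff (x0 : A) : exists F : A -> A,
  [/\ linear F, forall l a, Bs (nge l) a -> Bs (nge l) (F a) &
      forall i t x a, tb_X i t x -> one t ** a = a ->
        Bs (nge (dot t)) (F (x ** a) - (if x == x0 then a else 0))].
Proof.
have [F lF FE] := basis_ext (tb_basis T) (fun p => if p.1.1 == x0 then p.1.2 ** p.2 else 0).
have {}FE i s t j x h y : tb_X i s x -> tb_H s t h -> tb_Y t j y ->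
    F (x ** h ** y) = if x == x0 then h ** y else 0.
  by move=> hx hh hy; exact: (FE _ (basis_mem hx hh hy)).
have hF l a : Bs (nge l) a -> Bs (nge l) (F a).
  apply: (span_map lF) => _ [i [s [s' [j [x [h [y [hx hh hy g ->]]]]]]]].
  rewrite (FE _ _ _ _ _ _ _ hx hh hy); case: eqP => _; last exact: ss0.
  apply: span_sub; exists (val s), s, s', j, (one s), h, y; split=> //.
    by have [-> _] := tb_diag s.
  by rewrite (H_l hh).
exists F; split=> // i t x a hx ta.
have l1 : linear (fun a => F (x ** a) - (if x == x0 then a else 0)).
  apply: lin_eq_ss; first by move=> c u v; rewrite la_mulLr lF.
  by move=> c u v; case: eqP => // _; rewrite scaler0 addr0.
apply: (left_map (T := T) l1 ta).
- move=> s' j h y hh hy; rewrite la_mulA.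
  by rewrite (FE _ _ _ _ _ _ _ hx hh hy) subrr; exact: ss0.
- move=> s s' j x' h y hx' hh hy lt.
  have hb := Bs_nge hx' hh hy lt.
  apply: ssB; first by apply: hF; apply: Bs_mull => //; exact: nge_lower.
  by case: eqP => // _; exact: ss0.
Qed.

(** Apply the coefficient map of [p.1]; distinct pairs with the same first entry are then
    told apart by the idempotent [1_{p.2}]. *)
Lemma algebra_tor_free l (ps : seq (A * S)) (a : A * S -> A) : uniq ps ->
  (forall p, p \in ps ->
    [/\ exists i, tb_X i p.2 p.1, dot p.2 = l & one p.2 ** a p = a p]) ->
  Bs (nge l) (\sum_(p <- ps) p.1 ** a p) -> forall p, p \in ps -> Bs (nge l) (a p).
Proof.
move=> ups hps h p0 hp0; have [F [lF hF FE]] := left_coeff p0.1.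
have low := @nge_lower _ Lam l.
have h1 : Bs (nge l) (\sum_(p <- ps) (if p.1 == p0.1 then a p else 0)).
  have := ssB (hF _ _ h) (ss_sum_seq (S := Bs (nge l)) (s := ps)
    (f := fun p => F (p.1 ** a p) - (if p.1 == p0.1 then a p else 0)) _).
  rewrite (lin_sum _ _ _ lF) -sumrB => h2.
  under [X in Bs _ X]eq_bigr => p _ do rewrite -[if _ then _ else _](subKr (F (p.1 ** a p))).
  by apply: h2 => p /hps[[i hx] <- ta]; exact: FE hx ta.
have := Bs_mull low (one p0.2) h1; congr (Bs _ _).
rewrite mulA_sumr (bigD1_seq p0) //= eqxx.
have [_ _ ta] := hps p0 hp0; rewrite ta big_seq_cond big1 ?addr0 // => p /andP[hp ne].
case: eqP => e; last by rewrite mulA0.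
have [_ _ <-] := hps p hp; rewrite la_mulA la_orth (inj_eq val_inj).
case: eqP => [e'|_]; last by rewrite mul0A.
by case/eqP: ne; rewrite [LHS]surjective_pairing [RHS]surjective_pairing e e'.
Qed.

Lemma free_tor_free (G : choiceType) (ix : G -> la_idx A) dg : tor_free T (free ix dg).
Proof.
set F := free ix dg.
have Jm_ev l (f : F) g : Jm T (nge l) F f -> Bs (nge l) (sub_val f g).
  apply: (@span_map _ _ _ (fun f : F => sub_val f g)) => // _ [i [t [x [m [hx d tm ->]]]]].
  change (Bs (nge l) (x ** sub_val m g)); rewrite -tm.
  change (Bs (nge l) (x ** (one t ** sub_val m g))).
  by rewrite la_mulA; apply: Bs_ideal => //; exact: nge_lower.
have Jm_single l g a : Bs (nge l) a -> Jm T (nge l) F (single ix g a).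
  apply: (span_map (single_lin ix g)) => _ [i [s [t [j [x [h [y [hx hh hy d ->]]]]]]]].
  have -> : single ix g (x ** h ** y) = x |> (single ix g (h ** y) : F).
    by apply/esym; apply: etrans (act_single _ _ _ _) _; rewrite la_mulA.
  apply: (Jm_gen hx); first by rewrite (H_dot hh).
  by apply: etrans (act_single _ _ _ _) _; rewrite la_mulA (H_l hh).
move=> l ps m ups hps h p hp.
have [s [us hs]] := free_supp (m p); rewrite (free_dec us hs).
apply: ss_sum => g _; apply: Jm_single.
apply: (algebra_tor_free (a := fun p => sub_val (m p) g) ups _ _ hp) => [q hq|].
  have [h1 h2 h3] := hps q hq; split=> //.
  by have := congr1 (fun f : F => sub_val f g) h3.
have := Jm_ev _ _ g h; congr (Bs _ _).
by apply: (@lin_sum _ F A (fun f : F => sub_val f g)).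
Qed.

Lemma projective_tor_free P : projective_gmod P -> tor_free T P.
Proof.
move=> hP.
have [g hg gE] := projP hP (cover_map_hom P) (@cover_map_surj _ _ P) (hom0_id P).
have hF : tor_free T (cover P) by exact: free_tor_free.
exact: tor_free_retract hg (cover_map_hom P) gE hF.
Qed.

(** * Induced modules are Tor-free *)

Section Std.
Variables (l : Lam).
Local Notation J := (Jl T l).
Local Notation eb := (ebar T l).
Local Notation e0 := (tb_e T l).
Let e0K := tb_eK T l.
Let e0d := tb_e_deg T l.
Let eE : id_elt eb = quo_proj J e0 := erefl.
Variable N : gmod (alg_at T l).
Local Notation I := (j_shriek T N).
Local Notation ind_unit := (@ind_unit _ _ J eb N).
Local Notation kap := (@kap _ _ J eb).

(** The coefficient map of [left_coeff] is linear over the corner algebra on the right, modulo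
    [J_l], and so passes to the tensor product. This is the freeness of [A_{>=l} e] as a
    right module over the corner algebra. *)
Lemma shriek_coeff x0 : exists2 F : I -> N, linear F &
  forall i t x n, tb_X i t x -> dot t = l ->
    F (x |> ind_unit n) = if x == x0 then kap (one t) |> n else 0.
Proof.
have [F [lF hF FE]] := left_coeff x0.
have kJ a : Bs (nge l) a -> kap a = 0 by move=> h; apply: kap_J; exact/JlP.
have kB a b : Bs (nge l) (a - b) -> kap a = kap b.
  by move/kJ => h; apply/eqP; rewrite -subr_eq0 -(linB _ _ (@kap_lin _ _ J eb)) h.
have FB a b : J (a - b) -> kap (F a) = kap (F b).
  by move=> /JlP h; apply: kB; rewrite -(linB _ _ lF); exact: hF.
have low := @nge_lower _ Lam l.
have Fmul a b t : dot t = l -> a ** one t = a -> Bs (nge l) (F (a ** b) - F a ** b).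
  move=> dt ta.
  have l1 : linear (fun a => F (a ** b) - F a ** b).
    by apply: lin_eq_ss => c u v; rewrite ?la_mulLl ?lF ?la_mulLl.
  apply: (right_map (T := T) l1 ta).
  - move=> i s x h hx hh.
    have hs : dot s = l by rewrite (H_dot hh).
    have h1 := FE _ _ _ (h ** b) hx; have h2 := FE _ _ _ h hx.
    rewrite la_mulA (H_l hh) hs in h1; rewrite (H_l hh) hs in h2.
    have := ssB (h1 erefl) (Bs_mulr low b (h2 erefl)); congr (Bs _ _).
    rewrite (linB _ _ (la_mulLl b)) -la_mulA.
    by case: eqP => _; rewrite ?mul0A opprB addrA ?subrK ?subr0.
  - move=> i s s' x h y hx hh hy lt.
    have hb : Bs (nge l) (x ** h ** y).
      by apply: (Bs_nge hx hh hy); rewrite (H_dot hh) -dt.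
    by apply: ssB; [apply/hF/Bs_mulr | apply/Bs_mulr => //; exact: hF].
have Fe a b : Bs (nge l) (F (a ** e0 ** b) - F (a ** e0) ** b).
  have [ss [_ sd ->]] := e_sum T l.
  have l1 : linear (fun c => F (a ** c ** b) - F (a ** c) ** b).
    by apply: lin_eq_ss => c u v; rewrite ?la_mulLr ?la_mulLl ?lF ?la_mulLl.
  apply: (ss_sum_seq (S := pre_ss l1 (Bs (nge l)))) => t; rewrite sd => /eqP dt.
  by apply: (Fmul _ _ _ dt); rewrite -la_mulA la_orth eqxx.
pose c0 (x : sub_lmod (Ce eb)) (n : N) : N := kap (F (qrepr (sub_val x))) |> n.
have c0_bal : balanced c0.
  split=> [n c x y|x|x a n]; rewrite /c0.
  - rewrite -gm_actLl -(@kap_lin _ _ J eb) -lF; congr (_ |> _); apply: FB.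
    by apply/quo_proj_eq; rewrite quo_projL !quo_projK.
  - exact: gm_actLr.
  rewrite gm_actA; congr (_ |> _).
  set b := qrepr (sub_val x); set d := qrepr (sub_val a).
  have -> : kap (F (qrepr (sub_val (Ce_ract x a)))) = kap (F (b ** e0 ** d)).
    apply: FB; apply/quo_proj_eq; rewrite !quo_projM !quo_projK -eE.
    by rewrite Ce_er.
  rewrite (kB _ _ (Fe b d)).
  have -> : kap (F b) = kap (F (b ** e0)).
    by apply: FB; apply/quo_proj_eq; rewrite !quo_projM !quo_projK -eE Ce_er.
  have -> : kap (F (b ** e0)) = kap (F (b ** e0) ** e0).
    by rewrite -(kB _ _ (Fe b e0)) -la_mulA e0K.
  have kd : kap d = a by exact: kap_surj.
  rewrite -[in RHS]kd -(kapM eE) -[_ ** e0 ** e0]la_mulA e0K.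
  have := Fe b e0; rewrite -la_mulA e0K => h.
  apply: kB; have := Bs_mulr low d h.
  by rewrite (linB _ _ (la_mulLl d)).
have lc := tlift_lin c0_bal.
exists (tlift c0) => // i t x n hx dt.
have -> : x |> ind_unit n = ten (Ce_lact (quo_proj J x) (Ce_one eb)) n by exact: ten_actE.
rewrite (tlift_ten c0_bal) /c0.
have -> : kap (F (qrepr (sub_val (Ce_lact (quo_proj J x) (Ce_one eb))))) =
    kap (F (x ** one t)).
  apply: FB; apply/quo_proj_eq; rewrite quo_projK.
  change (quo_proj J x ** quo_proj J e0 = quo_proj J (x ** one t)).
  rewrite -quo_projM; congr quo_proj.
  by rewrite -[x](X_r hx) -la_mulA one_e dt eqxx -la_mulA la_orth eqxx.
have h := FE _ _ _ (one t) hx; rewrite la_orth eqxx dt in h.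
rewrite (kB _ _ (h erefl)); case: eqP => // _.
by rewrite (lin0 (@kap_lin _ _ J eb)) (lin0 (gm_actLl _)).
Qed.

Lemma e0_act_one (M : gmod A) t (m : M) : dot t = l -> one t |> m = m -> e0 |> m = m.
Proof. by move=> dt <-; rewrite gm_actA e_one dt eqxx. Qed.

Lemma std_gen (W : subspace I) : (forall a n, W (a |> ind_unit n)) -> forall v, W v.
Proof. exact: shriek_ind. Qed.

Lemma std_one_eq0 t (m : I) : ~~ (l <= dot t)%O -> one t |> m = m -> m = 0.
Proof. by move=> h <-; apply: shriek_killed; exact: one_J. Qed.

(** At the weight [l] itself this is the freeness above. At the other
    weights [l' >= l], [J_l' M] is all of [M], as [M] is generated in weight [l]; at the
    weights that are not above [l], [M] is zero. *)
Lemma shriek_tor_free : tor_free T I.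
Proof.
move=> l' ps m ups hps h p hp; have [[i hx] dp tp] := hps p hp.
case: (eqVneq l' l) => [e|ne]; last first.
  case: (boolP (l <= l')%O) => [le|nle]; last first.
    by rewrite (std_one_eq0 (t := p.2) _ tp) ?dp //; exact: ss0.
  move: (m p); apply: std_gen => a n; rewrite -(ind_unit_e0 eE) gm_actA; apply: Bs_act.
  apply: Bs_mull; first exact: nge_lower.
  apply/JlP/e_J; rewrite /nge /=; apply: contra ne => h'.
  by rewrite eq_le h' le.
rewrite e in h hps dp *.
pose n q := ind_counit (m q) : N.
have mE q : q \in ps -> m q = ind_unit (n q).
  by move=> /hps[_ dq tq]; rewrite (ind_unitK eE) (e0_act_one dq tq).
have h0 : \sum_(q <- ps) q.1 |> m q = 0.
  suff J0 : forall u : I, imod J I u -> u = 0 by apply/J0/imodP.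
  apply: (@imod_min _ _ _ _ (zero_ss I)) => a x ha; exact: shriek_killed.
have [F lF FE] := shriek_coeff p.1.
suff mp0 : m p = 0 by rewrite mp0; exact: ss0.
have e1 : \sum_(q <- ps) (if q.1 == p.1 then kap (one q.2) |> n q else 0) = 0.
  have := congr1 F h0; rewrite (lin0 lF) (lin_sum _ _ _ lF) => h1.
  rewrite -[RHS]h1 big_seq [RHS]big_seq; apply: eq_bigr => q hq.
  have [[j hxq] dq _] := hps q hq.
  by rewrite (mE q hq) (FE _ _ _ _ hxq dq).
have kk t t' : dot t = l -> kap (one t) ** kap (one t') = if t == t' then kap (one t) else 0.
  move=> dt; rewrite -(kapM eE) one_e dt eqxx la_orth (inj_eq val_inj).
  by case: eqP => // _; exact: lin0 (@kap_lin _ _ J eb).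
have := congr1 (fun v => kap (one p.2) |> v) e1.
rewrite (lin0 (gm_actLr _)) (lin_sum _ _ _ (gm_actLr _)) (bigD1_seq p) //= eqxx.
rewrite gm_actA kk // eqxx big_seq_cond big1 => [|q /andP[hq nq]]; last first.
  case: eqP => eq1; last exact: lin0 (gm_actLr _).
  rewrite gm_actA kk //; case: eqP => [eq2|_]; last exact: lin0 (gm_actLl _).
  by case/eqP: nq; rewrite [LHS]surjective_pairing [RHS]surjective_pairing eq1 eq2.
rewrite addr0 => e2.
have : ind_unit (kap (one p.2) |> n p) = 0 by rewrite e2; exact: lin0 (@ind_unit_lin _ _ J eb N).
by rewrite (ind_unit_act eE) -(mE p hp) tp (e0_act_one dp tp).
Qed.
End Std.
End TorFree.

(** * Coinduction preserves surjections *)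

Section Coinduction.
Context (k : fieldType) (A : lualg k) (disp : Order.disp_t) (Lam : porderType disp).
Context (T : triangular_basis A Lam) (l : Lam).
Local Notation S := (set_type (tb_S T)).
Implicit Types (s t : S).
Local Notation dot := (@tb_dot _ _ _ _ T).
Local Notation one s := (la_one A (val s)).
Local Notation Bs := (Bs T).
Local Notation nge := (@nge _ Lam).
Local Notation J := (Jl T l).
Local Notation eb := (ebar T l).
Local Notation e0 := (tb_e T l).
Local Notation kap := (@kap _ _ J eb).
Let e0K := tb_eK T l.
Let eE : id_elt eb = quo_proj J e0 := erefl.
Let low := @nge_lower _ Lam l.

Let kap_lin := @kap_lin _ _ J eb.

Let kB a : Bs (nge l) a -> kap a = 0.
Proof. by move=> h; apply: kap_J; exact/JlP. Qed.

Lemma e0_X i s x : tb_X i s x ->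
  e0 ** x = 0 \/ exists s', [/\ i = val s', dot s' = l & e0 ** x = x].
Proof.
move=> hx; have [ss [us sd eS]] := e_sum T l.
case: (pselect (exists2 s', s' \in ss & i = val s')) => [[s' ss' e]|n]; [right|left].
  move: ss'; rewrite sd => /eqP d; exists s'; split=> //.
  by rewrite -(X_l hx) e la_mulA e_one d eqxx.
rewrite eS mulA_suml big_seq big1 // => s' hs'; rewrite -(X_l hx) la_mulA la_orth.
by case: eqP => [e|]; [case: n; exists s' | rewrite mul0A].
Qed.

Lemma Bs_xh i s t x h : tb_X i s x -> tb_H s t h -> ~~ (l <= dot t)%O ->
  Bs (nge l) (x ** h).
Proof.
move=> hx hh nl; have -> : x ** h = x ** h ** one t ** one t.
  by rewrite -!la_mulA la_orth eqxx (H_r hh).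
exact: Bs_ideal.
Qed.

Section Lift.
Context (E E' : gmod (alg_at T l)) (g : E -> E') (hg : hom0 g) (sg : surj g).
Context (i : la_idx A) (d : int) (phi : A -> E').
Hypotheses (phi_lin : linear phi)
  (phi_kap : forall b a, phi (b ** e0 ** a) = kap b |> phi a)
  (phi_J : forall a, Bs (nge l) a -> phi a = 0)
  (phi_deg : forall n a, la_deg A n a -> gm_deg E' (n + d) (phi a))
  (phi_i : forall j a, j != i -> phi (a ** la_one A j) = 0).

Let phi_e0 a : phi (e0 ** a) = phi a.
Proof. by rewrite -{1}e0K phi_kap (kap_e0 eE) corner_act1. Qed.

Let lift_ex y : exists v, [/\ g v = phi y,
  forall n, la_deg A n y -> gm_deg E (n + d) v & phi y = 0 -> v = 0].
Proof.
case: (eqVneq (phi y) 0) => [->|ne].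
  by exists 0; split=> //; [exact: (hom0_0 hg) | move=> n _; exact: ss0].
have [v vE] := sg (phi y).
case: (pselect (exists n, la_deg A n y)) => [[n hn]|nh]; last first.
  by exists v; split=> // [n hn|e]; [case: nh; exists n | rewrite e eqxx in ne].
exists (gr_pr (gm_graded E) (n + d) v); split=> [|m hm|e].
- by rewrite (hom0_pr hg) vE gr_pr_id //; exact: phi_deg.
- case: (eqVneq n m) => [<-|nm]; first exact: gr_prP.
  case/eqP: ne; rewrite -(gr_pr_id (la_graded A) hm) (gr_pr_ne _ nm hn).
  exact: lin0.
- by rewrite e eqxx in ne.
Qed.
Let ey y := projT1 (cid (lift_ex y)).
Let eyE y : g (ey y) = phi y. Proof. by rewrite /ey; case: cid => v /= []. Qed.
Let eyd y n : la_deg A n y -> gm_deg E (n + d) (ey y).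
Proof. by rewrite /ey; case: cid => v /= [_ h _]; exact: h. Qed.
Let ey0 y : phi y = 0 -> ey y = 0. Proof. by rewrite /ey; case: cid => v /= []. Qed.

(** A map [e A 1_i -> E'] over the corner algebra lifts along a surjection [E -> E'],
    because [e A_{>=l} 1_i] is free over the corner algebra on the [y] of weight [l]. *)
Lemma coind_lift : exists psi : A -> E, [/\ linear psi,
  forall b a, psi (b ** e0 ** a) = kap b |> psi a, forall a, Bs (nge l) a -> psi a = 0 &
  [/\ forall n a, la_deg A n a -> gm_deg E (n + d) (psi a),
      forall j a, j != i -> psi (a ** la_one A j) = 0 & forall a, g (psi a) = phi a]].
Proof.
have [F lF FE] := basis_ext (tb_basis T) (fun p => kap (p.1.1 ** p.1.2) |> ey p.2).
have {}FE i' s t j x h y : @tb_X _ _ _ _ T i' s x -> tb_H s t h -> tb_Y t j y ->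
    F (x ** h ** y) = kap (x ** h) |> ey y.
  by move=> hx hh hy; exact: (FE _ (basis_mem hx hh hy)).
have FJ a : Bs (nge l) a -> F a = 0.
  apply: (@span_map _ _ _ F _ (zero_ss E) lF).
  move=> _ [i' [s [t [j [x [h [y [hx hh hy hn ->]]]]]]]] /=.
  rewrite /set1 /mkset (FE _ _ _ _ _ _ _ hx hh hy) kB ?(lin0 (gm_actLl _)) //.
  exact: Bs_xh hx hh hn.
(* [F (x h y)] was prescribed as [kap (x h) ey(y)]; the same then holds for all [c y] *)
have Fy t j c y : dot t = l -> c ** one t = c -> tb_Y t j y -> F (c ** y) = kap c |> ey y.
  move=> dt ct hy; apply/eqP; rewrite -subr_eq0; apply/eqP.
  have l1 : linear (fun c => F (c ** y) - kap c |> ey y).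
    by apply: lin_eq_ss => a u v; rewrite ?la_mulLl ?lF ?kap_lin ?gm_actLl.
  apply: (right_map (T := T) (W := zero_ss E) l1 ct).
  - move=> i' s x h hx hh; rewrite /= /set1 /mkset.
    by rewrite (FE _ _ _ _ _ _ _ hx hh hy) subrr.
  - move=> i' s s' x h y' hx hh hy' lt; rewrite /= /set1 /mkset.
    have hb : Bs (nge l) (x ** h ** y').
      by apply: (Bs_nge hx hh hy'); rewrite (H_dot hh) -dt.
    by rewrite (kB hb) (lin0 (gm_actLl _)) (FJ _ (Bs_mulr low _ hb)) subrr.
have ind (W : lmodType k) (f : A -> W) : linear f ->
    (forall i' s t j x h y, @tb_X _ _ _ _ T i' s x -> tb_H s t h -> tb_Y t j y ->
      f (x ** h ** y) = 0) -> forall a, f a = 0.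
  move=> lf hf a; apply: (span_map (S := zero_ss W) lf _ (Bs_all T a)).
  by move=> _ [i' [s [t [j [x [h [y [hx hh hy _ ->]]]]]]]]; exact: hf hx hh hy.
have Fkap b a : F (b ** e0 ** a) = kap b |> F a.
  apply/eqP; rewrite -subr_eq0; apply/eqP.
  have l1 : linear (fun a => F (b ** e0 ** a) - kap b |> F a).
    by apply: lin_eq_ss => c u v; rewrite ?la_mulLr ?lF ?gm_actLr.
  apply: (ind _ _ l1) => i' s t j x h y hx hh hy.
  rewrite (FE _ _ _ _ _ _ _ hx hh hy); case: (e0_X hx) => [ex|[s' [ei ds ex]]].
    have -> : b ** e0 ** (x ** h ** y) = 0 by rewrite !la_mulA -(la_mulA b) ex mulA0 !mul0A.
    rewrite -(kap_el eE (x ** h)) la_mulA ex mul0A (lin0 kap_lin) (lin0 (gm_actLl _)).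
    by rewrite (lin0 (gm_actLr _)) (lin0 lF) subrr.
  move: hx; rewrite ei => hx; case: (X_dot hx) => [[es xe]|lt].
    have dt : dot t = l by rewrite -(H_dot hh) -es.
    have -> : x ** h = h by rewrite xe es (H_l hh).
    rewrite la_mulA (Fy _ _ _ _ dt _ hy); last by rewrite -la_mulA (H_r hh).
    by rewrite (kapM eE) gm_actA subrr.
  have nl : ~~ (l <= dot t)%O by rewrite -(H_dot hh) -ds; exact: nge_lt.
  have hb := Bs_xh hx hh nl.
  rewrite (kB hb) (lin0 (gm_actLl _)) (lin0 (gm_actLr _)) FJ ?subrr //.
  by apply: Bs_mull => //; exact: Bs_mulr.
exists F; split=> //; split.
- move=> n a ha; rewrite -(gr_pr_id (la_graded A) ha).
  have l1 : linear (fun a => F (gr_pr (la_graded A) n a)) by move=> c u v; rewrite gr_pr_lin lF.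
  apply: (span_map l1 _ (Bs_all T a)).
  move=> _ [i' [s [t [j [x [h [y [hx hh hy _ ->]]]]]]]].
  have [[p px] _ _] := tb_X_hom hx; have [[q qh] _ _] := tb_H_hom hh.
  have [[r ry] _ _] := tb_Y_hom hy.
  have hd : la_deg A (p + q + r) (x ** h ** y) by do 2! apply: la_degM => //.
  case: (eqVneq (p + q + r) n) => [e|ne]; last first.
    by rewrite (gr_pr_ne _ ne hd) (lin0 lF); exact: ss0.
  rewrite gr_pr_id -?e // (FE _ _ _ _ _ _ _ hx hh hy) -addrA.
  by apply: gm_degM; [apply: kap_deg; exact: la_degM | exact: eyd].
- move=> j a ne.
  have l1 : linear (fun a => F (a ** la_one A j)) by move=> c u v; rewrite la_mulLl lF.
  apply: (ind _ _ l1) => i' s t j' x h y hx hh hy.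
  rewrite -(Y_r hy) -!la_mulA la_orth; case: eqP => [e|_]; last by rewrite !mulA0 (lin0 lF).
  rewrite (Y_r hy) la_mulA (FE _ _ _ _ _ _ _ hx hh hy) ey0 ?(lin0 (gm_actLr _)) //.
  by rewrite -(Y_r hy) e phi_i.
- move=> a; apply/eqP; rewrite -subr_eq0; apply/eqP.
  have l1 : linear (fun a => g (F a) - phi a).
    by apply: lin_eq_ss => // c u v; rewrite lF (hom0_lin hg).
  apply: (ind _ _ l1) => i' s t j x h y hx hh hy.
  rewrite (FE _ _ _ _ _ _ _ hx hh hy) (hom0_act hg) eyE.
  case: (boolP (l <= dot t)%O) => [lt|nl]; last first.
    have hb := Bs_xh hx hh nl.
    by rewrite (kB hb) (lin0 (gm_actLl _)) (phi_J (Bs_mulr low _ hb)) subrr.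
  case: (e0_X hx) => [ex|[s' [ei ds ex]]].
    rewrite -(kap_el eE (x ** h)) la_mulA ex mul0A (lin0 kap_lin) (lin0 (gm_actLl _)).
    by rewrite -[phi _]phi_e0 !la_mulA ex !mul0A (lin0 phi_lin) subrr.
  move: hx; rewrite ei => hx; case: (X_dot hx) => [[es xe]|lt']; last first.
    by have := le_lt_trans lt (y := dot t); rewrite -(H_dot hh) in lt *;
      have := le_lt_trans lt lt'; rewrite ds ltxx.
  have dt : dot t = l by rewrite -(H_dot hh) -es.
  rewrite -phi_kap; have -> : x ** h ** e0 ** y = x ** h ** y.
    by rewrite -(la_mulA _ e0) -(Y_l hy) (la_mulA e0) e_one dt eqxx.
  by rewrite subrr.
Qed.
End Lift.

Local Notation mumap := (@mumap _ _ J e0 eb).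

(** Coinduction preserves surjections; hence maps from a projective module into
    coinduced modules lift. *)
Lemma projective_mumap_lift (P : gmod A) (E E' : gmod (alg_at T l)) (g : E -> E') (phi : P -> E') :
  projective_gmod P -> hom0 g -> surj g -> mumap phi ->
  exists2 psi : P -> E, mumap psi & forall x, g (psi x) = phi x.
Proof.
move=> hP hg sg hphi.
have [f hf fE] := star_up e0K eE hphi.
pose h (F : j_star T E) : sub_lmod (eC eb) -> E' := fun x => g (sub_val F x).
have co_comp i n F : @co_hom _ _ eb E i n F ->
    @co_hom _ _ eb E' i n (fun x => g (F x)).
  move=> [h1 h2 h3 h4]; split.
  - by move=> c x y; rewrite h1 (hom0_lin hg).
  - by move=> a x; rewrite h2 (hom0_act hg).
  - by move=> p x hx; apply: (hom0_deg hg); exact: h3.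
  - by move=> j x ne; rewrite h4 // (hom0_0 hg).
have cl : linear (fun F : sub_lmod (eC eb) -> E => (fun x => g (F x)) : _ -> E').
  by move=> c F F'; apply/funext => x; exact: (hom0_lin hg).
have hin (F : j_star T E) : @co_ss _ _ eb E' (h F).
  apply: (span_map cl _ (sub_valP F)) => F' [i [n hF]].
  by apply: span_sub; exists i, n; exact: co_comp.
pose sg' (F : j_star T E) : j_star T E' := ssub (hin F).
have hsg : hom0 sg'.
  split=> [c F F'|a F|n F hF].
  - by apply: sub_val_inj; apply/funext => x; exact: (hom0_lin hg).
  - exact: sub_val_inj.
  - apply: (span_map cl _ hF) => F' [i hF']; apply: span_sub; exists i; exact: co_comp.
have ssg : surj sg'.
  pose I := im_ss (hom0_lin hsg) (full_ss (j_star T E)).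
  suff h0 F : I F by move=> F; have [G _ <-] := h0 F; exists G.
  have : exists2 G, @co_ss _ _ eb E G & (fun x => g (G x)) = sub_val F.
    have := sub_valP F; apply: (@span_min _ _ _ (im_ss cl (@co_ss _ _ eb E))).
    move=> {F}F [i [d hF]]; have [F1 F2 F3 F4] := hF.
    pose phi0 (a : A) := F (eC_ract (eC_one eb) (quo_proj J a)).
    have [psi [p1 p2 p3 [p4 p5 p6]]] : exists psi : A -> E, [/\ linear psi,
      forall b a, psi (b ** e0 ** a) = kap b |> psi a, forall a, Bs (nge l) a -> psi a = 0 &
      [/\ forall n a, la_deg A n a -> gm_deg E (n + d) (psi a),
      forall j a, j != i -> psi (a ** la_one A j) = 0 & forall a, g (psi a) = phi0 a]].
      apply: (coind_lift (phi := phi0) hg sg).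
      - by move=> c u v; rewrite /phi0 quo_projL eC_ractLr F1.
      - move=> b a; rewrite /phi0 -F2 !quo_projM -!eC_ractA.
        by rewrite -eE eC_ract_one eC_lractA.
      - move=> a /JlP/quo_proj_eq0 ha.
        by rewrite /phi0 ha (lin0 (eC_ractLr _)) (lin0 F1).
      - move=> n a ha; apply: F3; rewrite -[n]add0r; apply: la_degM; first exact: idem_deg.
        by exists a.
      - by move=> j a ne; rewrite /phi0 quo_projM -eC_ractA F4.
    have psieq a b : quo_proj J a = quo_proj J b -> psi a = psi b.
      move=> /quo_proj_eq/JlP e; apply/eqP; rewrite -subr_eq0 -(linB _ _ p1).
      exact/eqP/p3.
    pose G (x : sub_lmod (eC eb)) := psi (qrepr (sub_val x)).
    exists G; last first.
      apply/funext => x; rewrite /G p6 /phi0 quo_projK.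
      by rewrite eC_ract_oneE.
    apply: span_sub; exists i, d; split.
    - move=> c x y; rewrite /G -p1; apply: psieq.
      by rewrite quo_projL !quo_projK.
    - move=> c x; rewrite /G -[in RHS](kap_surj c) -p2; apply: psieq.
      by rewrite !quo_projM !quo_projK -eE corner_er.
    - move=> n x [a ha aE]; rewrite /G (psieq _ a); first exact: p4.
      by rewrite quo_projK.
    - move=> j x ne; rewrite /G (psieq _ (qrepr (sub_val x) ** la_one A j)); first exact: p5.
      by rewrite quo_projM !quo_projK.
  move=> [G hG e]; exists (ssub hG) => //; exact: sub_val_inj.
have [f' hf' fE'] := projP hP hsg ssg hf.
exists (fun x => evs (f' x)); first exact: comp_mumap hf' (evs_mumap eE E).
by move=> x; rewrite -fE -fE'.
Qed.
End Coinduction.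

(** * Vanishing of the first extensions *)

Section Weights.
Context (k : fieldType) (A : lualg k) (disp : Order.disp_t) (Lam : porderType disp).
Context (T : triangular_basis A Lam).
Implicit Types (l m : Lam) (M N P V X U : gmod A).

Lemma ebarE l : id_elt (ebar T l) = quo_proj (Jl T l) (tb_e T l). Proof. by []. Qed.

Definition topw l V : gmod (alg_at T l) := @top _ _ (Jl T l) _ (tb_e_deg T l) (ebar T l) erefl V.
Definition univw l X : gmod (alg_at T l) := @univ _ _ (Jl T l) _ (tb_e_deg T l) (ebar T l) erefl X.
Definition gamw l X (x : X) : univw l X :=
  @gam _ _ (Jl T l) _ (tb_eK T l) (tb_e_deg T l) (ebar T l) erefl X x.
Definition wmap l M (W : gmod (alg_at T l)) (phi : M -> W) :=
  @mumap _ _ (Jl T l) (tb_e T l) (ebar T l) M W phi.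
Definition evw l (W : gmod (alg_at T l)) (g : j_star T W) : W :=
  @evs _ _ (Jl T l) (ebar T l) W g.

Lemma gamw_wmap l X : wmap (@gamw l X).
Proof. exact: gam_mumap. Qed.
Lemma gamw_surj l X (z : univw l X) : exists x, gamw l x = z.
Proof. exact: gam_surj. Qed.
Lemma gamw_eq0 l X (x : X) : gamw l x = 0 <-> imod (Jl T l) X (tb_e T l |> x).
Proof. exact: gam_eq0. Qed.
Lemma gamw_factor l X (W : gmod (alg_at T l)) (phi : X -> W) : wmap phi ->
  exists2 g : univw l X -> W, hom0 g & forall x, g (gamw l x) = phi x.
Proof. exact: gam_factor. Qed.

Lemma evw_wmap l (W : gmod (alg_at T l)) M (f : M -> j_star T W) : hom0 f ->
  wmap (fun x => evw (f x)).
Proof. by move=> hf; apply: comp_mumap hf _; exact: evs_mumap. Qed.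

Lemma wmap_star l (W : gmod (alg_at T l)) M (phi : M -> W) : wmap phi ->
  exists2 f : M -> j_star T W, hom0 f & forall x, evw (f x) = phi x.
Proof. by apply: star_up => //; exact: tb_eK. Qed.

Lemma star_ext l (W : gmod (alg_at T l)) M (f g : M -> j_star T W) : hom0 f -> hom0 g ->
  (forall x, evw (f x) = evw (g x)) -> f =1 g.
Proof.
move=> hf hg h x; apply/eqP; rewrite -subr_eq0; apply/eqP.
apply: (@star_eq0 _ _ (Jl T l) (ebar T l)) => a.
have -> : a |> (f x - g x) = f (a |> x) - g (a |> x).
  by rewrite (hom0_act hf) (hom0_act hg) (linB _ _ (gm_actLr a)).
by have := h (a |> x) => /eqP; rewrite -subr_eq0 => /eqP.
Qed.

Section UnivSes.
Context (U X M : gmod A) (u : U -> X) (p : X -> M) (hs : ses u p) (l : Lam).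

(** Right exactness is formal; the injectivity of the first map is [Jm_exact]. *)
Lemma univ_ses : tor_free T M -> exists (gu : univw l U -> univw l X)
    (gp : univw l X -> univw l M),
  [/\ ses gu gp, forall y, gu (gamw l y) = gamw l (u y) &
      forall x, gp (gamw l x) = gamw l (p x)].
Proof.
move=> hM; have [hu hp iu sp exp] := hs.
have [gu hgu guE] := gamw_factor (comp_mumap hu (gamw_wmap l X)).
have [gp hgp gpE] := gamw_factor (comp_mumap hp (gamw_wmap l M)).
exists gu, gp; split=> //; split=> //.
- apply: hom0_inj => // z; have [y <-] := gamw_surj z.
  rewrite guE => /gamw_eq0; rewrite -(hom0_act hu) => /imodP h.
  by apply/gamw_eq0/imodP; exact: Jm_exact hs hM _ _ h.
- move=> z; have [x <-] := gamw_surj z; have [w <-] := sp x.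
  by exists (gamw l w).
move=> z; split=> [|[y <-]]; last first.
  have [w <-] := gamw_surj y; rewrite guE gpE.
  have -> : p (u w) = 0 by apply/exp; exists w.
  exact: mumap_0 (gamw_wmap l M).
have [x <-] := gamw_surj z; rewrite gpE => /gamw_eq0; rewrite -(hom0_act hp) => h.
have [x' hx' e] := imod_lift hp sp h.
have /exp[y yE] : p (tb_e T l |> x - x') = 0 by rewrite (hom0B _ _ hp) e subrr.
exists (gamw l y); rewrite guE yE (mumapB (gamw_wmap l X)).
rewrite (mumap_imod (gamw_wmap l X) hx') subr0.
by rewrite (mumap_e0 (tb_eK T l) (ebarE l) (gamw_wmap l X)).
Qed.
End UnivSes.

(** By the universal property of [univw l M] this says that these modules are projective.
    For a Tor-free [M] they are the layers of a standard filtration. *)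
Definition has_lifts M := forall l (E E' : gmod (alg_at T l)) (g : E -> E') (phi : M -> E'),
  hom0 g -> surj g -> wmap phi -> exists2 psi : M -> E, wmap psi & forall x, g (psi x) = phi x.

(** The vanishing of [Ext^1] against coinduced modules: extending a map from [U] to [X]
    amounts to extending it from [univw l U] to [univw l X], and either the target is
    injective or the quotient of the two is projective. *)
Lemma ext1z_star M l (W : gmod (alg_at T l)) : tor_free T M ->
  injective_gmod W \/ has_lifts M -> ext1z M (j_star T W).
Proof.
move=> hM hor U X u p f hs hf; have [hu hp iu sp exp] := hs.
have hphi := evw_wmap hf.
have [phi' hphi' phiE] := gamw_factor hphi.
have [gu [gp [hgs guE gpE]]] := univ_ses hs l hM.
have [hgu hgp igu sgp exgp] := hgs.
suff [psi hpsi psiE] : exists2 psi : X -> W, wmap psi & forall y, psi (u y) = evw (f y).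
  have [g hg gE] := wmap_star hpsi; exists g => //.
  apply: star_ext => //; first exact: hom0_comp.
  by move=> y; rewrite gE psiE.
case: hor => [hW|hl].
  have [psi hpsi psiE] := injP hW hgu igu hphi'.
  exists (fun x => psi (gamw l x)); first exact: mumap_comp (gamw_wmap l X) hpsi.
  by move=> y; rewrite -guE psiE phiE.
have [s hs' sE] := hl _ _ _ _ _ hgp sgp (gamw_wmap l M).
have hd := mumap_diff (gamw_wmap l X) (comp_mumap hp hs').
have [r hr rE] : exists2 r : X -> univw l U, wmap r &
    forall x, gu (r x) = gamw l x - s (p x).
  apply: mumap_factor_inj => // x; apply/exgp.
  by rewrite (hom0B _ _ hgp) gpE sE subrr.
exists (fun x => phi' (r x)); first exact: mumap_comp hr hphi'.
move=> y; rewrite -phiE; congr phi'; apply: igu; rewrite rE guE.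
have -> : p (u y) = 0 by apply/exp; exists y.
by rewrite (mumap_0 hs') subr0.
Qed.

Lemma projective_lifts P : projective_gmod P -> has_lifts P.
Proof. by move=> hP l E E' g phi; exact: projective_mumap_lift. Qed.

(** By the vanishing of [Ext^1(M, -)] a map from [U] into a coinduced module extends to [P],
    where it can be lifted. *)
Lemma lifts_ker U P M (u : U -> P) (p : P -> M) : ses u p -> tor_free T M ->
  has_lifts M -> has_lifts P -> has_lifts U.
Proof.
move=> hs tM lM lP l E E' g phi hg sg hphi; have [hu _ _ _ _] := hs.
have [f hf fE] := wmap_star hphi.
have [f' hf' fE'] := ext1z_star tM (or_intror lM) hs hf.
have [psi hpsi psiE] := lP _ _ _ _ _ hg sg (evw_wmap hf').
exists (fun y => psi (u y)); first exact: comp_mumap hu hpsi.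
by move=> y; rewrite psiE fE' fE.
Qed.

Lemma lifts_iso M N (f : M -> N) : hom0 f -> bijective f -> has_lifts M -> has_lifts N.
Proof.
move=> hf bf hM l E E' g phi hg sg hphi; have [f' [hf' fK f'K]] := hom0_inverse hf bf.
have [psi hpsi psiE] := hM _ _ _ _ _ hg sg (comp_mumap hf hphi).
exists (fun x => psi (f' x)); first exact: comp_mumap hf' hpsi.
by move=> x; rewrite psiE f'K.
Qed.

Section StdW.
Context (l : Lam) (N : gmod (alg_at T l)).
Local Notation I := (j_shriek T N).
Local Notation iotaw := (@ind_unit _ _ (Jl T l) (ebar T l) N).
Local Notation rhow := (@ind_counit _ _ (Jl T l) (ebar T l) N).

(** Distinct weights do not interact: [e_m] kills the induced module, or [e_l], which
    generates it, kills the coinduced one. *)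
Lemma std_wmap0 m (W : gmod (alg_at T m)) (phi : I -> W) : wmap phi -> m != l ->
  forall v, phi v = 0.
Proof.
move=> hphi ne v; case: (boolP (l <= m)%O) => [le|nle]; last first.
  rewrite -(mumap_e0 (tb_eK T m) (ebarE m) hphi).
  rewrite (shriek_killed (J := Jl T l)); last exact: e_J.
  exact: mumap_0 hphi.
apply: (@shriek_ind _ _ (Jl T l) (ebar T l) N (pre_ss (mumap_lin hphi) (zero_ss W))) => a n.
change (phi (a |> iotaw n) = 0); rewrite -(ind_unit_e0 (ebarE l)) gm_actA.
have [_ _ h0 _] := hphi; apply: h0; apply: gi_mull; apply: e_J.
by rewrite /nge /=; apply: contra ne => le'; rewrite eq_le le le'.
Qed.

Lemma std_wmap_iota (W : gmod (alg_at T l)) (phi : I -> W) : wmap phi ->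
  hom0 (fun n => phi (iotaw n)).
Proof.
move=> hphi; split=> [c u v|a n|d n hn].
- by rewrite ind_unit_lin (mumap_lin hphi).
- rewrite -[a](kap_surj (J := Jl T l)) (ind_unit_act (ebarE l)).
  rewrite (mumap_e0 (tb_eK T l) (ebarE l) hphi).
  by rewrite -[in LHS](ind_unit_e0 (ebarE l)) (mumap_kap hphi).
- by case: hphi => _ _ _ h; apply: h; exact: ind_unit_deg.
Qed.

(** A [wmap] from an induced module is determined by its restriction to [N]. *)
Lemma std_lifts : projective_gmod N -> has_lifts I.
Proof.
move=> hN m E E' g phi hg sg hphi; case: (eqVneq m l) => [e|ne]; last first.
  exists (fun _ => 0) => [|x]; last by rewrite (hom0_0 hg) (std_wmap0 hphi).
  split=> [c u v|a x|a x _|n x _]; rewrite ?scaler0 ?addr0 //.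
    by rewrite (lin0 (gm_actLr _)).
  exact: ss0.
subst m; have [psi hpsi psiE] := projP hN hg sg (std_wmap_iota hphi).
have hr : wmap rhow by exact: (ind_counit_mumap (ebarE l)).
exists (fun x => psi (rhow x)); first exact: mumap_comp hr hpsi.
move=> x; rewrite psiE (ind_unitK (ebarE l)).
exact: (mumap_e0 (tb_eK T l) (ebarE l) hphi).
Qed.

(** The identity map, since the tensor product does not see the grading. *)
Lemma shift_std d : exists2 f : shift d I -> j_shriek T (shift d N), hom0 f & bijective f.
Proof.
exists (fun x => x); last by exists (fun x => x).
split=> // n x; apply: span_mono => _ [p [q [y [v [e hy hv ->]]]]].
exists p, (q + d), y, v; split=> //; first by rewrite addrA -e subrK.
by rewrite /= addrK.
Qed.

End StdW.
End Weights.

(** * Finiteness conditions *)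

Section FinDim.
Context (k : fieldType) (V : lmodType k).
Implicit Types (S : subspace V) (ls : seq V).

Lemma span_cons v ls t : span [set` v :: ls] t ->
  exists (c : k) (u : V), span [set` ls] u /\ t = c *: v + u.
Proof.
pose Q (t : V) := exists (c : k) (u : V), span [set` ls] u /\ t = c *: v + u.
have Q0 : Q 0 by exists 0, 0; split; [exact: ss0 | rewrite scale0r addr0].
have QL (c : k) x y : Q x -> Q y -> Q (c *: x + y).
  move=> [a [u [hu ->]]] [b [w [hw ->]]]; exists (c * a + b), (c *: u + w); split.
    exact: ssL.
  by rewrite scalerDr scalerA scalerDl addrACA.
apply: (@span_min _ _ _ (Subspace Q0 QL)) => x /=; rewrite inE => /orP[/eqP ->|h].
  by exists 1, 0; split; [exact: ss0 | rewrite scale1r addr0].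
by exists 0, x; split; [exact: span_sub | rewrite scale0r add0r].
Qed.

Lemma span_consW v ls t : span [set` ls] t -> span [set` v :: ls] t.
Proof. by apply: span_mono => x /= h; rewrite inE h orbT. Qed.

Lemma span_cons_head v ls : span [set` v :: ls] v.
Proof. by apply: span_sub; rewrite /= inE eqxx. Qed.

Lemma span_elim S v ls : ~ (forall t, S t -> span [set` v :: ls] t -> span [set` ls] t) ->
  exists s, [/\ S s, span [set` v :: ls] s &
    forall t, span [set` v :: ls] t -> exists (c : k), span [set` ls] (t - c *: s)].
Proof.
move=> /existsNP[s /not_implyP[hs /not_implyP[h1 h2]]]; exists s; split=> // t ht.
have [c [u [hu es]]] := span_cons h1; have [d [w [hw et]]] := span_cons ht.
have c0 : c != 0.
  by apply: contra_notN h2 => /eqP e; rewrite es e scale0r add0r.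
exists (d / c); rewrite et es scalerDr scalerA divfK // opprD addrACA subrr add0r.
by apply: ssB => //; exact: ssZ.
Qed.

Lemma span_sub_fin S ls : exists ls', (forall x, x \in ls' -> S x) /\
  forall t, S t -> span [set` ls] t -> span [set` ls'] t.
Proof.
elim: ls => [|v ls [ls' [h1 h2]]]; first by exists [::].
case: (pselect (forall t, S t -> span [set` v :: ls] t -> span [set` ls] t)) => [h|].
  by exists ls'; split=> // t hS ht; apply: h2 => //; exact: h.
move=> /span_elim[s [hs _ hc]]; exists (s :: ls'); split=> [x|t hS ht].
  by rewrite inE => /orP[/eqP ->|/h1].
have [c hct] := hc t ht; rewrite -(subrK (c *: s) t); apply: ssD.
  by apply: span_consW; apply: h2 => //; apply: ssB => //; exact: ssZ.
by apply: ssZ; exact: span_cons_head.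
Qed.

(** The number of generators in the ambient space stands in for the dimension. *)
Lemma span_proper S ls t : (forall x, S x -> span [set` ls] x) -> span [set` ls] t -> ~ S t ->
  exists ls', (size ls' < size ls)%N /\ forall x, S x -> span [set` ls'] x.
Proof.
elim: ls S t => [|v ls ih] S t hS ht nt.
  suff e : t = 0 by case: nt; rewrite e; exact: ss0.
  by apply: (@span_min _ _ _ (zero_ss V) _ t ht).
case: (pselect (forall t, S t -> span [set` v :: ls] t -> span [set` ls] t)) => [h|].
  by exists ls; split=> // x hx; apply: h => //; exact: hS.
move=> /span_elim[s [hs h1 hc]].
pose S' := @Subspace k V [set x | S x /\ span [set` ls] x] (conj (ss0 S) (ss0 _))
  (fun c u v hu hv => conj (ssL c hu.1 hv.1) (ssL c hu.2 hv.2)).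
have [c hct] := hc t ht.
have [|//|[h2 _]|ls' [sz hls']] := ih S' (t - c *: s).
- by move=> x [].
- by apply: nt; rewrite -(subrK (c *: s) t); apply: ssD => //; exact: ssZ.
exists (s :: ls'); split=> // x hx; have [d hd] := hc x (hS x hx).
rewrite -(subrK (d *: s) x); apply: ssD; last by apply: ssZ; exact: span_cons_head.
by apply: span_consW; apply: hls'; split=> //; apply: ssB => //; exact: ssZ.
Qed.

Lemma fin_dim_sub S ls (X : set (sub_lmod S)) :
  (forall v, X v -> span [set` ls] (sub_val v)) -> fin_dim X.
Proof.
move=> hX; have [ls' [h1 h2]] := span_sub_fin S ls.
pose c (x : V) : sub_lmod S := if pselect (S x) is left hx then ssub hx else 0.
have hc x : x \in ls' -> sub_val (c x) = x by move=> /h1 hx; rewrite /c; case: pselect.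
exists (map c ls') => v /hX hv.
suff [w hw /sub_val_inj <-] : im_ss (@sub_valL k V S) (span [set` map c ls']) (sub_val v) by [].
have := h2 _ (sub_valP v) hv; apply: span_min => x hx.
by exists (c x); [apply: span_sub; exact: map_f | exact: hc].
Qed.
End FinDim.

Lemma span_map_seq (k : fieldType) (U V : lmodType k) (f : U -> V) (ls : seq U) : linear f ->
  forall x, span [set` ls] x -> span [set` map f ls] (f x).
Proof.
move=> lf; apply: (span_map lf) => x hx; apply: span_sub; exact: map_f.
Qed.

Section Bounds.
Context (k : fieldType) (A : lualg k).
Implicit Types V W : gmod A.

Lemma ba_sub V W (u : V -> W) : hom0 u -> injective u -> bounded_above W -> bounded_above V.
Proof.
move=> hu iu h i; have [N hN] := h i; exists N => d hd v vd v1.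
apply: (hom0_inj0 hu iu); apply: (hN d hd); first exact: hom0_deg vd.
by rewrite -(hom0_act hu) v1.
Qed.

Lemma surj_deg V W (q : V -> W) d (w : W) i : hom0 q -> surj q -> gm_deg W d w ->
  la_one A i |> w = w -> exists v, [/\ gm_deg V d v, la_one A i |> v = v & q v = w].
Proof.
move=> hq sq hd h1; have [v vE] := sq w.
have hp n x : gm_deg V n x -> gm_deg V (n + 0) (la_one A i |> x).
  by move=> hx; rewrite addrC; apply: gm_degM => //; exact: la_deg1.
exists (la_one A i |> gr_pr (gm_graded V) d v); split.
- by rewrite -[d]add0r; apply: gm_degM; [exact: la_deg1 | rewrite add0r; exact: gr_prP].
- by rewrite act_orth eqxx.
- by rewrite (hom0_act hq) (hom0_pr hq) vE gr_pr_id.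
Qed.

Lemma ba_quo V W (q : V -> W) : hom0 q -> surj q -> bounded_above V -> bounded_above W.
Proof.
move=> hq sq h i; have [N hN] := h i; exists N => d hd w wd w1.
have [v [vd v1 <-]] := surj_deg hq sq wd w1.
by rewrite (hN d hd v vd v1) (hom0_0 hq).
Qed.

Lemma fd_quo V W (q : V -> W) : hom0 q -> surj q -> locally_fd V -> locally_fd W.
Proof.
move=> hq sq h i d; have [ls hls] := h i d; exists (map q ls) => w [wd w1].
have [v [vd v1 <-]] := surj_deg hq sq wd w1.
by apply: span_map_seq; [exact: hom0_lin | exact: hls].
Qed.

Lemma fd_sub V (N : gsubmod V) : locally_fd V -> locally_fd (sub_gmod N).
Proof.
move=> h i d; have [ls hls] := h i d; apply: (fin_dim_sub (ls := ls)) => v [vd v1].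
by apply: hls; split=> //; have := congr1 (@sub_val _ _ _) v1.
Qed.

End Bounds.

Section TopBounds.
Context (k : fieldType) (A : lualg k) (disp : Order.disp_t) (Lam : porderType disp).
Context (T : triangular_basis A Lam) (l : Lam).

Lemma topw_ba (V : gmod A) : bounded_above V -> bounded_above (topw T l V).
Proof.
move=> h [].
have [ss [us _ eS]] := e_sum T l.
have [N hN] := choice (fun s : set_type (tb_S T) => h (val s)).
pose M := \sum_(s <- ss) `|N s|.
have eA (x : V) : tb_e T l |> x = \sum_(s <- ss) la_one A (val s) |> x.
  by rewrite eS (lin_sum _ _ _ (gm_actLl _)).
exists M => d hd v vd _; apply: sub_val_inj.
have [_ <-] := sub_valP v; rewrite eA big_seq big1 // => s hs.
apply: (hN s d).
- apply: le_lt_trans hd; apply: (le_trans (ler_norm _)); rewrite /M (bigD1_seq s) //=.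
  by rewrite lerDl; apply: sumr_ge0.
- by rewrite -[d]add0r; apply: gm_degM; [exact: la_deg1 |].
- by rewrite act_orth eqxx.
Qed.

Lemma topw_fd (V : gmod A) : locally_fd V -> locally_fd (topw T l V).
Proof.
move=> h [] d.
have [ss [us _ eS]] := e_sum T l.
have eA (x : V) : tb_e T l |> x = \sum_(s <- ss) la_one A (val s) |> x.
  by rewrite eS (lin_sum _ _ _ (gm_actLl _)).
have [f hf] := choice (fun s : set_type (tb_S T) => h (val s) d).
apply: (fin_dim_sub (ls := flatten [seq f s | s <- ss])) => v [vd _].
have [_ <-] := sub_valP v; rewrite eA; apply: ss_sum_seq => s hs.
have : span [set` f s] (la_one A (val s) |> sub_val v).
  apply: hf; split; last by rewrite act_orth eqxx.
  by rewrite -[d]add0r; apply: gm_degM; [exact: la_deg1 |].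
by apply: span_mono => x /= hx; apply/flatten_mapP; exists s.
Qed.

(** A map of degree [d] from [e A 1_i] to [W] is zero when [d] exceeds the difference of
    the upper bound of [W] and the lower bound of [e A 1_i]. *)
Lemma star_ba (A_bb : alg_bounded_below A) (W : gmod (alg_at T l)) : bounded_above W ->
  bounded_above (j_star T W).
Proof.
move=> h i; have [N hN] := h tt.
have [ss [us _ eS]] := e_sum T l.
have [M hM] := choice (fun s : set_type (tb_S T) => A_bb (val s) i).
pose M0 := \sum_(s <- ss) `|M s|.
exists (N + M0) => d hd g gd g1; apply: (@star_eq0 _ _ (Jl T l) (ebar T l)) => a.
rewrite -g1 gm_actA.
have lin1 : linear (fun a => evw (a ** la_one A i |> g)).
  by move=> c u v; rewrite la_mulLl gm_actLl.
apply: (gr_span_map (S := zero_ss W) (la_graded A) lin1) => n {}a ha.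
change (evw (a ** la_one A i |> g) = 0).
have hm : wmap (@evw _ _ _ _ T l W) := evw_wmap (hom0_id (j_star T W)).
rewrite -(mumap_e0 (tb_eK T l) (ebarE T l) hm) gm_actA.
have [Nn|nN] := ltP N (n + d).
  apply: (hN _ Nn); last exact: corner_act1.
  have [_ _ _ dg] := hm; apply: dg; rewrite -[n]add0r -addrA; rewrite -gm_actA.
  apply: gm_degM; first exact: tb_e_deg.
  by rewrite -[n]addr0; apply: gm_degM => //; apply: la_degM => //; exact: la_deg1.
have -> : tb_e T l ** (a ** la_one A i) = 0; last by rewrite (lin0 (gm_actLl _)).
rewrite eS mulA_suml big_seq big1 // => s hs; apply: (hM s n).
- have hMs : `|M s| <= M0 by rewrite /M0 (bigD1_seq s) //= lerDl sumr_ge0.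
  have := ler_norm (- M s); rewrite normrN; lia.
- rewrite -[n]add0r; apply: la_degM; first exact: la_deg1.
  by rewrite -[n]addr0; apply: la_degM => //; exact: la_deg1.
- by rewrite la_mulA la_orth eqxx.
- by rewrite -!la_mulA la_orth eqxx.
Qed.
End TopBounds.

(** * The homological criterion, for a general family of test modules *)

Section Criterion.
Context (k : fieldType) (A : lualg k) (disp : Order.disp_t) (Lam : porderType disp).
Context (T : triangular_basis A Lam).
Implicit Types (l m : Lam) (M N V X U P Q : gmod A).
Local Notation Jw l := (Jl T l).

Lemma killed_e l m V (v : V) : killed (Jw l) V -> tb_e T m |> v = v -> v <> 0 -> (l <= m)%O.
Proof.
move=> kV ev nv; case: (boolP (l <= m)%O) => // nl; case: nv.
by rewrite -ev; apply: kV; exact: e_J.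
Qed.

Lemma Jw_mono l m a : (l <= m)%O -> Jw l a -> Jw m a.
Proof.
move=> lm /JlP h; apply/JlP; apply: Bs_mono h => n; rewrite /nge /=.
by apply: contra; exact: le_trans.
Qed.

(** Each basis element [x h y] of [J_l] is the product of [x h] and [y], which both lie in
    [J_l]; so the modules killed by [J_l] are closed under extensions. *)
Lemma Jw_idem l V (v : V) : (forall a b, Jw l a -> Jw l b -> a |> b |> v = 0) ->
  forall a, Jw l a -> a |> v = 0.
Proof.
move=> h a /JlP; apply: (span_map (S := zero_ss V) (gm_actLl v)).
move=> _ [i [s [t [j [x [h0 [y [hx hh hy g ->]]]]]]]].
rewrite /= /set1 /mkset -gm_actA; apply: h.
  by rewrite -(H_r hh) la_mulA; apply: gi_mull; exact: one_J.
by rewrite -(Y_l hy); apply: gi_mulr; exact: one_J.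
Qed.

(** A nonzero module has a nonzero part at some weight that is killed by all the
    weights not above it: take a minimal weight of the module. *)
Lemma nonzero_top V (v : V) : v <> 0 -> exists l (w : topw T l V), w <> 0.
Proof.
move=> nv; pose wt l := exists (t : set_type (tb_S T)) (w : V),
  [/\ tb_dot t = l, la_one A (val t) |> w = w & w <> 0].
have [l0 hl0] : exists l, wt l.
  apply: contrapT => nl; apply: nv; have [s [_ ->]] := gm_unital v.
  rewrite big1 // => i _.
  apply: (span_map (S := zero_ss V) (gm_actLl v) _ (Bs_all T (la_one A i))).
  move=> _ [i' [s' [t [j [x [h [y [hx hh hy _ ->]]]]]]]].
  rewrite /= /set1 /mkset -gm_actA; suff -> : y |> v = 0 by exact: lin0 (gm_actLr _).
  apply: contrapT => ny; apply: nl; exists (tb_dot t), t, (y |> v); split=> //.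
  by rewrite gm_actA (Y_l hy).
have [l [[t [w [dt tw nw]]] hl]] := lam_min T hl0.
exists l; suff hin : @top_ss _ _ (Jw l) (tb_e T l) V w.
  by exists (ssub hin) => e; apply: nw; have := congr1 (@sub_val _ _ _) e.
split; last by rewrite -tw gm_actA e_one dt eqxx.
move=> a ha; rewrite -tw gm_actA.
have : Bs T (nge l) (a ** la_one A (val t)).
  by apply: Bs_mulr; [exact: nge_lower | exact/JlP].
set b := a ** _ => hb.
have bt : b ** la_one A (val t) = b by rewrite -la_mulA la_orth eqxx.
rewrite -bt; move: hb.
have l1 : linear (fun b : A => b ** la_one A (val t) |> w).
  by move=> c u u'; rewrite la_mulLl gm_actLl.
apply: (span_map (S := zero_ss V) l1).
move=> _ [i [s [s' [j [x [h [y [hx hh hy g ->]]]]]]]].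
rewrite /= /set1 /mkset -gm_actA tw; rewrite -gm_actA.
suff -> : y |> w = 0 by exact: lin0 (gm_actLr _).
rewrite -tw -(Y_r hy) gm_actA -la_mulA la_orth; case: eqP => [ej|_]; last first.
  by rewrite mulA0 (lin0 (gm_actLl _)).
rewrite (Y_r hy); move: hy; rewrite ej => hy.
case: (Y_dot hy) => [[e _]|lt]; first by move: g; rewrite e dt /nge /= lexx.
apply: contrapT => ny; apply: (hl (tb_dot s')); first by rewrite -dt.
by exists s', (y |> w); split=> //; rewrite gm_actA (Y_l hy).
Qed.

Section Layers.
Variable good : forall l, gmod (alg_at T l) -> Prop.

Definition layer l M := exists W : gmod (alg_at T l),
  [/\ good W, locally_fd W, bounded_above W & giso M (j_star T W)].

Lemma layer_iso l M N (f : M -> N) : hom0 f -> bijective f -> layer l N -> layer l M.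
Proof.
move=> hf bf [W [h1 h2 h3 [g /ghom0P hg bg]]]; exists W; split=> //.
exists (fun x => g (f x)); last exact: bij_comp.
by apply/ghom0P; exact: hom0_comp.
Qed.

Lemma sub_incl_ses V (N1 N2 : gsubmod V) : N2 `<=` N1 ->
  exists u : sub_gmod N2 -> sub_gmod N1,
  ses u (qpi (subquo_sub N1 N2) : sub_gmod N1 -> subquo_gmod N1 N2).
Proof.
move=> h; exists (fun x => ssub (h _ (sub_valP x)) : sub_gmod N1); split.
- by split=> [c u v|a v|n v hv] //; exact: sub_val_inj.
- exact: hom0_quo.
- by move=> x y e; apply: sub_val_inj; have := congr1 (@sub_val _ _ _) e.
- exact: quo_surj.
- move=> x; split=> [/(qpi_eq0 (subquo_sub N1 N2)) hx|[y <-]].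
    by exists (ssub (S := N2) hx); apply: sub_val_inj.
  by apply/(qpi_eq0 (subquo_sub N1 N2)); exact: (sub_valP y).
Qed.

(* [Cl] is a class of modules that is closed under syzygies, contains the test modules and
   is acyclic for the coinduced modules of good modules. *)
Variables (B : Lam -> Type) (D : forall l, B l -> gmod A) (Cl : gmod A -> Prop).
Hypothesis Cl_ker : forall U P N (u : U -> P) (p : P -> N),
  projective_gmod P -> ses u p -> Cl N -> Cl U.
Hypothesis Cl_ext : forall N l (W : gmod (alg_at T l)), Cl N -> good W -> ext1z N (j_star T W).
Hypothesis Cl_D : forall l (b : B l) d, Cl (shift d (D b)).
Hypothesis D_wmap0 : forall l (b : B l) d m (W : gmod (alg_at T m)) (phi : shift d (D b) -> W),
  wmap phi -> m != l -> forall v, phi v = 0.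
Hypothesis D_killed : forall l (b : B l), killed (Jw l) (D b).

Lemma ext1z_layer N l M : Cl N -> layer l M -> ext1z N M.
Proof.
move=> hN [W [hW _ _ [f /ghom0P hf bf]]].
have [g [hg fK gK]] := hom0_inverse hf bf.
have bg : bijective g by exists f.
exact: ext1z_isoV hg bg (Cl_ext hN hW).
Qed.

Lemma D_layer0 l (b : B l) d m M (f : shift d (D b) -> M) : layer m M -> m != l ->
  hom0 f -> forall x, f x = 0.
Proof.
move=> [W [_ _ _ [g /ghom0P hg bg]]] ne hf x; apply: (bij_inj bg); rewrite (hom0_0 hg).
have hgf := hom0_comp hf hg.
apply: (star_ext hgf (hom0_zero _ _) _ x) => y.
by rewrite (D_wmap0 (evw_wmap hgf) ne) (mumap_0 (evw_wmap (hom0_id (j_star T W)))).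
Qed.

Lemma suppP V l : hom_supp D V l <->
  exists (b : B l) d (f : shift d (D b) -> V), hom0 f /\ exists x, f x <> 0.
Proof.
split=> [[b [f hf nf]]|[b [d [f [hf [x nx]]]]]]; last first.
  exists b; exists f; first by apply: span_sub; exists d; exact/ghom_shiftP.
  by move=> e; apply: nx; rewrite e.
apply: contrapT => h; apply: nf.
apply: (@span_min _ _ _ (zero_ss _) _ f hf) => g [d /ghom_shiftP hg].
apply/funext => x; apply: contrapT => nx; apply: h.
by exists b, d, g; split=> //; exists x.
Qed.

Section Flag.
Context (V : gmod A) (n : nat) (F : nat -> gsubmod V) (w : 'I_n -> Lam).
Hypotheses (F0 : forall v, F 0 v) (Fn : forall v, F n v -> v = 0)
  (hF : forall r : 'I_n, F r.+1 `<=` F r /\ layer (w r) (subquo_gmod (F r) (F r.+1))).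

Lemma flag_ext1z N : Cl N -> ext1z N V.
Proof.
move=> hN.
have h i : (i <= n)%N -> ext1z N (sub_gmod (F (n - i))).
  elim: i => [_|i ih hi].
    move=> U X u p f _ hf; exists (fun _ => 0); first exact: hom0_zero.
    move=> y; apply: sub_val_inj => /=; rewrite subn0 in f hf *.
    by apply/esym/Fn; exact: sub_valP.
  have lt : (n - i.+1 < n)%N by rewrite ltn_subrL /=; apply: leq_trans hi.
  have [h1 h2] := hF (Ordinal lt).
  have e : (n - i.+1).+1 = (n - i)%N by rewrite -subSn.
  have [u hu] := sub_incl_ses h1.
  apply: (ext1z_mid hu _ (ext1z_layer hN h2)) => /=.
  by rewrite e; apply: ih; exact: ltnW.
have := h n (leqnn n); rewrite subnn; apply: ext1z_isoV (hom0_sub (F 0)) _.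
exists (fun v => ssub (F0 v)) => x; last by [].
exact: sub_val_inj.
Qed.

Lemma flag_supp l : hom_supp D V l -> exists r, w r = l.
Proof.
move=> /suppP[b [d [f [hf [x nx]]]]]; apply: contrapT => nl; apply: nx.
have h i : (i <= n)%N -> forall y, F i (f y).
  elim: i => [_ y|i ih hi]; first exact: F0.
  have [h1 h2] := hF (Ordinal hi); have {}ih := ih (ltnW hi).
  have hf' : hom0 (fun y => ssub (S := F i) (ih y) : sub_gmod (F i)).
    split=> [c u v|a v|m v hv]; last exact: (hom0_deg hf).
    - by apply: sub_val_inj; exact: (hom0_lin hf).
    - by apply: sub_val_inj; exact: (hom0_act hf).
  have hq := hom0_comp hf' (hom0_quo (subquo_sub (F i) (F i.+1))).
  have ne : w (Ordinal hi) != l by apply/eqP => e; apply: nl; exists (Ordinal hi).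
  move=> y; have := D_layer0 h2 ne hq y.
  by move/(qpi_eq0 (subquo_sub (F i) (F i.+1))).
exact: Fn (h n (leqnn n) x).
Qed.
End Flag.

Hypothesis D_enough : forall l V, bounded_above V -> (exists v : topw T l V, v <> 0) ->
  exists (b : B l) d (f : shift d (D b) -> V), hom0 f /\ exists x, f x <> 0.
Hypothesis good_test : forall l (W : gmod (alg_at T l)), locally_fd W -> bounded_above W ->
  (forall (b : B l) d, ext1z (shift d (D b)) (j_star T W)) -> good W.
Hypothesis A_bb : alg_bounded_below A.

(** The image would extend [ann] by a module that is killed by [J_l'] as well. *)
Lemma hom_to_quo0 l (b : B l) d l' Q (f : shift d (D b) -> quo_gmod (ann (Jw l') Q)) :
  (l' <= l)%O -> hom0 f -> forall x, f x = 0.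
Proof.
move=> le hf x; have [v vE] := quo_surj (f x); rewrite -vE.
apply/(qpi_eq0 (ann (Jw l') Q)); apply: Jw_idem => a c ha hc.
have hc' : Jw l c := Jw_mono le hc.
have : c |> f x = 0 by rewrite -(hom0_act hf) [c |> x](D_killed _ hc') (hom0_0 hf).
rewrite -vE -(hom0_act (hom0_quo _)) => /(qpi_eq0 (ann (Jw l') Q)) h.
exact: h.
Qed.

(** The bottom layer: for a weight [l] that is maximal in the support, the largest
    submodule of [Q] killed by [J_l] is coinduced from its weight [l] part [W]. The
    kernel and the cokernel of the canonical map would have maps from the [D b] of some
    larger weight, which contradicts the maximality of [l], respectively the vanishing
    of [Ext^1]. *)
Lemma bottom_layer Q l : locally_fd Q -> bounded_above Q ->
  (forall m, (l < m)%O -> ~ hom_supp D Q m) ->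
  (forall m (b : B m) d, ext1z (shift d (D b)) Q) ->
  layer l (sub_gmod (ann (Jw l) Q)).
Proof.
move=> fQ bQ hmax hext.
set N := ann (Jw l) Q; set Y := sub_gmod N; set Z := quo_gmod N.
have hs : ses (@sub_val k Q N : Y -> Q) (qpi N : Q -> Z) := ses_quo N.
have kY : killed (Jw l) Y by move=> a y ha; apply: sub_val_inj; exact: (sub_valP y).
pose W := topw T l Y.
have fW : locally_fd W by apply: topw_fd; exact: fd_sub.
have bY : bounded_above Y by apply: ba_sub (hom0_sub N) (@sub_val_inj _ _ N) bQ.
have bW : bounded_above W by exact: topw_ba.
pose ta (y : Y) : W := @tau _ _ (Jw l) _ (tb_eK T l) (tb_e_deg T l) (ebar T l) (ebarE T l) Y kY y.
have hta : wmap ta by exact: tau_mumap.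
have [f hf fE] := wmap_star hta.
have Yext m (b : B m) d : (l <= m)%O -> ext1z (shift d (D b)) Y.
  move=> le; apply: (ext1z_sub hs) => // g hg; exact: hom_to_quo0 le hg.
have finj y : f y = 0 -> y = 0.
  move=> hy; apply: contrapT => ny.
  pose K := sub_gmod (gker hf).
  have ik : injective (@sub_val k Y (gker hf)) by exact: sub_val_inj.
  have bK : bounded_above K by apply: ba_sub (hom0_sub (gker hf)) ik bY.
  pose y' : K := ssub (S := gker hf) hy.
  have ny' : y' <> 0 by move=> e; apply: ny; have := congr1 (@sub_val _ _ _) e.
  have [m [v nv]] := nonzero_top ny'.
  have [_ ev] := sub_valP v.
  have nz : sub_val (sub_val v) <> 0 :> Y.
    by move=> e; apply: nv; apply: sub_val_inj; exact: ik.
  have ev' : tb_e T m |> (sub_val (sub_val v) : Y) = sub_val (sub_val v).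
    by have := congr1 (@sub_val _ _ _) ev.
  have le := killed_e kY ev' nz.
  case: (eqVneq l m) => [e|ne].
    subst m; have f0 : f (sub_val (sub_val v)) = 0 := sub_valP (sub_val v).
    have := fE (sub_val (sub_val v)).
    rewrite f0 (mumap_0 (evw_wmap (hom0_id (j_star T W)))) => /esym h.
    by apply: nz; rewrite -ev'; exact: (congr1 (fun w : W => sub_val w : Y) h).
  have [b [d [g [hg [x nx]]]]] := D_enough bK (ex_intro _ v nv).
  apply: (hmax m); first by rewrite lt_neqAle ne le.
  apply/suppP; exists b, d, (fun x => sub_val (sub_val (g x))); split.
    exact: hom0_comp (hom0_comp hg (hom0_sub (gker hf))) (hom0_sub N).
  exists x => e; apply: nx; apply: sub_val_inj; exact: sub_val_inj.
have fsurj g : exists y, f y = g.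
  apply: contrapT => ng.
  pose I := gim hf (gfull Y); pose C := quo_gmod I.
  have hsC : ses f (qpi I : j_star T W -> C).
    split; [exact: hf | exact: hom0_quo | exact: hom0_inj | exact: quo_surj |].
    move=> x; split=> [/(qpi_eq0 I)[y _ <-]|[y <-]]; first by exists y.
    by apply/(qpi_eq0 I); exists y.
  have bC : bounded_above C.
    by apply: ba_quo (hom0_quo I) (@quo_surj _ _ _ I) _; exact: star_ba.
  have nc : (qpi I g : C) <> 0.
    by move/(qpi_eq0 I) => [y _ e]; apply: ng; exists y.
  have kC : killed (Jw l) C.
    move=> a c ha; have [h <-] := quo_surj c.
    rewrite -(hom0_act (hom0_quo I)) [a |> h](star_killed (J := Jw l)) //.
    exact: hom0_0 (hom0_quo I).
  have [m [v nv]] := nonzero_top nc.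
  have [_ ev] := sub_valP v.
  have nz : sub_val v <> 0 :> C by move=> e; apply: nv; exact: sub_val_inj.
  have le := killed_e kC ev nz.
  have evw0 : wmap (@evw _ _ _ _ T l W) := evw_wmap (hom0_id (j_star T W)).
  case: (eqVneq l m) => [e|ne].
    subst m; have [h hE] := quo_surj (sub_val v).
    have hfy : evw (f (sub_val (evw h))) = evw h.
      rewrite fE /ta; exact: tau_id.
    apply: nz; rewrite -ev -hE -(hom0_act (hom0_quo I)); apply/(qpi_eq0 I).
    exists (tb_e T l |> sub_val (evw h)) => //; rewrite (hom0_act hf).
    apply/eqP; rewrite -subr_eq0 -(linB _ _ (gm_actLr _)); apply/eqP.
    apply: (@star_eq0 _ _ (Jw l) (ebar T l)) => a.
    change (evw (a |> tb_e T l |> (f (sub_val (evw h)) - h)) = 0).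
    rewrite (mumap_kap evw0) (mumapB evw0) hfy subrr; exact: lin0 (gm_actLr _).
  have [b [d [h [hh [x nx]]]]] := D_enough bC (ex_intro _ v nv).
  have [h' hh' hE] := ext1z_lift hsC (Yext m b d le) hh.
  apply: nx; rewrite -hE.
  suff -> : h' x = 0 by exact: hom0_0 (hom0_quo I).
  apply: (star_ext hh' (hom0_zero _ _) _ x) => z.
  by rewrite (D_wmap0 (evw_wmap hh') ne) (mumap_0 evw0).
have bf := hom0_bij hf finj fsurj.
exists W; split=> //; last by exists f => //; exact/ghom0P.
apply: good_test => // b d.
by apply: ext1z_isoV hf bf _; exact: Yext.
Qed.

Lemma supp_dec Q (ls : seq Lam) : bounded_above Q -> hom_supp D Q `<=` [set` ls] ->
  (exists2 l, l \in ls & hom_supp D Q l) \/ forall x : Q, x = 0.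
Proof.
move=> bQ hsupp; case: (pselect (exists2 l, l \in ls & hom_supp D Q l)) => [|nl]; [by left|right].
move=> x; apply: contrapT => /nonzero_top[l [v nv]]; apply: nl.
have hl : hom_supp D Q l by apply/suppP; apply: D_enough => //; exists v.
by exists l => //; exact: hsupp.
Qed.

(** Peeling off bottom layers; each step removes a weight from the support. *)
Lemma build_flag V : forall n (ls : seq Lam) Q (q : V -> Q), (size ls <= n)%N ->
  hom0 q -> surj q -> locally_fd Q -> bounded_above Q -> hom_supp D Q `<=` [set` ls] ->
  (forall m (b : B m) d, ext1z (shift d (D b)) Q) ->
  exists (F : nat -> gsubmod V) (ws : seq Lam),
  [/\ forall v, F 0 v, forall v, F (size ws) v <-> q v = 0, uniq ws, {subset ws <= ls} &
      forall r l0, (r < size ws)%N -> F r.+1 `<=` F r /\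
        layer (nth l0 ws r) (subquo_gmod (F r) (F r.+1))].
Proof.
elim=> [|n ih] ls Q q sz hq sq fQ bQ hsupp hext;
  have [hl|Q0] := supp_dec bQ hsupp.
- by have [l] := hl; move: sz; rewrite leqn0 size_eq0 => /eqP ->.
- by exists (fun _ => gfull V), [::]; split=> // v; split.
- have [|||l [ls' hl' lmax]] := seq_extremal (R := fun x y : Lam => (y < x)%O) (P := hom_supp D Q) (ls := ls).
  + by move=> x; rewrite ltxx.
  + by move=> x y z h1 h2; exact: lt_trans h2 h1.
  + exact: hl.
  have hmax m : (l < m)%O -> ~ hom_supp D Q m.
    by move=> lt hm; exact: (lmax m (hsupp _ hm) hm lt).
  have hlay := bottom_layer fQ bQ hmax hext.
  set N := ann (Jw l) Q in hlay; set Z := quo_gmod N.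
  have hs : ses (@sub_val k Q N : sub_gmod N -> Q) (qpi N : Q -> Z) := ses_quo N.
  have hZ := hom0_quo N; have sZ : surj (qpi N : Q -> Z) := @quo_surj _ _ _ N.
  have [|||||||F [ws [F0 Fn uws sws hF]]] :=
    ih [seq m <- ls | m != l] Z (fun v => qpi N (q v)).
  + rewrite -ltnS; apply: leq_trans sz; rewrite size_filter -(count_predC (pred1 l) ls).
    by rewrite -[X in (X < _)%N]add0n ltn_add2r -has_count; apply/hasP; exists l => //=.
  + exact: hom0_comp hq hZ.
  + by move=> z; have [x <-] := sZ z; have [v <-] := sq x; exists v.
  + exact: fd_quo hZ sZ fQ.
  + exact: ba_quo hZ sZ bQ.
  + move=> m /suppP[b [d [f [hf [x nx]]]]]; rewrite /= mem_filter; apply/andP; split.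
      by apply/eqP => e; subst m; apply: nx; exact: hom_to_quo0 (lexx l) hf x.
    have [g hg gE] := ext1z_lift hs (ext1z_layer (Cl_D b d) hlay) hf.
    apply: hsupp; apply/suppP; exists b, d, g; split=> //; exists x => e.
    by apply: nx; rewrite -gE e (hom0_0 hZ).
  + move=> m b d; have [P [U [u [p [hP hup]]]]] := enough_projectives (shift d (D b)).
    apply: (ext1z_quo hs hP hup _ (hext m b d)).
    exact: ext1z_layer (Cl_ker hP hup (Cl_D b d)) hlay.
  exists (fun r => if (r <= size ws)%N then F r else gker hq), (rcons ws l); split.
  + by move=> v; rewrite leq0n.
  + by move=> v; rewrite size_rcons ltnn.
  + rewrite rcons_uniq uws andbT; apply/negP => /sws.
    by rewrite mem_filter eqxx.
  + move=> m; rewrite mem_rcons inE => /orP[/eqP ->//|/sws].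
    by rewrite mem_filter => /andP[].
  + move=> r l0; rewrite size_rcons ltnS => hr; rewrite hr nth_rcons.
    have [lt|] := ltnP r (size ws); first by apply: hF.
    move=> hr'; have -> : r = size ws by apply/eqP; rewrite eqn_leq hr hr'.
    rewrite eqxx; split.
      by move=> v hv; apply/Fn; rewrite [q v]hv (hom0_0 hZ).
    have inN (v : sub_gmod (F (size ws))) : N (q (sub_val v)).
      by apply/(qpi_eq0 N)/Fn; exact: sub_valP.
    pose g (v : sub_gmod (F (size ws))) : sub_gmod N := ssub (inN v).
    have hg : hom0 g.
      split=> [c u v|a v|m v hv].
      - by apply: sub_val_inj; exact: (hom0_lin hq).
      - by apply: sub_val_inj; exact: (hom0_act hq).
      - exact: (hom0_deg hq) hv.
    set K := subquo_sub (F (size ws)) (gker hq).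
    have [f hf fE] : exists2 f : quo_gmod K -> sub_gmod N, hom0 f & forall v, f (qpi K v) = g v.
      apply: (factor_surj (hom0_quo K) (@quo_surj _ _ _ K) hg) => v /(qpi_eq0 K) hv.
      exact: sub_val_inj.
    apply: (layer_iso hf) hlay; apply: hom0_bij => //.
      move=> x; have [v <-] := quo_surj x; rewrite fE => e; apply/(qpi_eq0 K).
      by have := congr1 (@sub_val _ _ _) e.
    move=> y; have [v vE] := sq (sub_val y).
    have hv : F (size ws) v by apply/Fn; rewrite vE; apply/(qpi_eq0 N); exact: sub_valP.
    exists (qpi K (ssub hv)); rewrite fE; exact: sub_val_inj.
- by exists (fun _ => gfull V), [::]; split=> // v; split.
Qed.

(** From a flag the vanishing is read off by induction on its length. Conversely [build_flag]
    applies, since the first extension groups stay zero in the quotients: the second ones of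
    the layers vanish. *)
Theorem flag_criterion V : locally_fd V -> bounded_above V ->
  (has_flag layer V <-> finite_set (hom_supp D V) /\
     (forall l (b : B l), ExtA_zero 1 (D b) V)) /\
  (finite_set (hom_supp D V) /\ (forall l (b : B l), ExtA_zero 1 (D b) V) <->
   finite_set (hom_supp D V) /\
     (forall l (b : B l) n, (1 <= n)%N -> ExtA_zero n (D b) V)).
Proof.
move=> fV bV.
have ac : has_flag layer V -> finite_set (hom_supp D V) /\
    (forall l (b : B l) n, (1 <= n)%N -> ExtA_zero n (D b) V).
  move=> [n [F [w [F0 Fn _ hF]]]]; split.
    apply: (sub_finite_set (B := range w)); last exact: finite_image.
    by move=> l /(flag_supp F0 Fn hF)[r <-]; exists r.
  move=> l b; apply: ExtA_zeroI Cl_ker _ (Cl_D b) => N.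
  exact: flag_ext1z F0 Fn hF N.
have ba : finite_set (hom_supp D V) /\ (forall l (b : B l), ExtA_zero 1 (D b) V) ->
    has_flag layer V.
  move=> [/finite_seqP[ls e] hext].
  have [|||||||F [ws [F0 Fn uws _ hF]]] := @build_flag V (size ls) ls V (fun v => v).
  - by [].
  - exact: hom0_id.
  - by move=> v; exists v.
  - by [].
  - by [].
  - by rewrite e.
  - by move=> m b d; exact: ExtA_zero1 (hext m b) d.
  exists (size ws), F, (fun i => tnth (in_tuple ws) i); split=> //.
  - by move=> v /Fn.
  - have tE l0 (i : 'I_(size ws)) : tnth (in_tuple ws) i = nth l0 ws i by exact: tnth_nth.
    move=> i j; rewrite (tE (tnth (in_tuple ws) i) i) (tE (tnth (in_tuple ws) i) j).
    by move=> /eqP; rewrite nth_uniq // => /eqP/val_inj.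
  - move=> r; have h := hF r (tnth (in_tuple ws) r) (ltn_ord r).
    by rewrite -(tnth_nth _ (in_tuple ws) r) in h.
have cb : finite_set (hom_supp D V) /\
     (forall l (b : B l) n, (1 <= n)%N -> ExtA_zero n (D b) V) ->
    finite_set (hom_supp D V) /\ (forall l (b : B l), ExtA_zero 1 (D b) V).
  by move=> [h1 h2]; split=> // l b; exact: h2.
by split; split=> [h|]; [exact: cb (ac h) | exact: ba | exact: ac (ba h) | exact: cb].
Qed.
End Layers.
End Criterion.

(** * Irreducible subquotients and injective modules *)

Section Zorn.
Context (k : fieldType) (A : lualg k) (V : gmod A).

(** Zorn's lemma for the graded submodules that avoid a given set of elements; it
    serves for maximal submodules, and for maximal extensions of a homomorphism, which
    are submodules of a product. *)
Lemma gsub_zorn (N0 : gsubmod V) (bad : set V) : (forall v, bad v -> ~ N0 v) ->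
  exists N : gsubmod V, [/\ N0 `<=` N, forall v, bad v -> ~ N v &
    forall N' : gsubmod V, N `<=` N' -> (forall v, bad v -> ~ N' v) -> N' `<=` N].
Proof.
move=> h0.
pose ok (N : gsubmod V) := N0 `<=` N /\ forall v, bad v -> ~ N v.
pose Z := {N : gsubmod V | ok N}.
pose R (x y : Z) := `[< forall v, projT1 x v -> projT1 y v >].
have ok0 : ok N0 by split.
pose z0 : Z := exist _ N0 ok0.
have [||C tot|[N [okN1 okN2]] maxN] := @ZL_preorder Z z0 R.
- by move=> x; apply/asboolP.
- by move=> y x z /asboolP h1 /asboolP h2; apply/asboolP => v /h1/h2.
- case: (pselect (exists z, C z)) => [[z1 Cz1]|nC]; last first.
    by exists z0 => s Cs; case: nC; exists s.
  pose S v := exists2 z : Z, C z & projT1 z v.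
  have S0 : S 0 by exists z1 => //; exact: ss0.
  have SL (c : k) u v : S u -> S v -> S (c *: u + v).
    move=> [x Cx hx] [y Cy hy]; case: (tot x y Cx Cy) => /asboolP h.
      by exists y => //; apply: ssL => //; exact: h.
    by exists x => //; apply: ssL => //; exact: h.
  have Sa a v : Subspace S0 SL v -> Subspace S0 SL (a |> v).
    by move=> [x Cx hx]; exists x => //; exact: gs_act.
  have Sp d v : Subspace S0 SL v -> Subspace S0 SL (gr_pr (gm_graded V) d v).
    by move=> [x Cx hx]; exists x => //; exact: gs_pr.
  have okU : ok (mk_gsub Sa Sp).
    split=> [v hv|v bv [x Cx hx]].
      by exists z1 => //; case: (projT2 z1) => h _; exact: h.
    by case: (projT2 x) => _ h; exact: h bv hx.
  by exists (exist _ _ okU) => s Cs; apply/asboolP => v hv; exists s.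
exists N; split=> // N' NN' hN' v hv.
have okN' : ok N' by split=> // x /okN1/NN'.
have /asboolP h := maxN (exist _ N' okN') (asboolT NN').
exact: h.
Qed.
End Zorn.

Section UnitalGraded.
Context (k : fieldType) (C : lualg k) (o : la_idx C).
Hypotheses (o_act : forall (W : gmod C) (w : W), la_one C o |> w = w)
  (o_l : forall a, la_one C o ** a = a) (o_r : forall a, a ** la_one C o = a).
Hypotheses (C_fd : alg_locally_fd C) (C_bb : alg_bounded_below C).
Implicit Types (W Y : gmod C).

Lemma hom_comp_ne0 W (w : W) : w <> 0 -> exists d, gr_pr (gm_graded W) d w <> 0.
Proof.
move=> nw; apply: contrapT => h; apply: nw.
have [s /(_ _ (undup_uniq s)) ->] := gr_pr_sum (gm_graded W) w.
  by rewrite big1 // => d _; apply: contrapT => nd; apply: h; exists d.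
by move=> x; rewrite mem_undup.
Qed.

Lemma cyc_hom W (d : int) (w : W) : gm_deg W d w -> [set w] `<=` homogeneous (gm_deg W).
Proof. by move=> h _ ->; exists d. Qed.

Definition cyc W d (w : W) (h : gm_deg W d w) : gsubmod W := ggen (cyc_hom h).

Lemma cyc_id W d (w : W) (h : gm_deg W d w) : cyc h w.
Proof. exact: ggen_sub. Qed.

Lemma cyc_min W d (w : W) (h : gm_deg W d w) (N : gsubmod W) : N w -> cyc h `<=` N.
Proof. by move=> hw; apply: ggen_min => _ ->. Qed.

Lemma cycP W d (w : W) (h : gm_deg W d w) (S : subspace W) :
  (forall n a, la_deg C n a -> S (a |> w)) -> forall x, cyc h x -> S x.
Proof.
move=> hS; apply: (@span_min _ _ _ S) => _ [a [_ [-> ->]]].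
exact: (gr_span_map (la_graded C) (gm_actLl w)).
Qed.

Lemma C_bounded : exists N : int, forall d a, d < N -> la_deg C d a -> a = 0.
Proof.
have [N hN] := C_bb o o; exists N => d a lt hd; apply: hN lt _ hd _ _.
  exact: o_l.
exact: o_r.
Qed.

Lemma W_bounded W : bounded_above W ->
  exists N : int, forall d w, N < d -> gm_deg W d w -> w = 0.
Proof. by move=> /(_ o)[N hN]; exists N => d w lt hd; apply: (hN d lt w hd). Qed.

(** Cyclic submodules are bounded below; those of a module that is bounded above are
    thus finite-dimensional. *)
Lemma cyc_fin W d (w : W) (h : gm_deg W d w) : bounded_above W ->
  exists ls : seq W, forall x, cyc h x -> span [set` ls] x.
Proof.
move=> /W_bounded[N hN]; have [M hM] := C_bounded.
have [f hf] := choice (fun i : nat => C_fd o o (M + i%:Z)).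
pose r := (absz (N - d - M)%R).+1.
exists (flatten [seq [seq a |> w | a <- f i] | i <- iota 0 r]).
apply: cycP => n a ha.
have [nM|Mn] := ltP n M; first by rewrite (hM _ _ nM ha) (lin0 (gm_actLl w)); exact: ss0.
have [big|small] := ltP N (n + d).
  by rewrite (hN _ _ big (gm_degM ha h)); exact: ss0.
pose i := absz (n - M)%R.
have en : n = M + i%:Z by rewrite /i; lia.
have ir : (i < r)%N by rewrite /i /r; lia.
have : span [set` f i] a by apply: hf; rewrite -en; split=> //.
move=> /(span_map_seq (gm_actLl w)); apply: span_mono => x hx.
by apply/flattenP; exists [seq a |> w | a <- f i] => //; apply/mapP; exists i => //; rewrite mem_iota.
Qed.

(** A nonzero module that is bounded above has an irreducible submodule, namely a cyclic
    one of minimal dimension. *)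
Lemma socle W (w : W) : bounded_above W -> w <> 0 ->
  exists S : gsubmod W, irreducible_gmod (sub_gmod S).
Proof.
move=> bW nw.
pose P n := exists (d : int) (y : W) (h : gm_deg W d y) (ls : seq W),
  [/\ y <> 0, size ls = n & forall x, cyc h x -> span [set` ls] x].
have [n0 hn0] : exists n, P n.
  have [d nd] := hom_comp_ne0 nw; have hd := gr_prP (gm_graded W) d w.
  have [ls hls] := cyc_fin hd bW.
  by exists (size ls), d, (gr_pr (gm_graded W) d w), hd, ls.
have [n [[d [y [h [ls [ny sz hls]]]]] hmin]] : exists n, P n /\ forall m, (m < n)%N -> ~ P m.
  elim/ltn_ind: n0 hn0 => n ih hn; case: (pselect (exists2 m, (m < n)%N & P m)) => [[m lt hm]|nm].
    exact: ih lt hm.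
  by exists n; split=> // m lt hm; apply: nm; exists m.
exists (cyc h); split.
  by exists (ssub (cyc_id h)) => e; apply: ny; have := congr1 (@sub_val _ _ _) e.
move=> N; case: (pselect (forall v, N v -> v = 0)) => [|/existsNP[v /not_implyP[hv nv]]]; [by left|right].
have [d' nd] := hom_comp_ne0 nv.
set v' := gr_pr _ d' v in nd.
have hv' : N v' by exact: gs_pr.
have hd : gm_deg W d' (sub_val v') := gr_prP (gm_graded (sub_gmod (cyc h))) d' v.
have ny' : sub_val v' <> 0 by move=> e; apply: nd; exact: sub_val_inj.
have sub : cyc hd `<=` cyc h by apply: cyc_min; exact: sub_valP.
have full x : cyc h x -> cyc hd x.
  move=> hx; apply: contrapT => nx.
  have [||ls' [lt hls']] := @span_proper _ _ (cyc hd) ls x _ _ nx.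
  - by move=> z /sub/hls.
  - exact: hls.
  by apply: (hmin (size ls')); [rewrite -sz | exists d', (sub_val v'), hd, ls'].
move=> x; have := full _ (sub_valP x).
have : cyc hd `<=` gim (hom0_sub (cyc h)) N by apply: cyc_min; exists v'.
by move=> hi /hi[z hz /sub_val_inj <-].
Qed.

(** Zorn's lemma, for the submodules of a cyclic module that avoid its generator. *)
Lemma irreducible_quotient W (w : W) : w <> 0 -> exists (S : gsubmod W)
  (M : gsubmod (sub_gmod S)), irreducible_gmod (quo_gmod M).
Proof.
move=> nw; have [d nd] := hom_comp_ne0 nw; have hd := gr_prP (gm_graded W) d w.
pose S := cyc hd; pose y : sub_gmod S := ssub (cyc_id hd).
have ny : y <> 0 by move=> e; apply: nd; have := congr1 (@sub_val _ _ _) e.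
have [|M [_ h1 h2]] := @gsub_zorn _ _ (sub_gmod S) (gzero _) [set y].
  by move=> v -> ; exact: ny.
exists S, M; split.
  by exists (qpi M y) => /(qpi_eq0 M); exact: h1.
move=> N; case: (pselect (forall v, N v -> v = 0)) => [|/existsNP[v /not_implyP[hv nv]]]; [by left|right].
have hq := hom0_quo M.
have hy : gpre hq N y.
  apply: contrapT => nNy; apply: nv; have [z zE] := quo_surj v; rewrite -zE.
  apply/(qpi_eq0 M); apply: (h2 (gpre hq N)); last by rewrite /= /preimage /mkset zE.
    by move=> m /(qpi_eq0 M) e; rewrite /= /preimage /mkset e; exact: ss0.
  by move=> _ ->.
have full z : gpre hq N z.
  have hS : cyc hd `<=` gim (hom0_sub S) (gpre hq N) by apply: cyc_min; exists y.
  by have [z' hz' /sub_val_inj <-] := hS _ (sub_valP z).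
by move=> x; have [z <-] := quo_surj x; exact: full.
Qed.

Section Baer.
Variable W : gmod C.
Hypothesis W_ba : bounded_above W.
Hypothesis test : forall Y (y : Y), bounded_above Y -> y <> 0 -> exists (S : gmod C) (h : S -> Y),
  [/\ hom0 h, injective h, exists s, h s <> 0 & ext1z S W].

Lemma prod_pr (V U : gmod C) d (z : prod_gmod V U) :
  gr_pr (gm_graded (prod_gmod V U)) d z =
  (gr_pr (gm_graded V) d z.1, gr_pr (gm_graded U) d z.2).
Proof.
rewrite [LHS]surjective_pairing; congr (_, _).
  exact: (hom0_pr (hom0_fst V U)).
exact: (hom0_pr (hom0_snd V U)).
Qed.

(** Baer's criterion. A maximal extension of a homomorphism to [W] is defined on all
    elements of large degree, since the submodules these generate can only map to zero.
    So the quotient by its domain is bounded above, and has an irreducible submodule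
    to which the homomorphism extends further, unless the quotient is zero. *)
Lemma baer : injective_gmod W.
Proof.
move=> X Y i f /ghom0P hi ii /ghom0P hf.
pose YW := prod_gmod Y W.
have hg0 : hom0 (fun x : X => (i x, f x) : YW).
  split=> [c u v|a v|n v hv].
  - by rewrite (hom0_lin hi) (hom0_lin hf).
  - by rewrite (hom0_act hi) (hom0_act hf).
  - by split; [exact: hom0_deg hi _ _ hv | exact: hom0_deg hf _ _ hv].
pose bad : set YW := [set z | z.1 = 0 /\ z.2 <> 0].
have [|N [N0 nb maxN]] := @gsub_zorn _ _ YW (gim hg0 (gfull X)) bad.
  move=> z [z1 z2] [x _ e]; apply: z2; rewrite -e /=.
  have -> : x = 0 by apply: (hom0_inj0 hi ii); rewrite -z1 -e.
  exact: hom0_0 hf.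
have fN w : N (0, w) -> w = 0 by move=> h; apply: contrapT => nw; exact: (nb (0, w)).
pose D := gim (hom0_fst Y W) N.
have hNf : hom0 (fun z : sub_gmod N => (sub_val z).1).
  exact: hom0_comp (hom0_sub N) (hom0_fst Y W).
have iNf : injective (fun z : sub_gmod N => (sub_val z).1).
  apply: hom0_inj => // z e; apply: sub_val_inj.
  have e2 : (sub_val z).2 = 0 by apply: fN; rewrite -e -surjective_pairing; exact: sub_valP.
  by rewrite [LHS]surjective_pairing e e2.
have uniq_val y w w' : N (y, w) -> N (y, w') -> w = w'.
  move=> h1 h2; apply/eqP; rewrite -subr_eq0; apply/eqP/fN.
  by have := ssB h1 h2; congr (N _); change ((y - y, w - w') = (0, w - w')); rewrite subrr.
have total : forall y, D y.
  pose Q := quo_gmod D.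
  suff Q0 (x : Q) : x = 0 by move=> y; apply/(qpi_eq0 D); exact: Q0.
  apply: contrapT => nx.
  have [NW hNW] := W_bounded W_ba; have [M hM] := C_bounded.
  (* [y] of large degree generates a submodule on which the extension can be zero *)
  have bQ : bounded_above Q.
    move=> j; exists (NW - M) => d hd q qd _.
    have [y hy <-] := qd; apply/(qpi_eq0 D).
    pose g (z : prod_gmod (sub_gmod N) (sub_gmod (cyc hy))) : YW :=
      sub_val z.1 + (sub_val z.2, 0).
    have hg : hom0 g.
      apply: hom0_comb; first exact: hom0_comp (hom0_fst _ _) (hom0_sub N).
      split=> [c u v|a v|n v [_ hv]].
      - by congr (_, _); rewrite /= scaler0 addr0.
      - by congr (_, _); rewrite /= (lin0 (gm_actLr a)).
      - by split=> //=; exact: ss0.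
    pose N' := gim hg (gfull _).
    have NN' : N `<=` N'.
      move=> z hz; exists (ssub hz, 0) => //; rewrite /g /=.
      by rewrite -[RHS]addr0.
    have hy' : N' (y, 0).
      by exists (0, ssub (cyc_id hy)) => //; rewrite /g /= add0r.
    suff nb' : forall v, bad v -> ~ N' v by exists (y, 0) => //; exact: maxN nb' _ hy'.
    move=> z [z1 z2] [[n c] _ e]; apply: z2.
    have hn := sub_valP n; have hc := sub_valP c; rewrite /g /= in e.
    have e2 : z.2 = (sub_val n).2 by rewrite -e /= addr0.
    have e1 : (sub_val n).1 = - sub_val c.
      by apply/eqP; rewrite -addr_eq0 -[X in _ == X]z1 -e.
    have clow m : m <= NW -> gr_pr (gm_graded Y) m (sub_val c) = 0.
      move=> hm; apply: (cycP (h := hy) (S := pre_ss (gr_pr_lin (gm_graded Y) m) (zero_ss Y))) hc.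
      move=> p a ha; rewrite /= /preimage /= /set1 /mkset.
      have [pM|Mp] := ltP p M.
        by rewrite (hM _ _ pM ha) (lin0 (gm_actLl y)) (lin0 (gr_pr_lin _ _)).
      by apply: (gr_pr_ne (gm_graded Y)) (gm_degM ha hy); apply/eqP => em; lia.
    apply: contrapT => nz; have [m nm] := hom_comp_ne0 nz; apply: nm.
    have [big|small] := ltP NW m; first exact: hNW big (gr_prP _ _ _).
    apply: fN; have := gs_pr m hn; rewrite prod_pr e1 -e2.
    by rewrite -scaleN1r (linZ _ _ (gr_pr_lin _ _)) clow // scaler0.
  have [S [h [hh ih [s ns] hS]]] := test bQ nx.
  (* [E] is the preimage of [S] in [Y], with its projection to [S] *)
  pose dif (z : prod_gmod Y S) : Q := (qpi D z.1 : Q) - h z.2.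
  have hdif : hom0 dif.
    apply: hom0_diff; first exact: hom0_comp (hom0_fst Y S) (hom0_quo D).
    exact: hom0_comp (hom0_snd Y S) hh.
  pose E := sub_gmod (gker hdif).
  have difE (z : E) : qpi D (sub_val z).1 = h (sub_val z).2 :> Q.
    by apply/eqP; rewrite -subr_eq0; apply/eqP; exact: (sub_valP z).
  have mkE y t : qpi D y = h t :> Q -> gker hdif (y, t).
    by move=> e; rewrite /= /preimage /= /set1 /mkset /dif /= e subrr.
  have hp : hom0 (fun z : E => (sub_val z).2).
    exact: hom0_comp (hom0_sub (gker hdif)) (hom0_snd Y S).
  have hfE : hom0 (fun z : E => (sub_val z).1).
    exact: hom0_comp (hom0_sub (gker hdif)) (hom0_fst Y S).
  have sp : surj (fun z : E => (sub_val z).2).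
    by move=> t; have [y yE] := quo_surj (h t); exists (ssub (mkE y t yE)).
  have hs := ses_ker hp sp.
  pose K := gker hp.
  have hKf : hom0 (fun z : sub_gmod K => (sub_val (sub_val z)).1).
    exact: hom0_comp (hom0_sub K) hfE.
  have [z|t ht tE] := factor_inj hNf iNf hKf.
    have : D (sub_val (sub_val z)).1.
      apply/(qpi_eq0 D); rewrite difE.
      have -> : (sub_val (sub_val z)).2 = 0 := sub_valP z; exact: hom0_0 hh.
    by move=> [n hn e]; exists (ssub hn).
  have [g hg gE] := hS _ _ _ _ _ hs (hom0_comp ht (hom0_comp (hom0_sub N) (hom0_snd Y W))).
  have hgr : hom0 (fun z : E => ((sub_val z).1, g z) : YW).
    split=> [c u v|a v|n v hv].
    - by rewrite (hom0_lin hfE) (hom0_lin hg).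
    - by rewrite (hom0_act hfE) (hom0_act hg).
    - by split; [exact: hom0_deg hfE _ _ hv | exact: hom0_deg hg _ _ hv].
  pose N' := gim hgr (gfull _).
  have NN' : N `<=` N'.
    move=> z hz; have hD : D z.1 by exists z.
    have e0 : qpi D z.1 = h 0 :> Q by rewrite (hom0_0 hh); apply/(qpi_eq0 D).
    pose x0 : E := ssub (mkE _ _ e0).
    have hx : K x0 by [].
    exists x0 => //; rewrite [RHS]surjective_pairing; congr (_, _).
    have := gE (ssub hx); rewrite /= => ->.
    have ht1 : (sub_val (t (ssub hx))).1 = z.1 := tE (ssub hx).
    apply: (@uniq_val z.1); last by rewrite -surjective_pairing.
    by rewrite -{1}ht1 -surjective_pairing; exact: sub_valP.
  have nb' v : bad v -> ~ N' v.
    move=> [v1 v2] [z _ e]; apply: v2; rewrite -e /=.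
    suff -> : z = 0 by exact: hom0_0 hg.
    have z1 : (sub_val z).1 = 0 by rewrite -v1 -e.
    have z2 : (sub_val z).2 = 0.
      by apply: (hom0_inj0 hh ih); rewrite -difE z1; exact: hom0_0 (hom0_quo D).
    by apply: sub_val_inj; rewrite [LHS]surjective_pairing z1 z2.
  apply: ns; have [y yE] := quo_surj (h s); rewrite -yE; apply/(qpi_eq0 D).
  exists (y, g (ssub (mkE y s yE))) => //; apply: (maxN N' NN' nb').
  by exists (ssub (mkE y s yE)).
have [y|t ht tE] := factor_inj hNf iNf (hom0_id Y).
  by have [n hn e] := total y; exists (ssub hn).
exists (fun y => (sub_val (t y)).2).
  by apply/ghom0P; exact: hom0_comp ht (hom0_comp (hom0_sub N) (hom0_snd Y W)).
apply/funext => x /=; apply: (@uniq_val (i x)); last by apply: N0; exists x.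
by rewrite -{1}[i x]tE -surjective_pairing; exact: sub_valP.
Qed.
End Baer.
End UnitalGraded.

(** * The weight algebras *)

Section WeightAlgebra.
Context (k : fieldType) (A : lualg k) (disp : Order.disp_t) (Lam : porderType disp).
Context (T : triangular_basis A Lam) (l : Lam).
Local Notation kap := (@kap _ _ (Jl T l) (ebar T l)).

Lemma alg_at_lift d (a : alg_at T l) : la_deg (alg_at T l) d a ->
  exists2 a', la_deg A d a' & kap (tb_e T l ** a' ** tb_e T l) = a.
Proof.
move=> [a' ha e]; exists a' => //; rewrite (kap_er (ebarE T l)) (kap_el (ebarE T l)).
have e' : quo_proj (Jl T l) a' = sub_val a := e.
by change (kapq (ebar T l) (quo_proj (Jl T l) a') = a); rewrite e' kapq_id.
Qed.

Lemma alg_at_fd : alg_locally_fd A -> alg_locally_fd (alg_at T l).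
Proof.
move=> A_fd i j d; have [ss [_ _ eS]] := e_sum T l.
pose St := set_type (tb_S T).
have [f hf] := choice (fun st : St * St => A_fd (val st.1) (val st.2) d).
exists (map kap (flatten [seq f (s, t) | s <- ss, t <- ss])) => a [had _ _].
have [a' ha <-] := alg_at_lift had.
apply: (span_map_seq (@kap_lin _ _ (Jl T l) (ebar T l))).
rewrite {1}eS !mulA_suml; apply: ss_sum_seq => s hs.
rewrite eS mulA_sumr; apply: ss_sum_seq => t ht.
have : span [set` f (s, t)] (la_one A (val s) ** a' ** la_one A (val t)).
  apply: hf; split=> /=.
  - rewrite -[d]addr0; apply: la_degM; last exact: la_deg1.
    by rewrite -[d]add0r; apply: la_degM => //; exact: la_deg1.
  - by rewrite !la_mulA la_orth eqxx.
  - by rewrite -!la_mulA la_orth eqxx.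
apply: span_mono => x hx; apply/flattenP; exists (f (s, t)) => //.
by apply/allpairsP; exists (s, t).
Qed.

Lemma alg_at_bb : alg_bounded_below A -> alg_bounded_below (alg_at T l).
Proof.
move=> A_bb i j; have [ss [us _ eS]] := e_sum T l.
pose St := set_type (tb_S T).
have [N hN] := choice (fun st : St * St => A_bb (val st.1) (val st.2)).
pose N0 := \sum_(s <- ss) \sum_(t <- ss) `|N (s, t)|.
exists (- N0) => d lt a had _ _; have [a' ha <-] := alg_at_lift had.
suff -> : tb_e T l ** a' ** tb_e T l = 0 by exact: lin0 (@kap_lin _ _ (Jl T l) (ebar T l)).
rewrite {1}eS !mulA_suml big_seq big1 // => s hs.
rewrite eS mulA_sumr big_seq big1 // => t ht.
have hNs : `|N (s, t)| <= N0.
  rewrite /N0 (bigD1_seq s) //= (bigD1_seq t) //= -addrA lerDl addr_ge0 ?sumr_ge0 //.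
  by move=> x _; apply: sumr_ge0.
apply: (hN (s, t) d) => /=.
- by apply: lt_le_trans lt _; rewrite lerNl; apply: le_trans hNs; rewrite -normrN ler_norm.
- rewrite -[d]addr0; apply: la_degM; last exact: la_deg1.
  by rewrite -[d]add0r; apply: la_degM => //; exact: la_deg1.
- by rewrite !la_mulA la_orth eqxx.
- by rewrite -!la_mulA la_orth eqxx.
Qed.

(** An extension of [N] with middle term [E] gives the surjection [j_! E -> j_! N], whose
    kernel has weight part [U]; a map [U -> W] is a map of this kernel to [j_* W], and its
    extension to [j_! E] restricts to [E]. *)
Lemma ext1z_corner (N W : gmod (alg_at T l)) :
  ext1z (j_shriek T N) (j_star T W) -> ext1z N W.
Proof.
move=> h U E u p f hs hf; have [hu hp iu sp exp] := hs.
pose un (M : gmod (alg_at T l)) : M -> j_shriek T M := @ind_unit _ _ (Jl T l) (ebar T l) M.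
pose co (M : gmod (alg_at T l)) : j_shriek T M -> M := @ind_counit _ _ (Jl T l) (ebar T l) M.
have hco M : wmap (co M) by exact: (ind_counit_mumap (ebarE T l)).
have coK M n : co M (un M n) = n by exact: (ind_counitK (ebarE T l)).
have coA M a n : co M (a |> un M n) = kap a |> n by exact: ind_counit_act.
have hun : hom0 (@ind_unitt _ _ (Jl T l) _ (tb_e_deg T l) (ebar T l) (ebarE T l) N).
  exact: ind_unitt_hom.
have [F hF FE] := shriek_up (hom0_comp hp hun).
have {}FE n : F (un E n) = un N (p n) by exact: FE.
have sF : surj F.
  move=> x; suff : im_ss (hom0_lin hF) (full_ss (j_shriek T E)) x by move=> [y _ <-]; exists y.
  apply: (@shriek_ind _ _ (Jl T l) (ebar T l) N) => a n; have [m <-] := sp n.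
  by exists (a |> un E m) => //; rewrite (hom0_act hF) FE.
have coF x : co N (F x) = p (co E x).
  have l1 : linear (fun x => co N (F x) - p (co E x)).
    apply: lin_eq_ss => c v w; first by rewrite (hom0_lin hF) (mumap_lin (hco N)).
    by rewrite (mumap_lin (hco E)) (hom0_lin hp).
  apply/eqP; rewrite -subr_eq0; apply/eqP.
  apply: (@shriek_ind _ _ (Jl T l) (ebar T l) E (pre_ss l1 (zero_ss N))) => a n.
  change (co N (F (a |> un E n)) - p (co E (a |> un E n)) = 0).
  by rewrite (hom0_act hF) FE !coA (hom0_act hp) subrr.
pose K := gker hF.
have hK : wmap (fun x : sub_gmod K => co E (sub_val x)) := comp_mumap (hom0_sub K) (hco E).
have [x|r hr rE] := mumap_factor_inj hu iu hK.
  by apply/exp; rewrite -coF (sub_valP x) (mumap_0 (hco N)).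
have [g hg gE] := wmap_star (mumap_comp hr hf).
have [G hG GE] := h _ _ _ _ _ (ses_ker hF sF) hg.
exists (fun n => evw (G (un E n))); first exact: std_wmap_iota (evw_wmap hG).
move=> y; have hy : K (un E (u y)).
  rewrite /K /= /preimage /= /set1 /mkset FE.
  have -> : p (u y) = 0 by apply/exp; exists y.
  exact: lin0 (@ind_unit_lin _ _ (Jl T l) (ebar T l) N).
have := GE (ssub hy); rewrite /= => ->; rewrite gE; congr f.
by apply: iu; rewrite rE /= coK.
Qed.

End WeightAlgebra.

Section ShiftProj.
Context (k : fieldType) (A : lualg k).

Lemma shift_projective d (P : gmod A) : projective_gmod P -> projective_gmod (shift d P).
Proof.
move=> hP V W p f /ghom0P hp sp /ghom0P hf.
have hp' : @hom0 _ _ (shift (- d) V) (shift (- d) W) p.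
  by case: hp => p1 p2 p3; split=> // n v; exact: p3.
have hf' : @hom0 _ _ P (shift (- d) W) f.
  case: hf => f1 f2 f3; split=> // n v hv.
  by rewrite /= opprK; apply: f3; rewrite /= addrK.
have [g hg gE] := projP hP hp' sp hf'.
exists g; last by apply/funext.
apply/ghom0P; case: hg => g1 g2 g3; split=> // n v hv.
by have := g3 _ _ hv; rewrite /= opprK subrK.
Qed.
End ShiftProj.

(** * The two criteria *)

Section Main.
Context (k : fieldType) (A : lualg k) (disp : Order.disp_t) (Lam : porderType disp).
Context (T : triangular_basis A Lam).
Context (B : Lam -> Type) (L P : forall l : Lam, B l -> gmod (alg_at T l)).
Hypotheses (A_fd : alg_locally_fd A) (A_bb : alg_bounded_below A)
  (L_full : full_irreducibles L)
  (P_cover : forall (l : Lam) (b : B l), projective_cover (P b) (L b)).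

Let oact (l : Lam) (W : gmod (alg_at T l)) (w : W) : la_one (alg_at T l) tt |> w = w.
Proof. exact: corner_act1. Qed.
Let ol (l : Lam) (a : alg_at T l) : la_one (alg_at T l) tt ** a = a.
Proof. exact: corner_1l. Qed.
Let or (l : Lam) (a : alg_at T l) : a ** la_one (alg_at T l) tt = a.
Proof. exact: corner_1r. Qed.

Lemma std_shift_wmap0 l (N : gmod (alg_at T l)) d m (W : gmod (alg_at T m))
  (phi : shift d (j_shriek T N) -> W) : wmap phi -> m != l -> forall v, phi v = 0.
Proof.
move=> hphi ne v; have [u hu bu] := shift_std N d; have [u' [hu' uK u'K]] := hom0_inverse hu bu.
by rewrite -[v]uK; apply: (std_wmap0 (comp_mumap hu' hphi)).
Qed.

Lemma std_shift_hom l (N : gmod (alg_at T l)) d V (h : shift d N -> topw T l V) :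
  hom0 h -> (exists n, h n <> 0) ->
  exists f : shift d (j_shriek T N) -> V, hom0 f /\ exists x, f x <> 0.
Proof.
move=> hh [n nz]; have [u hu bu] := shift_std N d; have [u' [hu' uK u'K]] := hom0_inverse hu bu.
have [f hf fE] := shriek_up hh; exists (fun x => f (u x)); split; first exact: hom0_comp.
exists (u' (ind_unit (e := ebar T l) (n : shift d N))); rewrite u'K fE => e; apply: nz.
exact: sub_val_inj.
Qed.

Lemma irreducible_iso l (S : gmod (alg_at T l)) : irreducible_gmod S ->
  exists (b : B l) d (f : shift d (L b) -> S), hom0 f /\ bijective f.
Proof.
move=> hS; have [_ h _] := L_full; have [b [d [f /ghom0P hf bf]]] := h l S hS.
have [g [hg fK gK]] := hom0_inverse hf bf.
by exists b, d, g; split=> //; exists f.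
Qed.

Lemma socle_hom l (Y : gmod (alg_at T l)) (y : Y) : bounded_above Y -> y <> 0 ->
  exists (b : B l) d (h : shift d (L b) -> Y), [/\ hom0 h, injective h & exists s, h s <> 0].
Proof.
move=> bY ny.
have [S hS] := socle (@oact l) (@ol l) (@or l)
  (alg_at_fd A_fd) (alg_at_bb A_bb) bY ny.
have [b [d [f [hf bf]]]] := irreducible_iso hS.
have ih : injective (fun x => sub_val (f x)).
  by move=> x x' /sub_val_inj/(bij_inj bf).
exists b, d, (fun x => sub_val (f x)); split=> //; first exact: hom0_comp hf (hom0_sub S).
have [[s ns] _] := hS; have [g fK gK] := bf; exists (g s); rewrite gK => e.
by apply: ns; exact: sub_val_inj.
Qed.

Lemma cover_hom l (Y : gmod (alg_at T l)) (y : Y) : y <> 0 ->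
  exists (b : B l) d (h : shift d (P b) -> Y), hom0 h /\ exists s, h s <> 0.
Proof.
move=> ny; have [S [M hM]] := irreducible_quotient ny.
have [b [d [f [hf bf]]]] := irreducible_iso hM; have [g fK gK] := bf.
have [hP [p [/ghom0P hp sp _]]] := P_cover b.
have hp' : @hom0 _ _ (shift d (P b)) (shift d (L b)) p.
  by case: hp => p1 p2 p3; split=> // n v; exact: p3.
have [h hh hE] := projP (@shift_projective _ _ d _ hP) (hom0_quo M) (@quo_surj _ _ _ M)
  (hom0_comp hp' hf).
exists b, d, (fun x => sub_val (h x)); split; first exact: hom0_comp hh (hom0_sub S).
have [[s ns] _] := hM; have [x xE] := sp (g s); exists x => e; apply: ns.
have e0 : h x = 0 by exact: sub_val_inj.
by have := hE x; rewrite e0 xE gK (hom0_0 (hom0_quo M)) => <-.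
Qed.

(** The test modules are induced from irreducible ones; the acyclic class consists of the
    Tor-free modules, and injectivity of a layer is tested by Baer's criterion. *)
Theorem nabla_criterion V : locally_fd V -> bounded_above V ->
  let D := fun l (b : B l) => j_shriek T (L b) in
  (has_flag (nabla_layer T) V <-> finite_set (hom_supp D V) /\
     (forall l (b : B l), ExtA_zero 1 (D l b) V)) /\
  (finite_set (hom_supp D V) /\ (forall l (b : B l), ExtA_zero 1 (D l b) V) <->
   finite_set (hom_supp D V) /\
     (forall l (b : B l) n, (1 <= n)%N -> ExtA_zero n (D l b) V)).
Proof.
move=> fV bV D.
apply: (@flag_criterion _ _ _ _ T (fun l => @injective_gmod _ (alg_at T l)) B D (tor_free T)).
- move=> U Q N u p hQ hs hN; have tQ := @projective_tor_free _ _ _ _ T Q hQ.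
  exact: tor_free_ker hs hN tQ.
- by move=> N l W hN hW; apply: ext1z_star => //; left.
- move=> l b d; have [u hu bu] := shift_std (L b) d.
  exact: (shriek_tor_free (l := l)).
- by move=> l b d m W phi; exact: std_shift_wmap0.
- by move=> l b; exact: shriek_killed.
- move=> l U bU [v nv]; have [b [d [h [hh _ ns]]]] := socle_hom (topw_ba bU) nv.
  by exists b, d; exact: std_shift_hom hh ns.
- move=> l W fW bW hW.
  apply: (baer (@oact l) (@ol l) (@or l)
    (alg_at_bb A_bb) bW) => Y y bY ny.
  have [b [d [h [hh ih ns]]]] := socle_hom bY ny.
  exists (shift d (L b)), h; split=> //; apply: ext1z_corner.
  by have [u hu bu] := shift_std (L b) d; exact: ext1z_isoM hu bu (hW b d).
- exact: A_bb.
- exact: fV.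
- exact: bV.
Qed.

(** The test modules are induced from projective ones, so that syzygies keep projective
    layers and the coinduced modules may be arbitrary. *)
Theorem nablabar_criterion V : locally_fd V -> bounded_above V ->
  let D := fun l (b : B l) => j_shriek T (P b) in
  (has_flag (nablabar_layer T) V <-> finite_set (hom_supp D V) /\
     (forall l (b : B l), ExtA_zero 1 (D l b) V)) /\
  (finite_set (hom_supp D V) /\ (forall l (b : B l), ExtA_zero 1 (D l b) V) <->
   finite_set (hom_supp D V) /\
     (forall l (b : B l) n, (1 <= n)%N -> ExtA_zero n (D l b) V)).
Proof.
move=> fV bV D.
have -> : nablabar_layer T = @layer _ _ _ _ T (fun l W => True).
  apply/funext => l; apply/funext => M; apply/propext; split.
    by move=> [W [h1 h2 h3]]; exists W.
  by move=> [W [_ h1 h2 h3]]; exists W.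
apply: (@flag_criterion _ _ _ _ T (fun l W => True) B D
  (fun M => tor_free T M /\ has_lifts T M)).
- move=> U Q N u p hQ hs [tN lN].
  have tQ := @projective_tor_free _ _ _ _ T Q hQ; have lQ := @projective_lifts _ _ _ _ T _ hQ.
  by split; [exact: tor_free_ker hs tN tQ | exact: lifts_ker hs tN lN lQ].
- by move=> N l W [tN lN] _; apply: ext1z_star => //; right.
- move=> l b d; split; first exact: (shriek_tor_free (l := l)).
  have [u hu bu] := shift_std (P b) d; have [u' [hu' uK u'K]] := hom0_inverse hu bu.
  have bu' : bijective u' by exists u.
  by apply: lifts_iso hu' bu' _; apply: std_lifts; apply: shift_projective; case: (P_cover b).
- by move=> l b d m W phi; exact: std_shift_wmap0.
- by move=> l b; exact: shriek_killed.
- move=> l U bU [v nv]; have [b [d [h [hh ns]]]] := cover_hom nv.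
  by exists b, d; exact: std_shift_hom hh ns.
- by [].
- exact: A_bb.
- exact: fV.
- exact: bV.
Qed.
End Main.

Theorem theorem8p8 (k : closedFieldType) (A : lualg k)
    (A_fd : alg_locally_fd A) (A_bb : alg_bounded_below A)
    (disp : Order.disp_t) (Lam : porderType disp) (T : triangular_basis A Lam)
    (B : Lam -> Type)
    (L : forall l : Lam, B l -> gmod (alg_at T l)) (L_full : full_irreducibles L)
    (P : forall l : Lam, B l -> gmod (alg_at T l))
    (P_cover : forall (l : Lam) (b : B l), projective_cover (P l b) (L l b))
    (V : gmod A) (V_fd : locally_fd V) (V_ba : bounded_above V) :
  let Delta := fun (l : Lam) (b : B l) => j_shriek T (P l b) in
  let Deltabar := fun (l : Lam) (b : B l) => j_shriek T (L l b) in
  let a1 := has_flag (nabla_layer T) V in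
  let b1 := finite_set (hom_supp Deltabar V) /\
            (forall (l : Lam) (b : B l), ExtA_zero 1 (Deltabar l b) V) in
  let c1 := finite_set (hom_supp Deltabar V) /\
            (forall (l : Lam) (b : B l) (n : nat), (1 <= n)%N ->
               ExtA_zero n (Deltabar l b) V) in
  let a2 := has_flag (nablabar_layer T) V in
  let b2 := finite_set (hom_supp Delta V) /\
            (forall (l : Lam) (b : B l), ExtA_zero 1 (Delta l b) V) in
  let c2 := finite_set (hom_supp Delta V) /\
            (forall (l : Lam) (b : B l) (n : nat), (1 <= n)%N ->
               ExtA_zero n (Delta l b) V) in
  ((a1 <-> b1) /\ (b1 <-> c1)) /\ ((a2 <-> b2) /\ (b2 <-> c2)).
Proof.
move=> Delta Deltabar a1 b1 c1 a2 b2 c2; split.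
  exact: (nabla_criterion A_fd A_bb L_full V_fd V_ba).
exact: (nablabar_criterion A_bb L_full P_cover V_fd V_ba).
Qed.
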